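(* Let $n\geq1$ and let $\Omega^+,\Omega^-\subset\mathbb{R}^{n+1}$ be two disjoint Borel sets. Fix $c_0\in(0,1)$, $x_0\in\mathbb{R}^{n+1}$ and $r_0>0$, and write $B_0=B(x_0,r_0)$. There exists $\delta>0$ such that the following holds. Let $E\subset B_0$ be a Borel set and let $\mu$ be a positive Radon measure supported on $E$ such that $\mu(B(x,r))\leq r^n$ for all $x\in\mathbb{R}^{n+1}$ and $r>0$. If $\mu(B_0)\geq c_0r_0^n$ and $$\int_0^{20r_0}\varepsilon_n(x,r)^2\,\frac{dr}{r}<\delta\quad\text{for all }x\in E,$$ then there exists an $n$-dimensional Lipschitz graph $\Gamma$ with slope at most $1/10$ such that $\mu(\Gamma)\geq\frac{99}{100}\mu(B_0)$. Moreover, the slope of $\Gamma$ can be taken arbitrarily small if $\delta$ is small enough: for every $\eta\in(0,1/10]$ there is $\delta>0$ for which the same conclusion holds with slope at most $\eta$.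
   Context: $S(x,r)=\partial B(x,r)$. For an open affine half-space $H\subset\mathbb{R}^{n+1}$ with $x\in\partial H$, put $S_H^+(x,r)=S(x,r)\cap H$ and $S_H^-(x,r)=S(x,r)\cap(\mathbb{R}^{n+1}\setminus\overline{H})$. For the given pair $\Omega^+,\Omega^-$, $$\varepsilon_n(x,r)=\frac1{r^n}\inf_H\mathcal{H}^n\big((S_H^+(x,r)\setminus\Omega^+)\cup(S_H^-(x,r)\setminus\Omega^-)\big),$$ the infimum being over all open affine half-spaces $H$ with $x\in\partial H$. An $n$-dimensional Lipschitz graph in $\mathbb{R}^{n+1}$ with slope at most $\eta$ is, after a rotation, a set $\{(y,A(y)):y\in\mathbb{R}^n\}$ with $A:\mathbb{R}^n\to\mathbb{R}$ Lipschitz with constant at most $\eta$. *)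

(* Defs.v *)
From HB Require Import structures.
From mathcomp Require Import all_boot all_order all_algebra.
From mathcomp Require Import all_classical all_reals all_analysis.
Set Implicit Arguments.
Unset Strict Implicit.
Unset Printing Implicit Defensive.
Import Order.TTheory GRing.Theory Num.Theory.
Import numFieldNormedType.Exports.
Local Open Scope classical_set_scope.
Local Open Scope ring_scope.

(* R^m is 'rV[R]_m. The library norm on it is the sup norm, so the Euclidean
   notions are introduced separately; the topology is the same, hence [open],
   [closure], [interior] and [compact] below are the library's. *)
Definition dotv (R : realType) (m : nat) (x y : 'rV[R]_m) : R :=
  \sum_(i < m) x 0 i * y 0 i.

Definition enorm (R : realType) (m : nat) (x : 'rV[R]_m) : R :=
  Num.sqrt (dotv x x).

Definition eball (R : realType) (m : nat) (x : 'rV[R]_m) (r : R) :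
    set 'rV[R]_m :=
  [set y | enorm (y - x) < r].

Definition boundary (T : topologicalType) (A : set T) : set T :=
  closure A `\` interior A.

Definition esphere (R : realType) (m : nat) (x : 'rV[R]_m) (r : R) :
    set 'rV[R]_m :=
  boundary (eball x r).

Notation borelV R m := (g_sigma_algebraType (@open 'rV[R]_m)).

Definition borel_set (R : realType) (m : nat) (A : set 'rV[R]_m) : Prop :=
  measurable (A : set (borelV R m)).

Definition radon (R : realType) (m : nat)
    (mu : {measure set (borelV R m) -> \bar R}) : Prop :=
  [/\ forall K : set 'rV[R]_m, compact K -> (mu K < +oo)%E,
      forall V : set 'rV[R]_m, open V ->
        mu V = ereal_sup
          [set mu K | K in [set K : set 'rV[R]_m | compact K /\ K `<=` V]]
    & forall A : set 'rV[R]_m, borel_set A ->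
        mu A = ereal_inf
          [set mu V | V in [set V : set 'rV[R]_m | open V /\ A `<=` V]]].

(* Lebesgue measure of the unit ball of R^k, by the recursion
   omega_k = (2 pi / k) omega_(k-2), omega_0 = 1, omega_1 = 2 *)
Fixpoint unit_ball_volume (R : realType) (k : nat) : R :=
  match k with
  | 0%N => 1
  | 1%N => 2
  | (k'.+1 as k1).+1 => 2 * pi / k1.+1%:R * unit_ball_volume R k'
  end.

(* 0 is adjoined so that the empty set has diameter 0 *)
Definition ediam (R : realType) (m : nat) (U : set 'rV[R]_m) : \bar R :=
  ereal_sup ([set 0%E] `|` [set (enorm (x - y))%:E | x in U & y in U]).

(* k-dimensional Hausdorff (outer) measure, for k >= 1, normalized to agree
   with Lebesgue measure on R^k *)
Definition hausdorff_pre (R : realType) (m k : nat) (d : R)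
    (A : set 'rV[R]_m) : \bar R :=
  ereal_inf [set s | exists U : nat -> set 'rV[R]_m,
    [/\ A `<=` \bigcup_i U i,
        forall i, (ediam (U i) <= d%:E)%E
      & s = (\sum_(i <oo)
               ((unit_ball_volume R k / 2 ^+ k)%:E * ediam (U i) ^+ k))%E]].

Definition hausdorff (R : realType) (m k : nat) (A : set 'rV[R]_m) : \bar R :=
  ereal_sup [set hausdorff_pre k d A | d in [set d : R | 0 < d]].

Definition open_halfspace (R : realType) (m : nat) (H : set 'rV[R]_m) : Prop :=
  exists (v : 'rV[R]_m) (c : R), v != 0 /\ H = [set y | c < dotv v y].

Definition sphere_pos (R : realType) (m : nat) (H : set 'rV[R]_m)
    (x : 'rV[R]_m) (r : R) : set 'rV[R]_m :=
  esphere x r `&` H.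

Definition sphere_neg (R : realType) (m : nat) (H : set 'rV[R]_m)
    (x : 'rV[R]_m) (r : R) : set 'rV[R]_m :=
  esphere x r `&` ~` closure H.

Definition epsilon_coef (R : realType) (n : nat) (Op Om : set 'rV[R]_(n + 1))
    (x : 'rV[R]_(n + 1)) (r : R) : \bar R :=
  ((r ^- n)%:E * ereal_inf
    [set hausdorff n ((sphere_pos H x r `\` Op) `|` (sphere_neg H x r `\` Om))
       | H in [set H : set 'rV[R]_(n + 1) |
                 open_halfspace H /\ boundary H x]])%E.

Definition is_rotation (R : realType) (m : nat) (Q : 'M[R]_m) : Prop :=
  Q *m Q^T = 1%:M /\ \det Q = 1.

(* No translation is needed: translates of graphs are graphs *)
Definition lipschitz_graph (R : realType) (n : nat) (eta : R)
    (G : set 'rV[R]_(n + 1)) : Prop :=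
  exists (Q : 'M[R]_(n + 1)) (A : 'rV[R]_n -> R),
    [/\ is_rotation Q,
        forall y z : 'rV[R]_n, `|A y - A z| <= eta * enorm (y - z)
      & G = [set row_mx y (A y)%:M *m Q | y in [set: 'rV[R]_n]]].

(* Main.v *)
Require Import Defs.
From HB Require Import structures.
From mathcomp Require Import all_boot all_order all_algebra.
From mathcomp Require Import all_classical all_reals all_analysis.
From mathcomp Require Import measurable_realfun ring lra zify.
Set Implicit Arguments.
Unset Strict Implicit.
Unset Printing Implicit Defensive.
Import Order.TTheory GRing.Theory Num.Theory.
Import numFieldNormedType.Exports.
Local Open Scope classical_set_scope.
Local Open Scope ring_scope.

(* Since delta may depend on Omega^+ and Omega^-, a compactness argument suffices.
   Write I(x) for the integral of the hypothesis and Z for the set of limits of points x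
   with I(x) -> 0.

   At each z in Z, continuity of translation in L^1 gives two exact symmetries: Omega^+ and
   Omega^- are exchanged a.e. by the reflection through z, and, for each choice of a "vertical"
   direction, on almost every upper hemisphere about z one of the two sets meets almost every
   pair {v, Tv}, T being the reflection in the vertical axis. Composing the central symmetries at z and at
   z + e shows that Omega^+ is 2e-periodic near z, hence periodic under arbitrarily short
   vectors, hence invariant under the span of the directions in which Z accumulates at z.

   If this span contains a hyperplane V, then Omega^+ is a.e. constant on almost every slice
   parallel to V and, by the second symmetry, on almost every hemisphere about z; so it is a.e.
   constant on each side of z + V. Off z + V the central symmetry then fails badly at small
   scales and I is bounded below by a dimensional constant: for small delta the set E lies in
   the hyperplane z + V.

   Otherwise Z is locally contained in affine subspaces of dimension less than n, so it is
   covered by finitely many balls with sum of r^n less than c_0 r_0^n. For small delta these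
   balls cover E, which contradicts mu(B_0) >= c_0 r_0^n. *)

(** * Lebesgue measure on row vectors *)

(** Hausdorff measure on spheres enters only through lower bounds: a subset of a hemisphere is
    compared with its orthogonal projection to R^n ([shadow]), at the price of the crude factor
    [covK]. Integrating shadows over r replaces polar coordinates; this degenerates at the equator,
    hence the cut-offs [upper kap].

    Projecting requires a vertical axis, but the hyperplane V is known only late. All coordinates
    are therefore relative to an arbitrary orthogonal matrix [Q], fixed once V is known.

    Two obstacles shape the middle of the proof. The function r -> epsilon(x, r) comes without
    measurability, so its integral is only compared with integrals of smaller functions. And the
    symmetries hold on half-balls only, so periods are local: a long vector spanned by short periods
    is reached by staying close to a segment, with an error that vanishes because at most n + 1
    periods are combined at each scale.

    Two symmetries are used because the central one allows layers: a set invariant along V may still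
    alternate with the height. Hemispheres cross many heights and exclude this. *)

Lemma open_rV_bigcup_ball (R : realType) (m : nat) (U : set 'rV[R]_m) :
  open U ->
  U = \bigcup_(k : nat)
        (if @unpickle ('rV[rat]_m * nat)%type k is Some (q, j) then
           (if pselect (ball (map_mx ratr q : 'rV[R]_m) j.+1%:R^-1 `<=` U)
            then ball (map_mx ratr q : 'rV[R]_m) j.+1%:R^-1 else set0)
         else set0).
Proof.
move=> oU; rewrite eqEsubset; split; last first.
  move=> x [k _]; case: unpickle => [[q j]|] //; case: pselect => // qU.
  exact: qU.
move=> x Ux.
have /nbhs_ballP[e /= e0 eU] : nbhs x U by exact: open_nbhs_nbhs.
(* Since 2/(j+1) < e, the ball of radius 1/(j+1) about a rational point that close to x stays inside
   [ball x e]. *)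
pose j := Num.truncn (2 / e).
have j0 : (0 : R) < j.+1%:R^-1 by rewrite invr_gt0.
have je : (j.+1%:R^-1 : R) * 2 < e.
  rewrite mulrC -ltr_pdivlMr // ?invr_gt0 // invrK mulrC -ltr_pdivrMr //.
  by rewrite truncnS_gt // divr_ge0 // ltW.
have xq i : {q : rat | x 0 i - j.+1%:R^-1 < ratr q < x 0 i + j.+1%:R^-1}.
  apply: cid; have [|q qx] := @rat_in_itvoo R (x 0 i - j.+1%:R^-1) (x 0 i + j.+1%:R^-1).
    by rewrite ltrBlDr -addrA ltrDl addr_gt0.
  by exists q; move: qx; rewrite in_itv.
pose q : 'rV[rat]_m := \row_i sval (xq i).
have qx : ball (map_mx ratr q : 'rV[R]_m) j.+1%:R^-1 x.
  split=> // i i'; rewrite !mxE (ord1 i) /ball /= distrC.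
  by have := svalP (xq i'); rewrite ltr_distlC => /andP[? ?]; apply/andP; split;
    rewrite // -?ltrBlDr // ltrBlDr.
exists (pickle (q, j)) => //; rewrite pickleK; case: pselect => // -[].
move=> y qy; apply: eU; apply: le_ball (ltW je) _ _.
by rewrite mulr2n mulrDr mulr1; apply: ball_triangle qy; exact: ball_sym.
Qed.

(** Sup-norm balls are boxes, so each of the countably many balls making up an open set pulls back
    to a finite intersection of coordinate preimages. *)
Lemma measurable_fun_rV (R : realType) (m : nat) d (T : measurableType d)
    (F : T -> 'rV[R]_m) :
  (forall i, measurable_fun setT (fun x => F x 0 i : measurableTypeR R)) ->
  measurable_fun setT (F : T -> borelV R m).
Proof.
move=> mF; apply: (@measurability _ _ _ (borelV R m) _ _ (@open 'rV[R]_m)) => //.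
move=> _ [U oU <-]; rewrite setTI (open_rV_bigcup_ball oU) preimage_bigcup.
apply: bigcupT_measurable => k; case: unpickle => [[q j]|]; last first.
  by rewrite preimage_set0.
case: ifPn => _; last by rewrite preimage_set0.
rewrite (_ : _ @^-1` _ = \bigcap_(i in [set: 'I_m])
  ((fun x => F x 0 i : measurableTypeR R) @^-1`
     (ball (ratr (q 0 i) : R) j.+1%:R^-1))); last first.
  rewrite eqEsubset; split => x /=.
    by move=> [_ H] i _ /=; have := H 0 i; rewrite mxE.
  by move=> H; split => // i' i; rewrite mxE (ord1 i'); exact: H.
apply: fin_bigcap_measurable => // i _.
rewrite -[X in measurable X]setTI; apply: mF => //.
by rewrite ball_itv; exact: measurable_itv.
Qed.

Lemma open_borel_set (R : realType) (m : nat) (U : set 'rV[R]_m) :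
  open U -> borel_set U.
Proof. by move=> oU; apply: sub_sigma_algebra. Qed.

Lemma closed_borel_set (R : realType) (m : nat) (U : set 'rV[R]_m) :
  closed U -> borel_set U.
Proof.
move=> cU; rewrite /borel_set -[U]setCK; apply: measurableC.
by apply: open_borel_set; exact: closed_openC.
Qed.

Lemma measurable_coord (R : realType) (m : nat) (i : 'I_m) :
  measurable_fun setT (fun x : borelV R m => x 0 i : measurableTypeR R).
Proof.
apply: (measurability _ (RGenOpens.measurableE R)).
move=> _ [_ [a [b ->] <-]]; rewrite setTI; apply: open_borel_set.
apply: open_comp => [x _|]; [exact: coord_continuous|exact: interval_open].
Qed.

(** * Push-forwards, and Lebesgue measure on R^n built from them *)

Section mpush.
Local Open Scope ereal_scope.
Context d d' (T1 : measurableType d) (T2 : measurableType d') (R : realType).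
Variables (m : {measure set T1 -> \bar R}) (f : T1 -> T2).

(** The measurability proof is an argument so that the measure structure can be inferred from the
    term. *)
Definition mpush of measurable_fun [set: T1] f := pushforward m f.

Hypothesis mf : measurable_fun [set: T1] f.

Let mpush0 : mpush mf set0 = 0.
Proof. by rewrite /mpush /pushforward preimage_set0 measure0. Qed.

Let mpush_ge0 A : 0 <= mpush mf A.
Proof. exact: measure_ge0. Qed.

Let mpush_sigma_additive : semi_sigma_additive (mpush mf).
Proof.
move=> F mF tF mUF; rewrite /mpush /pushforward preimage_bigcup.
apply: measure_semi_sigma_additive.
- by move=> n; rewrite -[X in measurable X]setTI; exact: mf.
- apply/trivIsetP => /= i j _ _ ij; rewrite -preimage_setI.
  by move/trivIsetP : tF => /(_ _ _ _ _ ij) ->//; rewrite preimage_set0.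
- by rewrite -preimage_bigcup -[X in measurable X]setTI; exact: mf.
Qed.

HB.instance Definition _ := isMeasure.Build _ _ _
  (mpush mf) mpush0 mpush_ge0 mpush_sigma_additive.

End mpush.

Section mpush_can.
Local Open Scope ereal_scope.
Context d d' (T1 : measurableType d) (T2 : measurableType d') (R : realType).
Variables (m : {sigma_finite_measure set T1 -> \bar R}).
Variables (f : T1 -> T2) (g : T2 -> T1).

(** A push-forward may lose sigma-finiteness. A measurable left inverse [g] preserves it: the sets
    g^-1(F k) exhaust the target and pull back under f to F k. *)
Definition mpush_can of measurable_fun [set: T1] f & measurable_fun [set: T2] g
  & cancel f g := pushforward m f.

Hypotheses (mf : measurable_fun [set: T1] f) (mg : measurable_fun [set: T2] g).
Hypothesis fg : cancel f g.

HB.instance Definition _ := Measure.copy (mpush_can mf mg fg) (mpush m mf).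

Let mpush_can_sigma_finite : sigma_finite setT (mpush_can mf mg fg).
Proof.
have [F TF Foo] := sigma_finiteT m.
exists (fun k => g @^-1` F k).
  by rewrite -preimage_bigcup -TF preimage_setT.
move=> k; have [mFk Fk] := Foo k; split.
  by rewrite -[X in measurable X]setTI; exact: mg.
rewrite /mpush_can /pushforward (_ : _ @^-1` _ = F k)//.
by apply/seteqP; split=> x /=; rewrite fg.
Qed.

HB.instance Definition _ := Measure_isSigmaFinite.Build _ _ _
  (mpush_can mf mg fg) mpush_can_sigma_finite.

End mpush_can.

Definition consv (R : Type) (n : nat) (p : R * 'rV[R]_n) : 'rV[R]_n.+1 :=
  \row_i (if unlift ord0 i is Some j then p.2 0 j else p.1).

Definition unconsv (R : Type) (n : nat) (v : 'rV[R]_n.+1) : R * 'rV[R]_n :=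
  (v 0 ord0, \row_j v 0 (lift ord0 j)).

Lemma consvK (R : Type) (n : nat) : cancel (@consv R n) (@unconsv R n).
Proof.
move=> [t y]; rewrite /unconsv /consv /= mxE unlift_none /=; congr pair.
by apply/rowP => j; rewrite !mxE liftK.
Qed.

Lemma measurable_consv (R : realType) (n : nat) :
  measurable_fun setT (@consv R n : measurableTypeR R * borelV R n -> borelV R n.+1).
Proof.
apply: measurable_fun_rV => i.
rewrite (_ : (fun _ => _) = fun x : R * 'rV[R]_n =>
  if unlift ord0 i is Some j then x.2 0 j else x.1); last first.
  by apply/funext => x; rewrite mxE.
case: unlift => [j|]; last exact: measurable_fst.
exact: (measurableT_comp (@measurable_coord R n j) measurable_snd).
Qed.

Lemma measurable_unconsv (R : realType) (n : nat) :
  measurable_fun setT (@unconsv R n : borelV R n.+1 -> measurableTypeR R * borelV R n).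
Proof.
apply: measurable_fun_pair; first exact: measurable_coord.
apply: measurable_fun_rV => i.
rewrite (_ : (fun _ => _) = fun x : 'rV[R]_n.+1 => x 0 (lift ord0 i)).
  exact: measurable_coord.
by apply/funext => x; rewrite mxE.
Qed.

(* The canonical sigma-finite structure of [\x] is shadowed by the one on products of
   probability measures, hence this copy. *)
Section sigma_finite_product.
Local Open Scope ereal_scope.
Context d1 d2 (T1 : measurableType d1) (T2 : measurableType d2) (R : realType).
Variables (m1 : {sigma_finite_measure set T1 -> \bar R}).
Variables (m2 : {sigma_finite_measure set T2 -> \bar R}).

Definition sprod : set (T1 * T2) -> \bar R := m1 \x m2.

HB.instance Definition _ := Measure.copy sprod
  (m1 \x m2 : {measure set (T1 * T2)%type -> \bar R}).

Let sprod_sigma_finite : sigma_finite setT sprod.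
Proof.
have [F TF Foo] := sigma_finiteT m1; have [G TG Goo] := sigma_finiteT m2.
exists (fun k => if @unpickle (nat * nat)%type k is Some (i, j)
  then F i `*` G j else set0).
  apply/esym/seteqP; split => // -[x y] _.
  have [i _ Fx] : (\bigcup_i F i) x by rewrite -TF.
  have [j _ Gy] : (\bigcup_i G i) y by rewrite -TG.
  by exists (pickle (i, j)) => //; rewrite pickleK.
move=> k; case: unpickle => [[i j]|]; last by rewrite measure0.
have [mF Fi] := Foo i; have [mG Gj] := Goo j.
split; first exact: measurableX.
by rewrite /sprod product_measure1E// lte_mul_pinfty// ge0_fin_numE.
Qed.

HB.instance Definition _ := Measure_isSigmaFinite.Build _ _ _ sprod sprod_sigma_finite.

End sigma_finite_product.

Definition cons_measure (R : realType) (n : nat)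
    (m : {sigma_finite_measure set (borelV R n) -> \bar R}) :
    {sigma_finite_measure set (borelV R n.+1) -> \bar R} :=
  mpush_can (sprod (@lebesgue_measure R) m) (@measurable_consv R n) (@measurable_unconsv R n) (@consvK R n).

(** Lebesgue measure, starting from the unit mass on the one-point space. The recursion makes Fubini
    in the first coordinate hold by definition ([lebS]); [leb_affine], [leb_cbox] and [radial_null]
    rely on it. *)
Fixpoint leb (R : realType) (n : nat) :
    {sigma_finite_measure set (borelV R n) -> \bar R} :=
  match n with
  | 0%N => \d_ (0 : borelV R 0)
  | k.+1 => cons_measure (leb R k)
  end.

Lemma lebS (R : realType) (n : nat) (A : set 'rV[R]_n.+1) :
  leb R n.+1 A = (@lebesgue_measure R \x leb R n)%E (@consv R n @^-1` A).
Proof. by []. Qed.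

Lemma measurable_preimageT d1 d2 (T1 : measurableType d1) (T2 : measurableType d2)
    (f : T1 -> T2) (A : set T2) :
  measurable_fun setT f -> measurable A -> measurable (f @^-1` A).
Proof. by move=> mf mA; rewrite -[X in measurable X]setTI; exact: mf. Qed.

Lemma product_measure_preimage d1 d2 (T1 : measurableType d1)
    (T2 : measurableType d2) (R : realType)
    (m1 : {sigma_finite_measure set T1 -> \bar R})
    (m2 : {sigma_finite_measure set T2 -> \bar R})
    (f1 : T1 -> T1) (f2 : T2 -> T2) :
  measurable_fun setT f1 -> measurable_fun setT f2 ->
  (forall A, measurable A -> m1 (f1 @^-1` A) = m1 A) ->
  (forall A, measurable A -> m2 (f2 @^-1` A) = m2 A) ->
  forall A, measurable A ->
  (m1 \x m2)%E ((fun p => (f1 p.1, f2 p.2)) @^-1` A) = (m1 \x m2)%E A.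
Proof.
move=> mf1 mf2 h1 h2 A mA.
have mF : measurable_fun setT (fun p : T1 * T2 => (f1 p.1, f2 p.2)).
  by apply: measurable_fun_pair; exact: measurableT_comp.
pose m12 : {measure set (T1 * T2)%type -> \bar R} := (m1 \x m2)%E.
rewrite -[LHS]/(mpush m12 mF A).
apply/esym/(product_measure_unique (m' := mpush m12 mF)) => //.
move=> B C mB mC.
rewrite /= /mpush /pushforward (_ : _ @^-1` _ = (f1 @^-1` B) `*` (f2 @^-1` C)) //.
rewrite /m12 product_measure1E; [|exact: measurable_preimageT..].
by congr (_ * _)%E; [exact: h1|exact: h2].
Qed.

Lemma measurable_scale_add (R : realType) (b a : R) :
  measurable_fun setT (fun t : measurableTypeR R => b * t + a : measurableTypeR R).
Proof. exact/measurable_funD. Qed.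

(** For translations, both measures agree on half-open intervals and uniqueness applies; b = -1 adds
    the reflection t -> -t. These two signs are what the central symmetries and [flip] require. *)
Lemma lebesgue_measure_affine (R : realType) (b a : R) (A : set R) :
  b = 1 \/ b = -1 -> measurable (A : set (measurableTypeR R)) ->
  lebesgue_measure ((fun t => b * t + a) @^-1` A) = lebesgue_measure A.
Proof.
have tr c (B : set R) : measurable (B : set (measurableTypeR R)) ->
    lebesgue_measure ((fun t => t + c) @^-1` B) = lebesgue_measure B.
  have mF : measurable_fun setT (fun t : measurableTypeR R => t + c : measurableTypeR R).
    exact/measurable_funD.
  move=> mB; apply/esym.
  apply: (@lebesgue_measure_unique R (mpush lebesgue_measure mF)) => //=.
  move=> _ [[x y] _ <-]; rewrite /mpush /pushforward.
  rewrite (_ : _ @^-1` _ = `]x - c, y - c]%classic); last first.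
    by apply/seteqP; split=> t /=; rewrite !in_itv /= ltrBlDr lerBrDr.
  rewrite !lebesgue_measure_itv /= !lte_fin ltrD2r.
  by case: ifP => // _; congr EFin; rewrite opprB addrA subrK.
move=> [] -> mA.
  rewrite (_ : (fun _ => _) = (fun t => t + a)); first exact: tr.
  by apply/funext => t; rewrite mul1r.
rewrite (_ : (fun _ => _) = (fun t => t + a) \o -%R); last first.
  by apply/funext => t /=; rewrite mulN1r.
rewrite comp_preimage; have := @lebesgue_measureN R ((fun t => t + a) @^-1` A).
rewrite /pushforward => -> //; first exact: tr.
apply: (@measurable_preimageT _ _ (measurableTypeR R) (measurableTypeR R)) => //.
exact/measurable_funD.
Qed.

Lemma measurable_affine_rV (R : realType) (n : nat) (b : R) (a : 'rV[R]_n) :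
  measurable_fun setT (fun y : borelV R n => b *: y + a : borelV R n).
Proof.
apply: measurable_fun_rV => i.
rewrite (_ : (fun _ => _) = fun y : 'rV[R]_n => b * y 0 i + a 0 i); last first.
  by apply/funext => y; rewrite !mxE.
exact: (measurableT_comp (measurable_scale_add b (a 0 i)) (@measurable_coord R n i)).
Qed.

Lemma leb_affine (R : realType) (n : nat) (b : R) (a : 'rV[R]_n) (A : set 'rV[R]_n) :
  b = 1 \/ b = -1 -> borel_set A ->
  leb R n ((fun y => b *: y + a) @^-1` A) = leb R n A.
Proof.
move=> hb; elim: n a A => [|n IH] a A mA.
  rewrite (_ : (fun _ => _) = id) // ; apply/funext => y.
  by rewrite [LHS]thinmx0 [RHS]thinmx0.
rewrite !lebS.
rewrite (_ : _ @^-1` _ = (fun p : R * 'rV[R]_n =>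
   (b * p.1 + a 0 0, b *: p.2 + (unconsv a).2)) @^-1` (@consv R n @^-1` A)).
  apply: (@product_measure_preimage _ _ (measurableTypeR R) (borelV R n) R
    lebesgue_measure (leb R n) (fun t => b * t + a 0 0)
    (fun y => b *: y + (unconsv a).2)).
  - exact: measurable_scale_add.
  - exact: measurable_affine_rV.
  - by move=> B mB; exact: lebesgue_measure_affine.
  - by move=> B mB; exact: IH.
  - exact: (measurable_preimageT (@measurable_consv R n) mA).
have E (p : R * 'rV[R]_n) : b *: consv p + a =
    consv (b * p.1 + a 0 0, b *: p.2 + (unconsv a).2).
  apply/rowP => i; rewrite !mxE /=.
  by case: unliftP => [j ->|->]; rewrite ?mxE.
by rewrite /preimage; apply/funext => p /=; rewrite E.
Qed.

Definition cbox (R : realType) (n : nat) (c : 'rV[R]_n) (d : R) : set 'rV[R]_n :=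
  [set y | forall i, `|y 0 i - c 0 i| <= d].

Lemma closed_cbox (R : realType) (n : nat) (c : 'rV[R]_n) (d : R) :
  closed (cbox c d).
Proof.
rewrite (_ : cbox c d = \bigcap_(i in [set: 'I_n])
    ((fun y : 'rV[R]_n => y 0 i) @^-1` `[c 0 i - d, c 0 i + d])).
  apply: closed_bigI => i _; apply: closed_comp.
    by move=> y _; exact: coord_continuous.
  exact: interval_closed.
apply/seteqP; split => y /=.
  by move=> H i _ /=; have := H i; rewrite ler_distl in_itv.
by move=> H i; rewrite ler_distl; have := H i I; rewrite /= in_itv.
Qed.

Lemma leb_cbox (R : realType) (n : nat) (c : 'rV[R]_n) (d : R) :
  0 <= d -> leb R n (cbox c d) = ((2 * d) ^+ n)%:E.
Proof.
move=> d0; elim: n c => [|n IH] c.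
  rewrite /= /dirac indicE mem_set ?expr0 //.
  by move=> -[].
have E : @consv R n @^-1` cbox c d =
    `[c 0 0 - d, c 0 0 + d]%classic `*` cbox (unconsv c).2 d.
  apply/seteqP; split => -[t y] /=.
    move=> H; split.
      by have := H 0; rewrite mxE unlift_none ler_distl in_itv.
    by move=> i; have := H (lift ord0 i); rewrite !mxE liftK.
  rewrite in_itv /= -ler_distl => -[h1 h2] i; rewrite mxE.
  by case: unliftP => [j ->|->] //=; have := h2 j; rewrite mxE.
have mb : measurable (cbox (unconsv c).2 d : set (borelV R n)).
  exact: (closed_borel_set (@closed_cbox R n (unconsv c).2 d)).
rewrite lebS E product_measure1E // IH exprS EFinM; congr (_ * _)%E.
rewrite /= lebesgue_measure_itv /= lte_fin.
case: ltP => [_|dd]; first by rewrite -EFinD; congr EFin; ring.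
by congr EFin; lra.
Qed.

(** * Euclidean norm *)

Section euclidean.
Variables (R : realType) (m : nat).
Implicit Types (x y z : 'rV[R]_m) (a b r : R).

Lemma dotvC x y : dotv x y = dotv y x.
Proof. by apply: eq_bigr => i _; rewrite mulrC. Qed.

Lemma dotvDl x y z : dotv (x + y) z = dotv x z + dotv y z.
Proof. by rewrite /dotv -big_split; apply: eq_bigr => i _; rewrite mxE mulrDl. Qed.

Lemma dotvZl a x y : dotv (a *: x) y = a * dotv x y.
Proof. by rewrite /dotv mulr_sumr; apply: eq_bigr => i _; rewrite mxE mulrA. Qed.

Lemma dotvNl x y : dotv (- x) y = - dotv x y.
Proof. by rewrite -scaleN1r dotvZl mulN1r. Qed.

Lemma dotvBl x y z : dotv (x - y) z = dotv x z - dotv y z.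
Proof. by rewrite dotvDl dotvNl. Qed.

Lemma dotvDr x y z : dotv z (x + y) = dotv z x + dotv z y.
Proof. by rewrite ![dotv z _]dotvC dotvDl. Qed.

Lemma dotvZr a x y : dotv x (a *: y) = a * dotv x y.
Proof. by rewrite dotvC dotvZl dotvC. Qed.

Lemma dotvNr x y : dotv x (- y) = - dotv x y.
Proof. by rewrite dotvC dotvNl dotvC. Qed.

Lemma dotvBr x y z : dotv z (x - y) = dotv z x - dotv z y.
Proof. by rewrite dotvDr dotvNr. Qed.

Lemma dotv0r x : dotv x 0 = 0.
Proof. by rewrite -(scale0r x) dotvZr mul0r. Qed.

Lemma dotv0l x : dotv 0 x = 0.
Proof. by rewrite dotvC dotv0r. Qed.

Lemma dotvE x y : dotv x y = (x *m y^T) 0 0.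
Proof. by rewrite mxE; apply: eq_bigr => i _; rewrite mxE. Qed.

Lemma dotv_ge0 x : 0 <= dotv x x.
Proof. by apply: sumr_ge0 => i _; rewrite -expr2 sqr_ge0. Qed.

Lemma dotv_eq0 x : (dotv x x == 0) = (x == 0).
Proof.
apply/eqP/eqP => [/eqP|->]; last by rewrite dotv0l.
rewrite psumr_eq0 => [|i _]; last by rewrite -expr2 sqr_ge0.
move=> /allP H; apply/rowP => i; rewrite mxE.
by have := H i (mem_index_enum i); rewrite -expr2 sqrf_eq0 => /eqP.
Qed.

Lemma enorm_ge0 x : 0 <= enorm x.
Proof. exact: sqrtr_ge0. Qed.

Lemma enorm_sqr x : enorm x ^+ 2 = dotv x x.
Proof. by rewrite sqr_sqrtr // dotv_ge0. Qed.

Lemma enorm0 : enorm (0 : 'rV[R]_m) = 0.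
Proof. by rewrite /enorm dotv0l sqrtr0. Qed.

Lemma enorm_eq0 x : (enorm x == 0) = (x == 0).
Proof. by rewrite -dotv_eq0 -enorm_sqr sqrf_eq0. Qed.

Lemma enormN x : enorm (- x) = enorm x.
Proof. by rewrite /enorm dotvNl dotvNr opprK. Qed.

Lemma enormB x y : enorm (x - y) = enorm (y - x).
Proof. by rewrite -enormN opprB. Qed.

Lemma enormZ a x : enorm (a *: x) = `|a| * enorm x.
Proof. by rewrite /enorm dotvZl dotvZr mulrA sqrtrM ?sqr_ge0// -expr2 sqrtr_sqr. Qed.

Lemma dotv_sqr_le x y : dotv x y ^+ 2 <= dotv x x * dotv y y.
Proof.
have [->|y0] := eqVneq y 0; first by rewrite !dotv0r mulr0 expr0n.
have Y0 : 0 < dotv y y by rewrite lt_def dotv_ge0 dotv_eq0 y0.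
have := dotv_ge0 (dotv y y *: x - dotv x y *: y).
rewrite dotvBl !dotvBr !dotvZl !dotvZr (dotvC y x) => H.
suff : 0 <= dotv y y * (dotv x x * dotv y y - dotv x y ^+ 2).
  by rewrite pmulr_rge0 // subr_ge0.
by apply: le_trans H _; rewrite le_eqVlt; apply/orP; left; apply/eqP; ring.
Qed.

Lemma dotv_le x y : `|dotv x y| <= enorm x * enorm y.
Proof.
rewrite -(@ler_pXn2r _ 2) ?nnegrE ?mulr_ge0 ?enorm_ge0 //.
by rewrite exprMn !enorm_sqr real_normK ?num_real // dotv_sqr_le.
Qed.

Lemma enormD x y : enorm (x + y) <= enorm x + enorm y.
Proof.
rewrite -(@ler_pXn2r _ 2) ?nnegrE ?addr_ge0 ?enorm_ge0 // enorm_sqr sqrrD !enorm_sqr.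
rewrite dotvDl !dotvDr (dotvC y x).
have := le_trans (ler_norm _) (dotv_le x y).
lra.
Qed.

Lemma enorm_triangle y x z : enorm (x - z) <= enorm (x - y) + enorm (y - z).
Proof. by rewrite (_ : x - z = (x - y) + (y - z)) ?enormD // addrA subrK. Qed.

Lemma coord_le_enorm x i : `|x 0 i| <= enorm x.
Proof.
rewrite -(@ler_pXn2r _ 2) ?nnegrE ?enorm_ge0 // enorm_sqr real_normK ?num_real //.
rewrite /dotv (bigD1 i) //= -expr2 lerDl.
by apply: sumr_ge0 => j _; rewrite -expr2 sqr_ge0.
Qed.

Lemma enorm_delta i : enorm (delta_mx 0 i : 'rV[R]_m) = 1.
Proof.
rewrite /enorm /dotv (bigD1 i) //= big1 ?addr0; last first.
  by move=> j ji; rewrite !mxE (negbTE ji) andbF mulr0.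
by rewrite !mxE !eqxx mulr1 sqrtr1.
Qed.

Lemma enorm_sum (I : Type) (s : seq I) (P : pred I) (F : I -> 'rV[R]_m) :
  enorm (\sum_(i <- s | P i) F i) <= \sum_(i <- s | P i) enorm (F i).
Proof.
elim/big_ind2: _ => [|a b c d ab cd|i _] //; first by rewrite enorm0.
by apply: le_trans (enormD _ _) _; exact: lerD.
Qed.

Lemma enorm_le_sum x : enorm x <= \sum_(i < m) `|x 0 i|.
Proof.
rewrite {1}(row_sum_delta x); apply: le_trans (enorm_sum _ _ _) _.
by apply: ler_sum => i _; rewrite enormZ enorm_delta mulr1.
Qed.

Lemma norm_le_enorm x : `|x| <= enorm x.
Proof.
rewrite /Num.norm /= mx_normrE; apply/bigmax_leP; split; first exact: enorm_ge0.
by move=> [i j] _ /=; rewrite (ord1 i); exact: coord_le_enorm.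
Qed.

Lemma coord_le_norm x i : `|x 0 i| <= `|x|.
Proof.
rewrite /Num.norm /= mx_normrE.
exact: (@le_bigmax _ _ _ 0 (fun ij : 'I_1 * 'I_m => `|x ij.1 ij.2|) (0, i)).
Qed.

Lemma enorm_le_norm x : enorm x <= m%:R * `|x|.
Proof.
apply: le_trans (enorm_le_sum x) _.
apply: (@le_trans _ _ (\sum_(i < m) `|x|)).
  by apply: ler_sum => i _; exact: coord_le_norm.
by rewrite sumr_const card_ord mulr_natl.
Qed.

(** The bridge between the sup-norm topology of the library and Euclidean balls, from |x| <= enorm x
    <= m |x|. *)
Lemma nbhs_eballP x (A : set 'rV[R]_m) :
  nbhs x A <-> exists2 e, 0 < e & eball x e `<=` A.
Proof.
split=> [/nbhs_ballP[e /= e0 eA]|[e e0 eA]].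
  exists e => // y xy; apply: eA; rewrite -ball_normE /ball_ /= distrC.
  exact: le_lt_trans (norm_le_enorm _) xy.
(* [m.+1] rather than m keeps the radius positive when m = 0. *)
apply/nbhs_ballP; exists (e / m.+1%:R); first by rewrite /= divr_gt0.
move=> y; rewrite -ball_normE /ball_ /= distrC ltr_pdivlMr // => xy.
apply: eA; rewrite /eball /=; apply: le_lt_trans (enorm_le_norm _) _.
apply: le_lt_trans xy; rewrite mulrC ler_wpM2l // ?normr_ge0 // ler_nat //.
Qed.

Lemma open_eball x r : open (eball x r).
Proof.
rewrite openE => y xy; apply/nbhs_eballP; exists (r - enorm (y - x)).
  by rewrite subr_gt0.
move=> z; rewrite /eball /= => zy.
by apply: le_lt_trans (enorm_triangle y _ _) _; rewrite -ltrBrDr.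
Qed.

Lemma continuous_dotv x : continuous (dotv x : 'rV[R]_m -> R).
Proof.
move=> y A /nbhs_ballP[e /= e0 eA]; apply/nbhs_eballP.
have x1 : 0 < enorm x + 1 by rewrite ltr_wpDl ?enorm_ge0.
exists (e / (enorm x + 1)) => [|z yz]; first by rewrite divr_gt0.
apply: eA; rewrite /ball /= distrC -dotvBr; apply: le_lt_trans (dotv_le _ _) _.
move: yz; rewrite /eball /= ltr_pdivlMr // => yz.
by apply: le_lt_trans yz; rewrite mulrC ler_wpM2l ?enorm_ge0 // lerDl.
Qed.

Lemma continuous_enorm : continuous (@enorm R m).
Proof.
move=> y A /nbhs_ballP[e /= e0 eA]; apply/nbhs_eballP; exists e => // z yz.
apply: eA; rewrite /ball /=; apply: le_lt_trans yz; rewrite ler_norml.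
apply/andP; split.
  by rewrite lerNl opprB lerBlDr -{1}(subrK y z); exact: enormD.
by rewrite lerBlDr enormB -{1}(subrK z y); exact: enormD.
Qed.

Lemma eball_measurable x r : borel_set (eball x r).
Proof. apply: open_borel_set; exact: open_eball. Qed.

End euclidean.

Lemma cbox_measurable (R : realType) (n : nat) (c : 'rV[R]_n) (d : R) :
  borel_set (cbox c d).
Proof. exact: (closed_borel_set (@closed_cbox R n c d)). Qed.

Lemma leb_eball_fin (R : realType) (n : nat) (c : 'rV[R]_n) (r : R) :
  (leb R n (eball c r) < +oo)%E.
Proof.
have [r0|r0] := ltP r 0.
  rewrite (_ : eball c r = set0) ?measure0 //; apply/seteqP; split => // y /=.
  by rewrite /eball /= => /(le_lt_trans (enorm_ge0 _))/(lt_trans r0); rewrite ltxx.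
apply: (@le_lt_trans _ _ (leb R n (cbox c r))); last by rewrite leb_cbox // ltry.
apply: le_measure; rewrite ?inE; [exact: eball_measurable|exact: cbox_measurable|].
move=> y yc i; rewrite -[X in `|X|]/(_ + _).
have := coord_le_enorm (y - c) i; rewrite !mxE => /le_trans; apply.
exact: ltW.
Qed.

(** The cube of half-side r/(n+1) fits in the ball because n/(n+1) < 1. This gives positivity of
    balls and the explicit constant in [threshold]. *)
Lemma leb_eball_ge (R : realType) (n : nat) (c : 'rV[R]_n) (r : R) : 0 < r ->
  (((2 * (r / n.+1%:R)) ^+ n)%:E <= leb R n (eball c r))%E.
Proof.
move=> r0; rewrite -(leb_cbox c); last by rewrite divr_ge0 // ltW.
apply: le_measure; rewrite ?inE; [exact: cbox_measurable|exact: eball_measurable|].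
move=> y yc; rewrite /eball /=; apply: le_lt_trans (enorm_le_sum _) _.
apply: (@le_lt_trans _ _ (\sum_(i < n) (r / n.+1%:R))).
  by apply: ler_sum => i _; have := yc i; rewrite !mxE.
rewrite sumr_const card_ord -[_ *+ _]mulr_natl mulrCA gtr_pMr // ltr_pdivrMr //.
by rewrite mul1r ltr_nat.
Qed.

(** * Hemispheres as graphs *)

(** Here [lebesgue_measure S] is read as an outer measure, so S is an arbitrary set. An interval of
    length l meeting S at s is sent into the interval of radius K l about f s, which is the origin
    of the factor 2. *)
Lemma lebesgue_measure_lipschitz (R : realType) (f : R -> R) (S T : set R) (K : R) :
  0 < K -> measurable (T : set (measurableTypeR R)) ->
  T `<=` f @` S ->
  (forall s t, S s -> S t -> `|f s - f t| <= K * `|s - t|) ->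
  (lebesgue_measure T <= (2 * K)%:E * lebesgue_measure S)%E.
Proof.
move=> K0 mT TS lf.
have K20 : 0 < 2 * K by rewrite mulr_gt0.
rewrite -lee_pdivrMl //.
have -> : lebesgue_measure S = ereal_inf [set (\sum_(k <oo) wlength idfun (F k))%E
  | F in measurable_cover (S : set (ocitv_type R))] by [].
apply: le_ereal_inf_tmp => _ [F [mF SF] <-].
rewrite lee_pdivrMl //.
have /choice[J hJ] : forall k, exists J : set R,
    [/\ measurable (J : set (measurableTypeR R)), f @` (S `&` F k) `<=` J
      & (lebesgue_measure J <= (2 * K)%:E * wlength idfun (F k))%E].
  move=> k; have [[s [Ss Fs]]|SF0] := pselect ((S `&` F k) !=set0); last first.
    exists set0; split => //.
      by move=> t [s sF _]; case: SF0; exists s.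
    rewrite measure0 mule_ge0 ?lee_fin ?(ltW K20) // wlength_ge0 //.
  have /ocitvP[F0|[[a b] /= ab Fab]] := mF k; first by rewrite F0 in Fs.
  exists `[f s - K * (b - a), f s + K * (b - a)]%classic; split.
  - exact: measurable_itv.
  - move=> _ [t [St Ft] <-] /=; rewrite in_itv /= -ler_distl.
    apply: le_trans (lf _ _ St Ss) _; rewrite ler_wpM2l ?(ltW K0) //.
    move: Fs Ft; rewrite Fab /= !in_itv /= => /andP[? ?] /andP[? ?].
    by rewrite ler_norml; apply/andP; split; lra.
  - rewrite Fab lebesgue_measure_itv /= wlength_itv_bnd ?(ltW ab) // lte_fin.
    have Kab : 0 < K * (b - a) by rewrite mulr_gt0 // subr_gt0.
    rewrite ifT; last by lra.
    by rewrite -EFinD -EFinM lee_fin /= le_eqVlt; apply/orP; left; apply/eqP; ring.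
rewrite -nneseriesZl //.
apply: (@le_trans _ _ (\sum_(k <oo) lebesgue_measure (J k))%E).
  apply: (measure_sigma_subadditive (@lebesgue_measure R)) => //.
    by move=> k; have [] := hJ k.
  move=> _ /TS [s Ss <-]; have [k _ Fks] := SF _ Ss.
  by exists k => //; have [_ + _] := hJ k; apply; exists s.
by apply: lee_nneseries => // k _; have [] := hJ k.
Qed.

Section chart.
Variables (R : realType) (n : nat).

Notation V := (borelV R n).
Notation T := (measurableTypeR R).

Definition lam : {sigma_finite_measure set (V * T)%type -> \bar R} :=
  sprod (leb R n) (@lebesgue_measure R).

Definition hgt (y : 'rV[R]_n) (r : R) : R := Num.sqrt (r ^+ 2 - enorm y ^+ 2).

(* [(y, r)] lies in [chart A] when the point above [y] on the sphere of radius [r] lies in A. *)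
Definition chart (A : set ('rV[R]_n * R)) : set ('rV[R]_n * R) :=
  [set p | enorm p.1 < p.2 /\ A (p.1, hgt p.1 p.2)].

(* The measure of the projection to R^n of the part of A on the upper hemisphere of radius r:
   a substitute for the surface measure of that part, of which it is a lower bound. *)
Definition shadow (A : set ('rV[R]_n * R)) (r : R) : \bar R :=
  leb R n (ysection (chart A) r).

Lemma measurable_enorm : measurable_fun setT (@enorm R n : V -> T).
Proof.
apply: (measurability _ (RGenOpens.measurableE R)).
move=> _ [_ [a [b ->] <-]]; rewrite setTI; apply: open_borel_set.
apply: open_comp => [x _|]; [exact: continuous_enorm|exact: interval_open].
Qed.

Lemma measurable_hgt :
  measurable_fun setT (fun p : V * T => hgt p.1 p.2 : T).
Proof.
apply: (measurableT_comp (continuous_measurable_fun (@sqrt_continuous R))).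
apply: measurable_funB; apply: measurable_funX.
  exact: measurable_snd.
exact: measurableT_comp measurable_enorm measurable_fst.
Qed.

Lemma measurable_chart (A : set (V * T)) : measurable A ->
  measurable (chart A : set (V * T)).
Proof.
move=> mA; rewrite (_ : chart A = [set p : V * T | enorm p.1 < p.2] `&`
   (fun p : V * T => (p.1, hgt p.1 p.2) : V * T) @^-1` A) //.
apply: measurableI.
  rewrite -[X in measurable X]setTI.
  apply: measurable_fun_ltr => //.
  exact: measurableT_comp measurable_enorm measurable_fst.
have mF : measurable_fun setT (fun p : V * T => (p.1, hgt p.1 p.2) : V * T).
  by apply: measurable_fun_pair; [exact: measurable_fst|exact: measurable_hgt].
exact: (measurable_preimageT mF mA).
Qed.

Lemma measurable_shadow (A : set (V * T)) : measurable A ->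
  measurable_fun setT (shadow A : T -> \bar R).
Proof.
by move=> mA; exact: (measurable_fun_ysection (leb R n) (measurable_chart mA)).
Qed.

Lemma sqrtr_sqrB_lt (y : 'rV[R]_n) (t : R) : 0 <= t ->
  hgt y (Num.sqrt (enorm y ^+ 2 + t ^+ 2)) = t.
Proof.
move=> t0; rewrite /hgt sqr_sqrtr ?addr_ge0 ?sqr_ge0 // addrC addKr.
by rewrite sqrtr_sqr ger0_norm.
Qed.

Lemma hgt_sqr (y : 'rV[R]_n) (r : R) : enorm y < r ->
  enorm y ^+ 2 + hgt y r ^+ 2 = r ^+ 2.
Proof.
move=> yr; rewrite /hgt [X in _ + X]sqr_sqrtr; first by ring.
rewrite subr_ge0.
by rewrite ler_pXn2r ?nnegrE ?enorm_ge0 ?(ltW yr) // (le_trans (enorm_ge0 y)) // ltW.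
Qed.

Lemma hgt_gt0 (y : 'rV[R]_n) (r : R) : enorm y < r -> 0 < hgt y r.
Proof.
move=> yr; rewrite /hgt sqrtr_gt0 subr_gt0 ltr_pXn2r ?nnegrE ?enorm_ge0 //.
by rewrite (le_trans (enorm_ge0 y)) // ltW.
Qed.

Lemma lamE (A : set (V * T)) : lam A = (\int[leb R n]_y lebesgue_measure (xsection A y))%E.
Proof. by []. Qed.

Lemma lamE2 (A : set (V * T)) : measurable A ->
  lam A = (\int[lebesgue_measure]_t leb R n (ysection A t))%E.
Proof.
move=> mA; rewrite -[LHS]/((leb R n \x @lebesgue_measure R)%E A).
rewrite -[RHS]/((leb R n \x^ @lebesgue_measure R)%E A).
apply: product_measure_unique => // B C mB mC.
exact: product_measure2E.
Qed.

Definition upper (c : R) : set ('rV[R]_n * R) := [set p | c < p.2].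

Definition below (c : R) : set ('rV[R]_n * R) := [set p | p.2 < c].

Definition rball (c : R) : set ('rV[R]_n * R) :=
  [set p | enorm p.1 ^+ 2 + p.2 ^+ 2 < c ^+ 2].

Lemma measurable_upper c : measurable (upper c : set (V * T)).
Proof.
rewrite (_ : upper c = setT `*` `]c, +oo[%classic).
  by apply: measurableX => //; exact: measurable_itv.
by apply/seteqP; split => p; rewrite /upper /= in_itv /= andbT // => -[].
Qed.

Lemma measurable_below c : measurable (below c : set (V * T)).
Proof.
rewrite (_ : below c = setT `*` `]-oo, c[%classic).
  by apply: measurableX => //; exact: measurable_itv.
by apply/seteqP; split => p; rewrite /below /= in_itv //= => -[].
Qed.

Lemma measurable_rball c : measurable (rball c : set (V * T)).
Proof.
rewrite -[X in measurable X]setTI.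
apply: (@measurable_fun_ltr _ (V * T)%type R setT
   (fun p => enorm p.1 ^+ 2 + p.2 ^+ 2) (cst (c ^+ 2))) => //.
apply: measurable_funD; apply: measurable_funX; last exact: measurable_snd.
exact: measurableT_comp measurable_enorm measurable_fst.
Qed.

(** On each vertical line the radius sqrt(|y|^2 + t^2) is a 1-Lipschitz function of the height t >
    0. Hence shadows integrated over r are controlled by volume. *)
Lemma lam_chart_le (A : set (V * T)) : measurable A ->
  (lam (chart A) <= 2%:E * lam (A `&` upper 0))%E.
Proof.
move=> mA.
have mA' : measurable (A `&` upper 0).
  by apply: measurableI => //; exact: measurable_upper.
rewrite !lamE -ge0_integralZl //; last exact: measurable_fun_xsection.
apply: ge0_le_integral => //.
- exact: measurable_fun_xsection (measurable_chart mA).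
- by apply: measurable_funeM; exact: measurable_fun_xsection.
move=> y _; rewrite -[in leRHS](mulr1 2).
apply: (@lebesgue_measure_lipschitz _ (fun t => Num.sqrt (enorm y ^+ 2 + t ^+ 2))) => //.
- exact: (measurable_xsection _ (measurable_chart mA)).
- move=> r; rewrite /xsection /= inE => -[/= yr Ar]; exists (hgt y r).
    by rewrite inE; split => //=; exact: hgt_gt0.
  rewrite hgt_sqr // sqrtr_sqr ger0_norm //.
  by rewrite (le_trans (enorm_ge0 y)) // ltW.
- move=> s t; rewrite /xsection /= !inE => -[_ /= s0] [_ /= t0]; rewrite mul1r.
  set a := enorm y ^+ 2.
  have a0 : 0 <= a by exact: sqr_ge0.
  have e1 u : 0 < u -> 0 <= a + u ^+ 2 by move=> u0; rewrite addr_ge0 ?sqr_ge0.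
  have e2 u : 0 < u -> u <= Num.sqrt (a + u ^+ 2).
    move=> u0; rewrite -{1}(ger0_norm (ltW u0)) -sqrtr_sqr ler_wsqrtr //.
    by rewrite lerDr.
  have d0 : 0 < Num.sqrt (a + s ^+ 2) + Num.sqrt (a + t ^+ 2).
    by rewrite addr_gt0 // (lt_le_trans _ (e2 _ _)).
  rewrite -(ler_pM2r d0) -{1}(gtr0_norm d0) -normrM -subr_sqr !sqr_sqrtr ?e1 //.
  rewrite (_ : a + s ^+ 2 - (a + t ^+ 2) = (s - t) * (s + t)); last by ring.
  rewrite normrM ler_wpM2l // gtr0_norm ?addr_gt0 //.
  by apply: lerD; exact: e2.
Qed.

(** The converse of [lam_chart_le]: as a function of r the height has slope r/t, at most r0/c where
    t > c and r < r0. The slope blows up at the equator, so c cannot be 0. *)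
Lemma lam_le_chart (A : set (V * T)) (c r0 : R) : measurable A -> 0 < c -> 0 < r0 ->
  (lam (A `&` (upper c `&` rball r0)) <=
   (2 * (r0 / c))%:E * lam (chart A `&` below r0))%E.
Proof.
move=> mA c0 r00.
have mB := measurable_below r0.
have mC : measurable (upper c `&` rball r0 : set (V * T)).
  by apply: measurableI; [exact: measurable_upper|exact: measurable_rball].
rewrite !lamE -ge0_integralZl //; last 2 first.
- by apply: measurable_fun_xsection; apply: measurableI => //; exact: measurable_chart.
- by rewrite lee_fin mulr_ge0 // divr_ge0 // ltW.
apply: ge0_le_integral => //.
- by apply: measurable_fun_xsection; exact: measurableI.
- apply: measurable_funeM; apply: measurable_fun_xsection; apply: measurableI => //.
  exact: measurable_chart.
move=> y _.
pose S := [set r | xsection (chart A `&` below r0) y r /\ c < hgt y r].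
apply: (@le_trans _ _ ((2 * (r0 / c))%:E * lebesgue_measure S)%E); last first.
  rewrite lee_wpmul2l // ?lee_fin ?mulr_ge0 ?divr_ge0 ?invr_ge0 ?(ltW c0) ?(ltW r00) //.
  have mS1 : measurable (xsection (chart A `&` below r0) y : set T).
    exact: (measurable_xsection y (measurableI _ _ (measurable_chart mA) mB)).
  apply: le_measure; rewrite ?inE //; last by move=> r [].
  apply: measurableI => //.
  rewrite -[X in measurable X]setTI.
  apply: (@measurable_fun_ltr _ T R setT (cst c) (hgt y)) => //.
  exact: (measurableT_comp measurable_hgt (pair1_measurable y)).
apply: (@lebesgue_measure_lipschitz _ (hgt y)) => //.
- by rewrite divr_gt0.
- exact: (measurable_xsection y (measurableI _ _ mA mC)).
- move=> t; rewrite /xsection /= inE => -[/= At [ct tr]].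
  have t0 : 0 < t by rewrite (lt_trans c0).
  exists (Num.sqrt (enorm y ^+ 2 + t ^+ 2)); last by rewrite sqrtr_sqrB_lt // ltW.
  rewrite /S /xsection /= inE /chart /= sqrtr_sqrB_lt ?(ltW t0) //; split => //.
  split; first split => //.
    rewrite -{1}(ger0_norm (enorm_ge0 y)) -sqrtr_sqr ltr_sqrt ?ltrDl ?exprn_gt0 //.
    by rewrite ltr_wpDl ?sqr_ge0 // exprn_gt0.
  by rewrite /below /= -(ger0_norm (ltW r00)) -sqrtr_sqr ltr_sqrt // exprn_gt0.
move=> r s [+ cr] [+ cs]; rewrite /xsection /= !inE => -[[/= yr _] rr] [[/= ys _] sr].
have d0 : 0 < hgt y r + hgt y s by rewrite addr_gt0 // (lt_trans c0).
rewrite -(ler_pM2r d0) -{1}(gtr0_norm d0) -normrM -subr_sqr.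
have -> : hgt y r ^+ 2 - hgt y s ^+ 2 = (r - s) * (r + s).
  by rewrite -subr_sqr -(hgt_sqr yr) -(hgt_sqr ys); ring.
rewrite normrM mulrAC [leRHS]mulrC ler_wpM2l //.
have r_ge0 : 0 <= r by rewrite (le_trans (enorm_ge0 y)) // ltW.
have s_ge0 : 0 <= s by rewrite (le_trans (enorm_ge0 y)) // ltW.
rewrite ger0_norm ?addr_ge0 // mulrAC ler_pdivlMr //.
have rr0 : r < r0 := rr.
have sr0 : s < r0 := sr.
apply: (@le_trans _ _ ((r0 + r0) * c)); first by rewrite ler_wpM2r ?(ltW c0) // lerD ?ltW.
by rewrite (_ : (r0 + r0) * c = r0 * (c + c)) ?ler_wpM2l ?(ltW r00) ?lerD ?(ltW cr) ?(ltW cs) //; ring.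
Qed.

End chart.

(** * Projections and Hausdorff measure *)

Lemma unit_ball_volume_gt0 (R : realType) (k : nat) : 0 < unit_ball_volume R k.
Proof.
(* The recursion descends by two, so two consecutive values are carried along. *)
suff: 0 < unit_ball_volume R k /\ 0 < unit_ball_volume R k.+1 by case.
elim: k => [|k [h1 h2]]; first by rewrite /= ltr01 ltr0n.
split=> //=; case: k h1 h2 => [|k] h1 h2.
  by rewrite mulr_gt0 // divr_gt0 // mulr_gt0 // pi_gt0.
by rewrite mulr_gt0 // divr_gt0 // mulr_gt0 // pi_gt0.
Qed.

Section isometry.
Variables (R : realType) (n : nat) (Q : 'M[R]_(n + 1)).
Hypothesis hQ : Q *m Q^T = 1%:M.

(* [psi] has inverse [(prj, height)]; the vertical direction is the last row of Q. *)
Definition psi (p : 'rV[R]_n * R) : 'rV[R]_(n + 1) := row_mx p.1 p.2%:M *m Q.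

Definition prj (v : 'rV[R]_(n + 1)) : 'rV[R]_n := lsubmx (v *m Q^T).

Definition height (v : 'rV[R]_(n + 1)) : R := (rsubmx (v *m Q^T) : 'rV[R]_1) 0 0.

Lemma heightE v : height v = \sum_j v 0 j * Q^T j (rshift n 0).
Proof. by rewrite /height !mxE. Qed.

Lemma dotv_row_mx (y z : 'rV[R]_n) (s t : R) :
  dotv (row_mx y s%:M) (row_mx z t%:M) = dotv y z + s * t.
Proof.
rewrite !dotvE tr_row_mx mul_row_col mxE; congr (_ + _).
by rewrite tr_scalar_mx -scalar_mxM mxE.
Qed.

Lemma dotv_mulQ (u v : 'rV[R]_(n + 1)) : dotv (u *m Q) (v *m Q) = dotv u v.
Proof. by rewrite !dotvE trmx_mul mulmxA -(mulmxA u) hQ mulmx1. Qed.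

Lemma dotv_psi p q : dotv (psi p) (psi q) = dotv p.1 q.1 + p.2 * q.2.
Proof. by rewrite dotv_mulQ dotv_row_mx. Qed.

Lemma enorm_psi p : enorm (psi p) ^+ 2 = enorm p.1 ^+ 2 + p.2 ^+ 2.
Proof. by rewrite !enorm_sqr dotv_psi -expr2. Qed.

Lemma psiK : cancel psi (fun v => (prj v, height v)).
Proof.
move=> [y t]; rewrite /prj /height /psi -!mulmxA hQ !mulmx1 row_mxKl row_mxKr /=.
by rewrite mxE eqxx mulr1n.
Qed.

Lemma prj_psi p : prj (psi p) = p.1.
Proof. by case: p => y t; have [] := psiK (y, t). Qed.

Lemma height_psi p : height (psi p) = p.2.
Proof. by case: p => y t; have [] := psiK (y, t). Qed.

Lemma prjK v : psi (prj v, height v) = v.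
Proof.
rewrite /psi /= (_ : row_mx _ _ = v *m Q^T).
  by rewrite -mulmxA (mulmx1C hQ) mulmx1.
rewrite -[RHS]hsubmxK; congr row_mx.
by rewrite [RHS]mx11_scalar.
Qed.

Lemma psiD p q : psi (p.1 + q.1, p.2 + q.2) = psi p + psi q.
Proof. by rewrite /psi /= raddfD -add_row_mx mulmxDl. Qed.

Lemma psiN p : psi (- p.1, - p.2) = - psi p.
Proof. by rewrite /psi /= raddfN -opp_row_mx mulNmx. Qed.

Lemma psiZ a p : psi (a *: p.1, a * p.2) = a *: psi p.
Proof. by rewrite /psi /= -scale_scalar_mx -scale_row_mx -scalemxAl. Qed.

Lemma prjD u v : prj (u + v) = prj u + prj v.
Proof. by rewrite /prj mulmxDl raddfD. Qed.

Lemma prjN v : prj (- v) = - prj v.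
Proof. by rewrite /prj mulNmx raddfN. Qed.

Lemma prjB u v : prj (u - v) = prj u - prj v.
Proof. by rewrite prjD prjN. Qed.

Lemma heightD u v : height (u + v) = height u + height v.
Proof. by rewrite /height mulmxDl raddfD mxE. Qed.

Lemma heightN v : height (- v) = - height v.
Proof. by rewrite /height mulNmx raddfN mxE. Qed.

Lemma heightB u v : height (u - v) = height u - height v.
Proof. by rewrite heightD heightN. Qed.

Lemma heightZ a v : height (a *: v) = a * height v.
Proof. by rewrite /height -scalemxAl linearZ mxE. Qed.

Lemma enorm_prj v : enorm v ^+ 2 = enorm (prj v) ^+ 2 + height v ^+ 2.
Proof. by rewrite -{1}(prjK v) enorm_psi. Qed.

Lemma enorm_prj_le v : enorm (prj v) <= enorm v.
Proof.
rewrite -(@ler_pXn2r _ 2) ?nnegrE ?enorm_ge0 // enorm_prj.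
by rewrite lerDl sqr_ge0.
Qed.

Lemma height_le v : `|height v| <= enorm v.
Proof.
rewrite -(@ler_pXn2r _ 2) ?nnegrE ?enorm_ge0 // real_normK ?num_real // enorm_prj.
by rewrite lerDr sqr_ge0.
Qed.

(** A set of diameter d projects into a cube of half-side d, of volume (2d)^n. Two such cubes, one
    per sign in [leb_le_hausdorff], are compared with the Hausdorff weight omega_n (d/2)^n; [covK]
    is the quotient. *)
Definition covK : R := 2 * 2 ^+ n * 2 ^+ n / unit_ball_volume R n.

Lemma covK_gt0 : 0 < covK.
Proof. by rewrite /covK divr_gt0 ?mulr_gt0 ?exprn_gt0 ?unit_ball_volume_gt0. Qed.

Lemma ediam_ge0 (m : nat) (U : set 'rV[R]_m) : (0 <= ediam U)%E.
Proof. by apply: ereal_sup_ubound; left. Qed.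

Lemma ediam_le (m : nat) (U : set 'rV[R]_m) u v d : (ediam U <= d%:E)%E ->
  U u -> U v -> enorm (u - v) <= d.
Proof.
move=> Ud Uu Uv; rewrite -lee_fin; apply: le_trans Ud.
by apply: ereal_sup_ubound; right; exists u => //; exists v.
Qed.

(** Projection does not increase diameters, so covers of B project to covers of S. The sign is left
    free because the bad point found for y may be the antipode or the mirror image of the point
    above y; N absorbs an equator. *)
Lemma leb_le_hausdorff (S N : set 'rV[R]_n) (B : set 'rV[R]_(n + 1)) (x : 'rV[R]_(n + 1)) :
  borel_set S -> borel_set N -> leb R n N = 0%E ->
  (forall y, S y -> N y \/ exists2 q, B q & (y = prj (q - x) \/ y = - prj (q - x))) ->
  (leb R n S <= covK%:E * hausdorff n B)%E.
Proof.
move=> mS mN N0 SB.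
(* A single scale is enough for a lower bound; the diameter bound 1 serves to make the diameters
   finite. *)
apply: (@le_trans _ _ (covK%:E * hausdorff_pre n 1 B)%E); last first.
  rewrite lee_wpmul2l ?lee_fin ?(ltW covK_gt0) //.
  by apply: ereal_sup_ubound; exists 1 => //=.
rewrite -lee_pdivrMl ?covK_gt0 //.
apply: le_ereal_inf_tmp => s [U [BU dU ->]].
rewrite lee_pdivrMl ?covK_gt0 //.
pose c : R := unit_ball_volume R n / 2 ^+ n.
have c0 : 0 < c by rewrite divr_gt0 ?unit_ball_volume_gt0 ?exprn_gt0.
have /choice[J hJ] : forall k, exists J : set 'rV[R]_n,
    [/\ borel_set J, forall q, (B `&` U k) q -> J (prj (q - x)) /\ J (- prj (q - x))
      & (leb R n J <= covK%:E * (c%:E * ediam (U k) ^+ n))%E].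
  move=> k; have [[u [Bu Uu]]|SF0] := pselect ((B `&` U k) !=set0); last first.
    exists set0; split => //.
    - exact: measurable0.
    - by move=> q qB; case: SF0; exists q.
    by rewrite measure0 !mule_ge0 ?lee_fin ?(ltW c0) ?(ltW covK_gt0) // expe_ge0 // ediam_ge0.
  have [d Ud] : exists d, ediam (U k) = d%:E.
    exists (fine (ediam (U k))); rewrite fineK // ge0_fin_numE ?ediam_ge0 //.
    by apply: le_lt_trans (dU k) _; rewrite ltry.
  have d0 : 0 <= d by rewrite -lee_fin -Ud ediam_ge0.
  exists (cbox (prj (u - x)) d `|` cbox (- prj (u - x)) d); split.
  - by apply: measurableU; exact: cbox_measurable.
  - move=> q [_ Uq].
    have qu i : `|prj (q - x) 0 i - prj (u - x) 0 i| <= d.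
      rewrite -[X in `|X|](_ : (prj (q - x) - prj (u - x)) 0 i = _); last by rewrite !mxE.
      rewrite -prjB opprB addrA subrK.
      apply: le_trans (coord_le_enorm _ _) _; apply: le_trans (enorm_prj_le _) _.
      apply: ediam_le Uq Uu; by rewrite Ud.
    split; [left|right] => i; first exact: qu.
    have oppE (w : 'rV[R]_n) : (- w) 0 i = - w 0 i by rewrite mxE.
    by rewrite !oppE -opprD normrN; exact: qu.
  apply: le_trans (measureU2 _ _ _) _; [exact: cbox_measurable|exact: cbox_measurable|].
  rewrite [X in (X + _)%E](leb_cbox _ d0) [X in (_ + X)%E](leb_cbox _ d0) Ud -EFin_expe -!EFinM -EFinD lee_fin le_eqVlt.
  apply/orP; left; apply/eqP; rewrite /covK /c exprMn.
  have u0 : unit_ball_volume R n != 0 by rewrite gt_eqF // unit_ball_volume_gt0.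
  have t0 : (2 : R) ^+ n != 0 by rewrite expf_neq0.
  by field; rewrite u0 t0.
rewrite -nneseriesZl //; last by move=> k _; rewrite mule_ge0 ?expe_ge0 ?ediam_ge0 // lee_fin ltW.
apply: (@le_trans _ _ (leb R n (N `|` \bigcup_k J k))).
  apply: le_measure; rewrite ?inE //.
    apply: measurableU => //; apply: bigcupT_measurable => k.
    by have [] := hJ k.
  move=> y /SB[Ny|[q Bq yq]]; first by left.
  have [k _ Uq] := BU _ Bq; right; exists k => //.
  have [_ + _] := hJ k => /(_ q (conj Bq Uq))[h1 h2].
  by case: yq => ->.
apply: le_trans (measureU2 _ _ _) _ => //.
  by apply: bigcupT_measurable => k; have [] := hJ k.
rewrite [X in (X + _)%E]N0 add0e.
apply: (@le_trans _ _ (\sum_(k <oo) leb R n (J k))%E).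
  apply: (measure_sigma_subadditive (leb R n)) => //.
    by move=> k; have [] := hJ k.
  by apply: bigcupT_measurable => k; have [] := hJ k.
by apply: lee_nneseries => // k _; have [] := hJ k.
Qed.

End isometry.

(** * Traces of hyperplanes on hemispheres are negligible *)

Section equator.
Variables (R : realType) (n : nat).
Implicit Types (a y e : 'rV[R]_n).

(** The projection of the trace, on the upper hemisphere of radius r, of the hyperplane through the
    centre with normal (a, b) in the coordinates of [psi]. *)
Definition equator a (b r : R) : set 'rV[R]_n :=
  [set y | enorm y < r /\ dotv a y + b * hgt y r = 0].

Lemma measurable_dotv a : measurable_fun setT (dotv a : borelV R n -> measurableTypeR R).
Proof.
apply: (measurability _ (RGenOpens.measurableE R)).
move=> _ [_ [c [d ->] <-]]; rewrite setTI; apply: open_borel_set.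
apply: open_comp => [x _|]; [exact: continuous_dotv|exact: interval_open].
Qed.

Lemma equator_measurable a b r : borel_set (equator a b r).
Proof.
rewrite /borel_set (_ : equator a b r = [set y | enorm y < r] `&`
  (fun y : borelV R n => dotv a y + b * hgt y r : measurableTypeR R) @^-1` [set 0]) //.
apply: measurableI.
  rewrite -[X in measurable X]setTI.
  apply: (@measurable_fun_ltr _ (borelV R n) R setT (@enorm R n) (cst r)) => //.
  exact: measurable_enorm.
have mF : measurable_fun setT (fun y : borelV R n => dotv a y + b * hgt y r : measurableTypeR R).
  apply: measurable_funD; first exact: measurable_dotv.
  apply: measurable_funM => //.
  exact: (measurableT_comp (@measurable_hgt R n) (pair2_measurable r)).
exact: (measurable_preimageT mF (measurable_set1 _)).
Qed.

Lemma quadratic_three_roots (k l m s t u : R) : k != 0 -> s != t -> t != u -> u != s ->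
  k * s ^+ 2 + l * s + m = 0 -> k * t ^+ 2 + l * t + m = 0 ->
  k * u ^+ 2 + l * u + m = 0 -> False.
Proof.
move=> k0 st tu us hs ht hu.
have h1 : (s - t) * (k * (s + t) + l) = 0.
  by rewrite -[RHS](subrr 0) -{1}hs -ht; ring.
have h2 : (t - u) * (k * (t + u) + l) = 0.
  by rewrite -[RHS](subrr 0) -{1}ht -hu; ring.
move/eqP : h1; rewrite mulf_eq0 subr_eq0 (negbTE st) /= => /eqP h1.
move/eqP : h2; rewrite mulf_eq0 subr_eq0 (negbTE tu) /= => /eqP h2.
have /eqP : k * (u - s) = 0 by rewrite -[RHS](subrr 0) -{1}h2 -h1; ring.
by rewrite mulf_eq0 (negbTE k0) subr_eq0 (negbTE us).
Qed.

(** Squaring the equation of the equator removes the root in [hgt] and leaves a quadratic in the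
    parameter w of the line, with the assumed positive number as leading coefficient. *)
Lemma equator_line a b r e y : 0 < dotv a e ^+ 2 + b ^+ 2 * dotv e e ->
  forall s t u, s != t -> t != u -> u != s ->
  equator a b r (s *: e + y) -> equator a b r (t *: e + y) ->
  equator a b r (u *: e + y) -> False.
Proof.
move=> k0 s t u st tu us.
have key w : equator a b r (w *: e + y) ->
    (dotv a e ^+ 2 + b ^+ 2 * dotv e e) * w ^+ 2 +
    (2 * (dotv a e * dotv a y + b ^+ 2 * dotv e y)) * w +
    (dotv a y ^+ 2 + b ^+ 2 * (dotv y y - r ^+ 2)) = 0.
  move=> [wr w0]; have := hgt_sqr wr; rewrite enorm_sqr => hw.
  have : (dotv a (w *: e + y)) ^+ 2 = b ^+ 2 * hgt (w *: e + y) r ^+ 2.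
    have /eqP -> : dotv a (w *: e + y) == - (b * hgt (w *: e + y) r).
      by rewrite -addr_eq0 w0.
    by ring.
  rewrite (_ : hgt _ _ ^+ 2 = r ^+ 2 - dotv (w *: e + y) (w *: e + y)); last first.
    by rewrite -hw; ring.
  rewrite !dotvDl !dotvDr !dotvZl !dotvZr (dotvC y e) => h.
  by rewrite -[RHS](subrr ((w * dotv a e + dotv a y) ^+ 2)) {2}h; ring.
by move=> /key hs /key ht /key hu; exact: (quadratic_three_roots (lt0r_neq0 k0) st tu us hs ht hu).
Qed.

(* By translation invariance, a bounded set meeting each line of some direction in at most
   two points is negligible. *)
Lemma leb_equator a b r : (0 < n)%N -> 0 < dotv a a + b ^+ 2 ->
  leb R n (equator a b r) = 0%E.
Proof.
move=> n0 ab0.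
have [e he] : exists e, 0 < dotv a e ^+ 2 + b ^+ 2 * dotv e e.
  have [b0|b0] := eqVneq b 0.
    exists a; move: ab0; rewrite b0 expr0n /= mul0r !addr0 => a0.
    by rewrite exprn_gt0.
  exists (delta_mx 0 (Ordinal n0)); rewrite -enorm_sqr enorm_delta expr1n mulr1.
  by rewrite ltr_wpDl ?sqr_ge0 // exprn_even_gt0.
pose E := equator a b r.
(* N translates of the equator by fractions of e, all of the same measure and all inside one ball B.
   No point lies in three of them, so N times the measure of the equator is at most twice that of B,
   for every N. *)
pose F (N : nat) (j : 'I_N) : set 'rV[R]_n :=
  (fun y => 1 *: y + (j%:R / N%:R : R) *: e) @^-1` E.
have mE : borel_set E by exact: equator_measurable.
have mF N j : borel_set (@F N j).
  exact: (measurable_preimageT (measurable_affine_rV 1 _) mE).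
have lF N j : leb R n (@F N j) = leb R n E by apply: leb_affine => //; left.
pose B := eball (0 : 'rV[R]_n) (r + enorm e).
have mB : borel_set B by exact: eball_measurable.
have FB N (j : 'I_N) : F N j `<=` B.
  move=> y [yr _]; rewrite /B /eball /= subr0.
  set v := (_ *: e) in yr.
  have -> : y = (1 *: y + v) - v by rewrite scale1r addrK.
  apply: le_lt_trans (enormD _ _) _; rewrite enormN; apply: ltr_leD => //.
  rewrite /v enormZ ger0_norm ?divr_ge0 // ler_piMl ?enorm_ge0 // ler_pdivrMr ?mul1r.
    by rewrite ler_nat ltnW.
  by rewrite ltr0n; exact: leq_ltn_trans (leq0n _) (ltn_ord j).
have card2 N y : (\sum_(j < N) \1_(F N j) y <= 2 * \1_B y :> R).
  have [yB|yB] := boolP (y \in B); last first.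
    rewrite big1 ?mulr_ge0 // => j _; rewrite indicE; apply/eqP.
    by rewrite pnatr_eq0 eqb0; apply: contra yB => /set_mem/FB/mem_set.
  rewrite indicE yB mulr1.
  have -> : \sum_(j < N) \1_(F N j) y = #|[pred j : 'I_N | y \in F N j]|%:R :> R.
    rewrite -sum1_card natr_sum [RHS]big_mkcond /=; apply: eq_bigr => j _.
    by rewrite indicE inE; case: (y \in _).
  rewrite ler_nat leqNgt; apply/negP => /card_gt2P[i [j [k [[]]]]].
  have mem (l : 'I_N) : l \in [pred j : 'I_N | y \in F N j] -> F N l y.
    by move=> h; apply: set_mem.
  move=> /mem hi /mem hj /mem hk [ij jk ki].
  have N0 : N%:R != 0 :> R by rewrite pnatr_eq0 -lt0n; exact: leq_ltn_trans (leq0n _) (ltn_ord i).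
  have neq (p q : 'I_N) : p != q -> (p%:R / N%:R : R) != q%:R / N%:R.
    move=> pq; apply: contra pq => /eqP /(mulIf (invr_neq0 N0)) /eqP.
    by rewrite eqr_nat.
  apply: (equator_line he (neq _ _ ij) (neq _ _ jk) (neq _ _ ki)).
  - by move: hi; rewrite /F /= scale1r addrC; exact.
  - by move: hj; rewrite /F /= scale1r addrC; exact.
  - by move: hk; rewrite /F /= scale1r addrC; exact.
have indE (A : set 'rV[R]_n) : borel_set A ->
    (\int[leb R n]_y (\1_A y)%:E = leb R n A)%E.
  by move=> mA; rewrite integral_indic //; congr (leb R n _); exact: setIT.
have mind (A : set 'rV[R]_n) : borel_set A ->
    measurable_fun setT (fun y : borelV R n => (\1_A y)%:E : \bar R).
  by move=> mA; apply/measurable_EFinP; exact: measurable_indic.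
have NE N : (N%:R%:E * leb R n E <= 2%:E * leb R n B)%E.
  have -> : (N%:R%:E * leb R n E = \sum_(j < N) leb R n (F N j))%E.
    under eq_bigr do rewrite lF.
    by rewrite sumr_const card_ord mule_natl.
  rewrite (_ : \sum_(j < N) _ = \int[leb R n]_y (\sum_(j < N) (\1_(F N j) y)%:E))%E; last first.
    rewrite ge0_integral_sum //; last by move=> j; exact: mind.
    by apply: eq_bigr => j _; rewrite indE.
  rewrite -(indE B) // -ge0_integralZl //; last exact: mind.
  apply: ge0_le_integral => //.
  - by move=> y _; apply: sume_ge0.
  - by apply: emeasurable_sum => j; exact: mind.
  - by apply: measurable_funeM; exact: mind.
  - by move=> y _; rewrite sumEFin -EFinM lee_fin; exact: card2.
have Bfin : leb R n B \is a fin_num.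
  by rewrite ge0_fin_numE // leb_eball_fin.
have Efin : leb R n E \is a fin_num.
  rewrite ge0_fin_numE //; have := NE 1%N; rewrite mul1e => /le_lt_trans; apply.
  by rewrite -(fineK Bfin) -EFinM ltry.
apply/eqP; rewrite eq_le measure_ge0 andbT -(fineK Efin) lee_fin leNgt; apply/negP => E0.
have := NE (Num.bound (2 * fine (leb R n B) / fine (leb R n E))).
rewrite -(fineK Bfin) -(fineK Efin) -!EFinM lee_fin leNgt => /negP; apply.
rewrite -ltr_pdivrMr //.
by apply: archi_boundP; rewrite divr_ge0 ?mulr_ge0 ?fine_ge0.
Qed.

End equator.

(** * Lower bounds for the coefficients *)

Section halfspace.
Variables (R : realType) (m : nat).
Implicit Types (x q v : 'rV[R]_m).

(** [esphere] is the topological boundary of the open ball, so q is approached from inside along its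
    radius; r > 0 excludes the empty ball. *)
Lemma esphere_enorm x q r : 0 < r -> enorm (q - x) = r -> esphere x r q.
Proof.
move=> r0 qr; split; last first.
  by move=> /nbhs_singleton; rewrite /eball /= qr ltxx.
move=> B /nbhs_eballP[e e0 eB].
have er : 0 < e + r by rewrite addr_gt0.
pose s := e / (e + r).
have s0 : 0 < s by rewrite divr_gt0.
have s1 : s < 1 by rewrite ltr_pdivrMr // mul1r ltrDl.
exists (x + (1 - s) *: (q - x)); split.
  rewrite /eball /= addrC addKr enormZ qr ger0_norm ?subr_ge0 ?(ltW s1) //.
  by rewrite gtr_pMl // gtrBl.
apply: eB; rewrite /eball /= (_ : _ - q = - s *: (q - x)).
  rewrite enormZ qr normrN gtr0_norm // /s mulrAC ltr_pdivrMr //.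
  by rewrite ltr_pM2l // ltrDr.
by apply/rowP => i; rewrite !mxE; ring.
Qed.

Lemma closure_halfspace v c x : closure [set y | c < dotv v y] x -> c <= dotv v x.
Proof.
move=> clx; rewrite leNgt; apply/negP => h.
have : nbhs x [set y | dotv v y < c].
  apply: open_nbhs_nbhs; split => //.
  apply: (@open_comp _ _ (dotv v) `]-oo, c[%classic) => [y _|]; first exact: continuous_dotv.
  exact: interval_open.
by move=> /clx [y [/= cy yc]]; move: (lt_trans cy yc); rewrite ltxx.
Qed.

Lemma boundary_halfspace v c x : boundary [set y | c < dotv v y] x -> dotv v x = c.
Proof.
move=> [/closure_halfspace clx intx]; apply/eqP; rewrite eq_le clx andbT leNgt.
apply/negP => h; apply: intx; apply: open_nbhs_nbhs; split => //.
rewrite (_ : [set y | _] = dotv v @^-1` `]c, +oo[%classic); last first.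
  by apply/seteqP; split => y /=; rewrite in_itv /= andbT.
apply: open_comp => [y _|]; first exact: continuous_dotv.
exact: interval_open.
Qed.

End halfspace.

Section detection.
Variables (R : realType) (n : nat) (Q : 'M[R]_(n + 1)).
Hypothesis hQ : Q *m Q^T = 1%:M.
Hypothesis hn : (0 < n)%N.
Variables (P M : set 'rV[R]_(n + 1)).
Hypothesis (mP : borel_set P) (mM : borel_set M).

Notation V := (borelV R n).
Notation T := (measurableTypeR R).
Notation psi := (psi Q).

Definition bad (H : set 'rV[R]_(n + 1)) x r : set 'rV[R]_(n + 1) :=
  (sphere_pos H x r `\` P) `|` (sphere_neg H x r `\` M).

Definition flip (p : 'rV[R]_n * R) : 'rV[R]_n * R := (- p.1, p.2).

(* Whatever the half-space H, [w] in [unsplit x] with [enorm w = r] yields a point [x + w] or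
   [x - w] of [bad H x r], up to the equator of H. *)
Definition unsplit x : set ('rV[R]_n * R) :=
  [set p | ~ ((P (x + psi p) /\ M (x - psi p)) \/ (M (x + psi p) /\ P (x - psi p)))].

(* If the vertical direction points into H (resp. out of H), each [w] in [missing P x]
   (resp. [missing M x]) with [enorm w = r] yields a point of [bad H x r]. *)
Definition missing (A : set 'rV[R]_(n + 1)) x : set ('rV[R]_n * R) :=
  [set p | ~ A (x + psi p) /\ ~ A (x + psi (flip p))].

Lemma measurable_psi : measurable_fun setT (psi : V * T -> borelV R (n + 1)).
Proof.
apply: measurable_fun_rV => i.
rewrite (_ : (fun _ => _) = fun p : 'rV[R]_n * R =>
  \sum_(j < n) p.1 0 j * Q (lshift 1 j) i + p.2 * Q (rshift n 0) i); last first.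
  apply/funext => p; rewrite !mxE big_split_ord /= big_ord1; congr (_ + _).
    by apply: eq_bigr => j _; rewrite row_mxEl.
  by rewrite row_mxEr mxE eqxx mulr1n.
apply: measurable_funD.
  apply: measurable_sum => j; apply: measurable_funM => //.
  exact: measurableT_comp (@measurable_coord R n j) measurable_fst.
by apply: measurable_funM => //; exact: measurable_snd.
Qed.

Lemma measurable_psi_affine b x :
  measurable_fun setT (fun p : V * T => b *: psi p + x : borelV R (n + 1)).
Proof. exact: measurableT_comp (measurable_affine_rV b x) measurable_psi. Qed.

Lemma measurable_flip : measurable_fun setT (flip : V * T -> V * T).
Proof.
apply: measurable_fun_pair; last exact: measurable_snd.
rewrite (_ : (fun _ => _) = (fun y : V => -1 *: y + 0) \o (fun p : V * T => p.1)).
  exact: measurableT_comp (measurable_affine_rV (-1) 0) measurable_fst.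
by apply/funext => p /=; rewrite scaleN1r addr0.
Qed.

Lemma preimage_psiD x (A : set 'rV[R]_(n + 1)) : borel_set A ->
  measurable ([set p | A (x + psi p)] : set (V * T)).
Proof.
move=> mA; rewrite (_ : [set _ | _] = (fun p => 1 *: psi p + x) @^-1` A).
  exact: (measurable_preimageT (measurable_psi_affine 1 x) mA).
by apply/seteqP; split => p /=; rewrite scale1r addrC.
Qed.

Lemma preimage_psiB x (A : set 'rV[R]_(n + 1)) : borel_set A ->
  measurable ([set p | A (x - psi p)] : set (V * T)).
Proof.
move=> mA; rewrite (_ : [set _ | _] = (fun p => -1 *: psi p + x) @^-1` A).
  exact: (measurable_preimageT (measurable_psi_affine (-1) x) mA).
by apply/seteqP; split => p /=; rewrite scaleN1r addrC.
Qed.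

Lemma measurable_unsplit x : measurable (unsplit x : set (V * T)).
Proof.
apply: measurableC; apply: measurableU; apply: measurableI.
- exact: preimage_psiD.
- exact: preimage_psiB.
- exact: preimage_psiD.
- exact: preimage_psiB.
Qed.

Lemma measurable_missing A x : borel_set A -> measurable (missing A x : set (V * T)).
Proof.
move=> mA; apply: measurableI; apply: measurableC; first exact: preimage_psiD.
exact: (measurable_preimageT measurable_flip (preimage_psiD x mA)).
Qed.

(** The point above y, its mirror image and its antipode all project to y or -y, so any of the three
    may witness membership in B. *)
Lemma shadow_le_hausdorff (A : set ('rV[R]_n * R)) (N : set 'rV[R]_n) (B : set 'rV[R]_(n + 1)) x r :
  measurable (A : set (V * T)) -> borel_set N -> leb R n N = 0%E ->
  (forall y, enorm y < r -> A (y, hgt y r) -> N y \/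
     [\/ B (x + psi (y, hgt y r)), B (x + psi (- y, hgt y r)) | B (x - psi (y, hgt y r))]) ->
  (shadow A r <= (covK R n)%:E * hausdorff n B)%E.
Proof.
move=> mA mN N0 AB; apply: (leb_le_hausdorff (Q := Q) hQ (x := x) _ mN N0).
  exact: measurable_ysection (measurable_chart mA).
move=> y; rewrite /ysection /= inE => -[/= yr Ay].
have [|[b|b|b]] := AB y yr Ay; first by left.
- right; exists (x + psi (y, hgt y r)) => //; left.
  by rewrite addrC addKr; have [-> _] := psiK hQ (y, hgt y r).
- right; exists (x + psi (- y, hgt y r)) => //; right.
  by rewrite addrC addKr; have [-> _] := psiK hQ (- y, hgt y r); rewrite opprK.
- right; exists (x - psi (y, hgt y r)) => //; right.
  by rewrite addrC addKr prjN; have [-> _] := psiK hQ (y, hgt y r); rewrite opprK.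
Qed.

Lemma bad_pos v c x r w : 0 < r -> dotv v x = c -> enorm w = r -> 0 < dotv v w ->
  ~ P (x + w) -> bad [set y | c < dotv v y] x r (x + w).
Proof.
move=> r0 vx wr vw nP; left; split => //; split; last by rewrite /= dotvDr vx ltrDl.
by apply: esphere_enorm => //; rewrite addrC addKr.
Qed.

Lemma bad_neg v c x r w : 0 < r -> dotv v x = c -> enorm w = r -> dotv v w < 0 ->
  ~ M (x + w) -> bad [set y | c < dotv v y] x r (x + w).
Proof.
move=> r0 vx wr vw nM; right; split => //; split.
  by apply: esphere_enorm => //; rewrite addrC addKr.
by move=> /closure_halfspace; rewrite dotvDr vx lerDl leNgt vw.
Qed.

Lemma enorm_psi_hgt y r : enorm y < r -> enorm (psi (y, hgt y r)) = r.
Proof.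
move=> yr; apply/eqP; rewrite -(@eqrXn2 _ 2) ?enorm_ge0 //; last first.
  by rewrite (le_trans (enorm_ge0 y)) // ltW.
by rewrite (enorm_psi hQ) /= hgt_sqr.
Qed.

Lemma dotv_psi_eq v p : dotv v (psi p) = dotv (prj Q v) p.1 + height Q v * p.2.
Proof. by rewrite -{1}(prjK hQ v) (dotv_psi hQ). Qed.

Lemma halfspace_nz v : v != 0 -> 0 < dotv (prj Q v) (prj Q v) + height Q v ^+ 2.
Proof.
move=> v0; rewrite -enorm_sqr -(enorm_prj hQ) exprn_gt0 // lt_def enorm_ge0 andbT.
by rewrite enorm_eq0.
Qed.

(** Off the equator of H exactly one of w, -w points into H. If neither were bad, P would contain
    one endpoint and M the other, contrary to [unsplit]. *)
Lemma shadow_unsplit_le H x r : 0 < r -> open_halfspace H -> boundary H x ->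
  (shadow (unsplit x) r <= (covK R n)%:E * hausdorff n (bad H x r))%E.
Proof.
move=> r0 [v [c [v0 ->]]] /boundary_halfspace vx.
apply: (shadow_le_hausdorff (N := equator (prj Q v) (height Q v) r) (x := x)).
- exact: measurable_unsplit.
- exact: equator_measurable.
- by apply: leb_equator => //; exact: halfspace_nz.
move=> y yr Dy.
have wr := enorm_psi_hgt yr; set w := psi (y, hgt y r) in Dy wr *.
have wr' : enorm (- w) = r by rewrite enormN.
have vwE : dotv v w = dotv (prj Q v) y + height Q v * hgt y r by rewrite dotv_psi_eq.
have [w0|w0|w0] := ltgtP (dotv v w) 0.
- right; have [Mw|Mw] := pselect (M (x + w)); last first.
    by constructor 1; exact: bad_neg.
  have [Pw|Pw] := pselect (P (x - w)); first by case: Dy; right.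
  by constructor 3; apply: bad_pos => //; rewrite dotvNr oppr_gt0.
- right; have [Pw|Pw] := pselect (P (x + w)); last first.
    by constructor 1; exact: bad_pos.
  have [Mw|Mw] := pselect (M (x - w)); first by case: Dy; left.
  by constructor 3; apply: bad_neg => //; rewrite dotvNr oppr_lt0.
- by left; split => //; rewrite -vwE.
Qed.

(** For v normal to H, the values of v at w and at [flip w] add up to twice the product of their
    vertical components. If the axis points into H, one of the two points is thus on the P-side or
    on the equator; otherwise the same holds for M. The minimum accounts for the unknown case. *)
Lemma shadow_missing_le H x r : 0 < r -> open_halfspace H -> boundary H x ->
  (Order.min (shadow (missing P x) r) (shadow (missing M x) r) <=
   (covK R n)%:E * hausdorff n (bad H x r))%E.
Proof.
move=> r0 [v [c [v0 ->]]] /boundary_halfspace vx.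
pose N := equator (prj Q v) (height Q v) r `|` equator (- prj Q v) (height Q v) r.
have mN : borel_set N by apply: measurableU; exact: equator_measurable.
have N0 : leb R n N = 0%E.
  apply/eqP; rewrite eq_le measure_ge0 andbT.
  apply: le_trans (measureU2 _ _ _) _; [exact: equator_measurable|exact: equator_measurable|].
  rewrite [X in (X + _)%E]leb_equator // ?halfspace_nz // add0e.
  have e2 : leb R n (equator (- prj Q v) (height Q v) r) = 0%E.
    by apply: leb_equator => //; rewrite dotvNl dotvNr opprK; exact: halfspace_nz.
  by rewrite [leLHS]e2.
(* The sign s = 1 or -1 treats the cases of P and of M at once. *)
have key A y s : enorm y < r -> missing A x (y, hgt y r) ->
    (forall w, enorm w = r -> 0 < s * dotv v w -> ~ A (x + w) ->
      bad [set y | c < dotv v y] x r (x + w)) ->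
    0 <= s * height Q v -> s != 0 ->
    N y \/
     [\/ bad [set y | c < dotv v y] x r (x + psi (y, hgt y r)),
         bad [set y | c < dotv v y] x r (x + psi (- y, hgt y r))
       | bad [set y | c < dotv v y] x r (x - psi (y, hgt y r))].
  move=> yr [/= A1 A2] badA s0 sn0.
  have wr := enorm_psi_hgt yr.
  have wr' : enorm (psi (- y, hgt y r)) = r.
    by have := @enorm_psi_hgt (- y) r; rewrite /hgt enormN; exact.
  have e1 := dotv_psi_eq v (y, hgt y r); have e2 := dotv_psi_eq v (- y, hgt y r).
  rewrite /= dotvNr in e1 e2.
  have [p1|p1|p1] := ltgtP 0 (s * dotv v (psi (y, hgt y r))).
  - by right; constructor 1; exact: badA.
  - right; constructor 2; apply: badA => //.
    have := mulr_ge0 s0 (ltW (hgt_gt0 yr)); move: p1; rewrite e1 e2; nra.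
  - left; left; split => //; rewrite -e1; apply/eqP.
    by move/esym/eqP: p1; rewrite mulf_eq0 (negbTE sn0).
have [h0|h0] := leP 0 (height Q v).
  apply: le_trans (_ : (_ <= shadow (missing P x) r)%E) _; first by rewrite ge_min lexx.
  apply: (shadow_le_hausdorff (N := N) (x := x) _ mN N0); first exact: measurable_missing.
  move=> y yr Ay; apply: (key P y 1) => //; rewrite ?mul1r ?oner_neq0 //.
  by move=> w wr; rewrite mul1r => w0; exact: bad_pos.
apply: le_trans (_ : (_ <= shadow (missing M x) r)%E) _; first by rewrite ge_min lexx orbT.
apply: (shadow_le_hausdorff (N := N) (x := x) _ mN N0); first exact: measurable_missing.
move=> y yr Ay; apply: (key M y (-1)) => //.
- by move=> w wr; rewrite mulN1r oppr_gt0 => w0; exact: bad_neg.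
- by rewrite mulN1r oppr_ge0 ltW.
Qed.

End detection.

(** * Continuity of translations *)

Section translation_continuity.
Local Open Scope ereal_scope.
Variables (R : realType) (k : nat) (m : {measure set (borelV R k) -> \bar R}).
Hypothesis mtr : forall (A : set 'rV[R]_k) (h : 'rV[R]_k), borel_set A ->
  m [set p | A (p + h)%R] = m A.
Hypothesis mfin : forall r : R, m (eball (0%R : 'rV[R]_k) r) < +oo.

Lemma borel_setI (A B : set 'rV[R]_k) : borel_set A -> borel_set B -> borel_set (A `&` B).
Proof. by move=> mA mB; rewrite /borel_set; exact: measurableI. Qed.

Definition translate (h : 'rV[R]_k) (A : set 'rV[R]_k) : set 'rV[R]_k :=
  [set p | A (p + h)%R].

Lemma translate_measurable h A : borel_set A -> borel_set (translate h A).
Proof.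
move=> mA; rewrite /borel_set (_ : translate h A = (fun p => 1 *: p + h)%R @^-1` A).
  exact: (measurable_preimageT (measurable_affine_rV 1 h) mA).
by apply/seteqP; split => p; rewrite /translate /= scale1r.
Qed.

(** One-sided: only the points that leave A are measured. Those that enter A are handled by passing
    to the complement, that is, by replacing h with -h. *)
Definition transl_cont (A : set 'rV[R]_k) := borel_set A /\
  forall r e : R, (0 < e)%R -> exists2 d : R, (0 < d)%R & forall h : 'rV[R]_k,
    (enorm h < d)%R -> m (eball 0%R r `&` (A `\` translate h A)) <= e%:E.

Lemma measurable_gap r (A : set 'rV[R]_k) h : borel_set A ->
  borel_set (eball 0%R r `&` (A `\` translate h A)).
Proof.
move=> mA; apply: measurableI; first exact: eball_measurable.
by apply: measurableD => //; exact: translate_measurable.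
Qed.

Lemma eball_translate r h p : (enorm h < 1)%R -> eball (0%R : 'rV[R]_k) r p ->
  eball (0%R : 'rV[R]_k) (r + 1) (p + h)%R.
Proof.
rewrite /eball /= !subr0 => h1 pr.
by apply: le_lt_trans (enormD _ _) _; exact: ltrD.
Qed.

Lemma transl_contC A : transl_cont A -> transl_cont (~` A).
Proof.
move=> [mA cA]; split; first exact: measurableC.
move=> r e e0; have [d d0 H] := cA (r + 1)%R e e0.
exists (Num.min d 1%R); first by rewrite lt_min d0 ltr01.
move=> h; rewrite lt_min => /andP[hd h1].
pose S := eball (0%R : 'rV[R]_k) (r + 1) `&` (A `\` translate (- h)%R A).
have mS : borel_set S by exact: measurable_gap.
apply: (@le_trans _ _ (m (translate h S))); last first.
  by rewrite /translate mtr //; apply: H; rewrite enormN.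
apply: le_measure; rewrite ?inE //.
- by apply: measurable_gap; exact: measurableC.
- exact: translate_measurable.
move=> p [pr [nA AA]]; split; first exact: eball_translate.
split; first by apply: contrapT.
by rewrite /translate /= addrK.
Qed.

Lemma transl_contU A B : transl_cont A -> transl_cont B -> transl_cont (A `|` B).
Proof.
move=> [mA cA] [mB cB]; split; first exact: measurableU.
move=> r e e0; have e20 : (0 < e / 2)%R by rewrite divr_gt0.
have [d1 d10 H1] := cA r _ e20; have [d2 d20 H2] := cB r _ e20.
exists (Num.min d1 d2); first by rewrite lt_min d10 d20.
move=> h; rewrite lt_min => /andP[hd1 hd2].
apply: (@le_trans _ _ (m ((eball 0%R r `&` (A `\` translate h A)) `|`
                         (eball 0%R r `&` (B `\` translate h B))))).
  apply: le_measure; rewrite ?inE //.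
  - by apply: measurable_gap; exact: measurableU.
  - by apply: measurableU; exact: measurable_gap.
  move=> p [pr [[Ap|Bp] /not_orP[nA nB]]]; by [left|right].
apply: le_trans (measureU2 _ _ _) _; [exact: measurable_gap|exact: measurable_gap|].
by rewrite [e in e%:E](splitr e) EFinD; apply: leeD; [exact: H1|exact: H2].
Qed.

Lemma tail_small (r e : R) (F : (set 'rV[R]_k)^nat) : (0 < e)%R ->
  (forall j, borel_set (F j)) -> nonincreasing_seq F -> \bigcap_j F j = set0 ->
  exists N, m (eball 0%R r `&` F N) <= e%:E.
Proof.
move=> e0 mF dF F0.
have mG j : borel_set (eball 0%R r `&` F j).
  by apply: borel_setI => //; exact: eball_measurable.
have := @nonincreasing_cvg_mu _ _ _ m (fun j => eball 0%R r `&` F j).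
rewrite (_ : \bigcap_j (eball 0%R r `&` F j) = set0); last first.
  by apply/seteqP; split => // p H; rewrite -F0 => j _; have [] := H j I.
rewrite measure0 => H.
have {H} : (m \o (fun j => eball 0%R r `&` F j)) @ \oo --> 0.
  apply: H => //.
  - apply: le_lt_trans (mfin r); apply: le_measure; rewrite ?inE //; [exact: mG|exact: eball_measurable].
  - by move=> i j ij; apply/subsetPset; apply: setIS; apply/subsetPset; exact: dF.
move=> /fine_cvgP[fin /cvgrPdist_le /(_ e e0)[N _ HN]].
case: fin => N' _ HN'.
exists (maxn N N'); have := HN _ (leq_maxl N N'); have := HN' _ (leq_maxr N N').
rewrite /= => h1; rewrite sub0r normrN -lee_fin => h2.
rewrite -(fineK h1); apply: le_trans h2; rewrite lee_fin; exact: ler_norm.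
Qed.

(** A finite subunion has small complement inside a ball, by continuity of the measure from above,
    and finite unions are covered by [transl_contU]. *)
Lemma transl_cont_bigcup (F : (set 'rV[R]_k)^nat) :
  (forall j, transl_cont (F j)) -> transl_cont (\bigcup_j F j).
Proof.
move=> cF; have mF j : borel_set (F j) by have [] := cF j.
have mU : borel_set (\bigcup_j F j) by exact: bigcupT_measurable.
split=> // r e e0; have e20 : (0 < e / 2)%R by rewrite divr_gt0.
pose D N := \big[setU/set0]_(j < N) F j.
have cD N : transl_cont (D N).
  rewrite /D; elim: N => [|N IH].
    rewrite big_ord0; split; first exact: measurable0.
    by move=> r' e' e'0; exists 1%R => // h _; rewrite set0D setI0 measure0 lee_fin ltW.
  by rewrite big_ord_recr /=; exact: transl_contU.
have [N HN] : exists N, m (eball 0%R r `&` (\bigcup_j F j `\` D N)) <= (e / 2)%:E.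
  apply: tail_small => //.
  - by move=> j; apply: measurableD => //; have [] := cD j.
  - move=> i j ij; apply/subsetPset; apply: setDS; rewrite /D.
    by apply: (@subset_bigsetU _ F).
  apply/seteqP; split => // p H.
  have [[j _ Fj] _] := H 0%N I; have [_] := H j.+1 I; apply.
  by rewrite /D big_ord_recr /=; right.
have [d d0 Hd] := (cD N).2 r _ e20.
exists d => // h hd.
apply: (@le_trans _ _ (m ((eball 0%R r `&` (\bigcup_j F j `\` D N)) `|`
                         (eball 0%R r `&` (D N `\` translate h (D N)))))).
  apply: le_measure; rewrite ?inE //.
  - exact: measurable_gap.
  - apply: measurableU; last by apply: measurable_gap; have [] := cD N.
    apply: measurableI; first exact: eball_measurable.
    by apply: measurableD => //; have [] := cD N.
  move=> p [pr [Up nU]]; have [DN|nD] := pselect (D N p); last by left.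
  right; split => //; split => // hD; apply: nU.
  by move: hD; rewrite /translate /= /D -bigcup_mkord => -[j _ Fj]; exists j.
apply: le_trans (measureU2 _ _ _) _.
- apply: measurableI; first exact: eball_measurable.
  by apply: measurableD => //; have [] := cD N.
- by apply: measurable_gap; have [] := cD N.
by rewrite [e in e%:E](splitr e) EFinD; apply: leeD => //; exact: Hd.
Qed.

(** A point of U that leaves U under a short translation lies close to the complement. The sets [U]
    and [O j] have intersections decreasing to the empty set, so they become small within a ball. *)
Lemma transl_cont_open (U : set 'rV[R]_k) : open U -> transl_cont U.
Proof.
move=> oU; have mU := open_borel_set oU; split => // r e e0.
pose O j : set 'rV[R]_k := \bigcup_(q in ~` U) eball q (j.+1%:R^-1)%R.
have oO j : open (O j) by apply: bigcup_open => q _; exact: open_eball.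
have mO j : borel_set (O j) by exact: open_borel_set.
have [N HN] : exists N, m (eball 0%R r `&` (U `&` O N)) <= e%:E.
  apply: tail_small => //.
  - by move=> j; exact: borel_setI.
  - move=> i j ij; apply/subsetPset; apply: setIS => p [q nq pq]; exists q => //.
    apply: lt_le_trans pq _; rewrite lef_pV2 ?posrE ?ltr0n // ler_nat.
    by rewrite ltnS.
  apply/seteqP; split => // p H.
  have [Up _] := H 0%N I.
  have /nbhs_eballP[d d0 dU] : nbhs p U by exact: open_nbhs_nbhs.
  have [_ [q nq pq]] := H (Num.truncn d^-1) I.
  apply: nq; apply: dU; rewrite /eball /= enormB.
  apply: lt_trans pq _; rewrite invf_plt ?posrE //.
  by rewrite truncnS_gt // invr_ge0 ltW.
exists (N.+1%:R^-1)%R; first by rewrite invr_gt0.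
move=> h hN; apply: le_trans HN; apply: le_measure; rewrite ?inE //.
- exact: measurable_gap.
- by apply: borel_setI; [exact: eball_measurable|exact: borel_setI].
apply: setIS => p [Up nU]; split => //; exists (p + h)%R => //.
by rewrite /eball /= opprD addrA subrr add0r enormN.
Qed.

(** The sets with this property form a sigma-algebra containing the open sets. *)
Lemma borel_transl_cont (A : set 'rV[R]_k) : borel_set A -> transl_cont A.
Proof.
apply: (@smallest_sub _ (sigma_algebra setT) _ [set A | transl_cont A]); last first.
  by move=> U oU; exact: transl_cont_open.
split.
- by apply: transl_cont_open; exact: open0.
- by move=> B cB; rewrite setTD; exact: transl_contC.
- by move=> F cF; exact: transl_cont_bigcup.
Qed.

End translation_continuity.

(** Monotonicity read off from the supremum over simple functions, valid for non-measurable
    integrands; it is applied to the square of [epsilon_coef] divided by r. *)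
Lemma le_integral_ge0 d (T : measurableType d) (R : realType)
    (mu : {measure set T -> \bar R}) (D : set T) (f g : T -> \bar R) :
  (forall x, D x -> (0 <= f x)%E) -> (forall x, D x -> (f x <= g x)%E) ->
  (\int[mu]_(x in D) f x <= \int[mu]_(x in D) g x)%E.
Proof.
move=> f0 fg; rewrite !ge0_integralE //; last first.
  by move=> x Dx; exact: le_trans (f0 _ Dx) (fg _ Dx).
apply: ge_ereal_sup => _ [h hf <-]; apply: ereal_sup_ubound; exists h => // x.
by apply: le_trans (hf x) _; exact: lee_restrict.
Qed.

(** * From pointwise bounds on the coefficients to their square integral *)

Section epsilon.
Variables (R : realType) (n : nat) (P M : set 'rV[R]_(n + 1)).

Lemma hausdorff_ge0 m k (A : set 'rV[R]_m) : (0 <= hausdorff k A)%E.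
Proof.
apply: (@le_trans _ _ (hausdorff_pre k 1 A)); last first.
  by apply: ereal_sup_ubound; exists 1 => /=.
apply: le_ereal_inf_tmp => _ [U [_ _ ->]]; apply: nneseries_ge0 => i _ _.
by rewrite mule_ge0 ?expe_ge0 ?ediam_ge0 // lee_fin divr_ge0 // ltW // unit_ball_volume_gt0.
Qed.

Lemma epsilon_coef_ge0 x r : 0 < r -> (0 <= epsilon_coef P M x r)%E.
Proof.
move=> r0; rewrite mule_ge0 // ?lee_fin ?invr_ge0 ?exprn_ge0 ?(ltW r0) //.
by apply: le_ereal_inf_tmp => _ [H _ <-]; exact: hausdorff_ge0.
Qed.

Lemma le_epsilon_coef (a : \bar R) x r : 0 < r ->
  (forall H, open_halfspace H -> boundary H x ->
     (a <= (covK R n)%:E * hausdorff n (bad P M H x r))%E) ->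
  (a <= (covK R n * r ^+ n)%:E * epsilon_coef P M x r)%E.
Proof.
move=> r0 aH; rewrite /epsilon_coef muleA -EFinM.
rewrite -mulrA divff ?mulr1; last by rewrite expf_neq0 // gt_eqF.
rewrite -lee_pdivrMl ?covK_gt0 //.
apply: le_ereal_inf_tmp => _ [H [oH bH] <-].
by rewrite lee_pdivrMl ?covK_gt0 //; exact: aH.
Qed.

Definition sqint (r0 : R) x : \bar R :=
  (\int[lebesgue_measure]_(r in `]0%R, (20 * r0)%R[)
     ((epsilon_coef P M x r) ^+ 2 * (r^-1)%:E))%E.

(** The square of covK r^n epsilon is covK^2 r^(2n+1) times epsilon^2/r; the power of r is then
    bounded by its value at r1. *)
Definition sqK (r1 : R) : R := covK R n ^+ 2 * r1 ^+ (2 * n).+1.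

Lemma sqK_gt0 r1 : 0 < r1 -> 0 < sqK r1.
Proof. by move=> r10; rewrite mulr_gt0 ?exprn_gt0 // covK_gt0. Qed.

Lemma sqint_ge (r0 : R) x (g : R -> \bar R) : 0 < r0 ->
  measurable_fun setT (g : measurableTypeR R -> \bar R) ->
  (forall r, (0 <= g r)%E) ->
  (forall r, 0 < r -> (g r <= (covK R n * r ^+ n)%:E * epsilon_coef P M x r)%E) ->
  (\int[lebesgue_measure]_(r in `]0%R, (20 * r0)%R[) (g r ^+ 2) <=
   (sqK (20 * r0))%:E * sqint r0 x)%E.
Proof.
move=> r00 mg g0 gle.
have C0 : 0 < sqK (20 * r0) by apply: sqK_gt0; rewrite mulr_gt0.
rewrite -lee_pdivrMl // -ge0_integralZl //; last 3 first.
- by apply: measurable_funTS; under eq_fun do rewrite expe2; exact: emeasurable_funM.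
- by move=> r _; rewrite expe_ge0.
- by rewrite lee_fin invr_ge0 ltW.
apply: le_integral_ge0 => r; rewrite /= in_itv /= => /andP[r_gt0 r1].
  by rewrite !mule_ge0 // lee_fin invr_ge0 ltW.
set e := epsilon_coef P M x r.
have e0 : (0 <= e)%E by exact: epsilon_coef_ge0.
rewrite (muleC (e * e)%E).
apply: (@le_trans _ _ ((sqK (20 * r0))^-1%:E * (((covK R n * r ^+ n) ^+ 2)%:E * (e * e)))%E).
  rewrite lee_wpmul2l ?lee_fin ?invr_ge0 ?(ltW C0) //.
  rewrite expr2 EFinM muleACA.
  by apply: lee_pmul => //; exact: gle.
rewrite muleA -EFinM; apply: lee_wpmul2r; first by rewrite mule_ge0.
rewrite lee_fin.
rewrite ler_pdivrMl // ler_pdivlMr // /sqK exprMn -exprM -mulrA -exprSr mulnC.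
rewrite ler_wpM2l ?sqr_ge0 // lerXn2r ?nnegrE ?mulr_ge0 ?(ltW r00) ?(ltW r1) //.
by rewrite ltW.
Qed.

End epsilon.

Section lam_invariance.
Variables (R : realType) (n : nat).
Notation V := (borelV R n).
Notation T := (measurableTypeR R).

Lemma lam_affine (b1 b2 : R) (a : 'rV[R]_n) (c : R) (A : set (V * T)) :
  b1 = 1 \/ b1 = -1 -> b2 = 1 \/ b2 = -1 -> measurable A ->
  lam R n ((fun p => (b1 *: p.1 + a, b2 * p.2 + c)) @^-1` A) = lam R n A.
Proof.
move=> h1 h2 mA.
apply: (product_measure_preimage (m1 := leb R n) (m2 := @lebesgue_measure R)
   (f1 := fun y => b1 *: y + a) (f2 := fun t => b2 * t + c)) => //.
- exact: measurable_affine_rV.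
- exact: measurable_scale_add.
- by move=> B mB; exact: leb_affine.
- by move=> B mB; exact: lebesgue_measure_affine.
Qed.

Lemma shadow_ge0 (A : set ('rV[R]_n * R)) r : (0 <= shadow A r)%E.
Proof. exact: measure_ge0. Qed.

Lemma integral_shadow (A : set (V * T)) (r1 : R) : measurable A ->
  (\int[lebesgue_measure]_(r in `]0%R, r1[) shadow A r = lam R n (chart A `&` below r1))%E.
Proof.
move=> mA; rewrite lamE2; last first.
  by apply: measurableI; [exact: measurable_chart|exact: measurable_below].
rewrite integral_mkcond; apply: eq_integral => r _; rewrite /patch.
case: ifPn => [|/negP]; rewrite inE /= in_itv /=.
  move=> /andP[_ rr1]; rewrite /shadow; congr (leb R n _).
  apply/seteqP; split => y; rewrite /ysection /= !inE /below; last by case.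
  by move=> h; split.
move=> nr; rewrite (_ : ysection _ _ = set0) ?measure0 //.
apply/seteqP; split => // y; rewrite /ysection /= inE => -[[/= yr _] /= rr1].
by apply: nr; rewrite (le_lt_trans (enorm_ge0 y)).
Qed.

End lam_invariance.

(** * Exact symmetries at limit points *)

Lemma measure_bigcup_null d (T : measurableType d) (R : realType)
    (mu : {measure set T -> \bar R}) (F : (set T)^nat) :
  (forall k, measurable (F k)) -> (forall k, mu (F k) = 0%E) -> mu (\bigcup_k F k) = 0%E.
Proof.
move=> mF F0; apply/eqP; rewrite eq_le measure_ge0 andbT.
apply: le_trans (measure_sigma_subadditive mu mF _ (@subset_refl _ _)) _.
  exact: bigcupT_measurable.
by rewrite eseries0.
Qed.

Lemma integral_affine_sum d (X : measurableType d) (R : realType)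
    (mu : {measure set X -> \bar R}) (D : set X) (a c : R) (f g h : X -> \bar R) :
  measurable D -> 0 <= a -> 0 <= c ->
  measurable_fun setT f -> measurable_fun setT g -> measurable_fun setT h ->
  (forall x, (0 <= f x)%E) -> (forall x, (0 <= g x)%E) -> (forall x, (0 <= h x)%E) ->
  (\int[mu]_(x in D) ((a%:E + c%:E * f x) + (g x + h x)) =
   (a%:E * mu D + c%:E * \int[mu]_(x in D) f x) +
   (\int[mu]_(x in D) g x + \int[mu]_(x in D) h x))%E.
Proof.
move=> mD a0 c0 mf mg mh f0 g0 h0.
have mf' := measurable_funTS mf; have mg' := measurable_funTS mg.
have mh' := measurable_funTS mh.
have mcf : measurable_fun D (fun x => c%:E * f x)%E by exact: measurable_funeM.
have cf0 x : (0 <= c%:E * f x)%E by rewrite mule_ge0 // lee_fin.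
rewrite ge0_integralD //; last 4 first.
- by move=> x _; rewrite adde_ge0 // lee_fin.
- exact: emeasurable_funD.
- by move=> x _; rewrite adde_ge0.
- exact: emeasurable_funD.
rewrite ge0_integralD // ge0_integralD //.
by rewrite integral_cst // ge0_integralZl // lee_fin.
Qed.

Section limit_points.
Variables (R : realType) (n : nat) (Q : 'M[R]_(n + 1)).
Hypothesis hQ : Q *m Q^T = 1%:M.
Hypothesis hn : (0 < n)%N.
Variables (P M : set 'rV[R]_(n + 1)).
Hypothesis (mP : borel_set P) (mM : borel_set M).
Variable r0 : R.
Hypothesis r00 : 0 < r0.

Notation V := (borelV R n).
Notation T := (measurableTypeR R).
Notation psi := (psi Q).
Notation lam := (lam R n).

(** Lebesgue measure on R^(n+1), seen through the frame Q. What is used of it is the invariance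
    below, the finiteness on balls, and its link with [lam]. *)
Definition mur : {measure set (borelV R (n + 1)) -> \bar R} :=
  mpush lam (@measurable_psi R n Q).

Lemma murE (A : set 'rV[R]_(n + 1)) : mur A = lam (psi @^-1` A).
Proof. by []. Qed.

Lemma mur_affine b x (A : set 'rV[R]_(n + 1)) : b = 1 \/ b = -1 -> borel_set A ->
  mur [set p | A (b *: p + x)] = mur A.
Proof.
move=> hb mA; rewrite !murE.
rewrite -[RHS](lam_affine (prj Q x) (height Q x) hb hb); last first.
  exact: (measurable_preimageT (@measurable_psi R n Q) mA).
have e p : b *: psi p + x = psi (b *: p.1 + prj Q x, b * p.2 + height Q x).
  by rewrite -{1}(prjK hQ x) -psiZ -psiD.
by congr (lam _); apply/seteqP; split => p; rewrite /= e.
Qed.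

Lemma mur_translate (A : set 'rV[R]_(n + 1)) h : borel_set A ->
  mur [set p | A (p + h)] = mur A.
Proof.
move=> mA; transitivity (mur [set p | A (1 *: p + h)]); last first.
  by apply: mur_affine => //; left.
by congr (mur _); apply/seteqP; split => p /=; rewrite scale1r.
Qed.

Lemma mur_eball r : (mur (eball 0%R r) < +oo)%E.
Proof.
have [rneg|r_ge0] := ltP r 0.
  rewrite (_ : eball _ _ = set0) ?measure0 ?ltry //; apply/seteqP; split => // p.
  by rewrite /eball /= => /(le_lt_trans (enorm_ge0 _)) /(lt_trans rneg); rewrite ltxx.
rewrite murE; apply: (@le_lt_trans _ _ (lam (eball 0 (r + 1) `*` `[- (r + 1), r + 1]%classic))).
  apply: le_measure; rewrite ?inE.
  - exact: (measurable_preimageT (@measurable_psi R n Q) (eball_measurable 0 r)).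
  - by apply: measurableX; [exact: eball_measurable|exact: measurable_itv].
  move=> p; rewrite /eball /= !subr0 => pr; split.
    apply: lt_trans (_ : r < r + 1); last by rewrite ltrDl.
    by apply: le_lt_trans pr; have := enorm_prj_le hQ (psi p); rewrite (prj_psi hQ).
  rewrite in_itv /= -ler_norml; apply: le_trans (_ : r <= r + 1); last by rewrite lerDl.
  apply: le_trans (ltW pr); have := height_le hQ (psi p).
  by rewrite (height_psi hQ).
rewrite [X in (X < _)%E](product_measure1E (leb R n) (@lebesgue_measure R)).
- have /fineK E : leb R n (eball (0 : 'rV[R]_n) (r + 1)) \is a fin_num.
    by rewrite ge0_fin_numE // leb_eball_fin.
  rewrite -[X in (X * _)%E]E.
  rewrite [X in (_ * X)%E](lebesgue_measure_itv `[- (r + 1), r + 1]) /=.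
  case: ifP => _; last by rewrite mule0 ltry.
  by rewrite -EFinD -EFinM ltry.
- exact: eball_measurable.
- exact: measurable_itv.
Qed.

Definition gap (A : set 'rV[R]_(n + 1)) (f : 'rV[R]_n * R -> 'rV[R]_n * R) z x :
  set ('rV[R]_n * R) := [set p | A (x + psi (f p)) /\ ~ A (z + psi (f p))].

(** Measure- and norm-preserving maps. The identity, [opp] and [flip] are the three instances; they
    relate a point to its antipode and to its mirror image. *)
Definition adm (f : 'rV[R]_n * R -> 'rV[R]_n * R) :=
  [/\ measurable_fun setT (f : V * T -> V * T),
      forall A : set (V * T), measurable A -> lam (f @^-1` A) = lam A
    & forall p, enorm (f p).1 = enorm p.1 /\ (f p).2 ^+ 2 = p.2 ^+ 2].

Lemma adm_id : adm id.
Proof. by split => //; exact: measurable_id. Qed.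

Definition opp (p : 'rV[R]_n * R) := (- p.1, - p.2).

Lemma opp_affine : opp = (fun p => (-1 *: p.1 + 0, -1 * p.2 + 0)).
Proof. by apply/funext => p; rewrite /opp scaleN1r mulN1r !addr0. Qed.

Lemma flip_affine : @flip R n = (fun p => (-1 *: p.1 + 0, 1 * p.2 + 0)).
Proof. by apply/funext => p; rewrite /flip scaleN1r mul1r !addr0. Qed.

Lemma measurable_opp : measurable_fun setT (opp : V * T -> V * T).
Proof.
rewrite opp_affine; apply: measurable_fun_pair.
  exact: measurableT_comp (measurable_affine_rV (-1) 0) measurable_fst.
exact: measurableT_comp (measurable_scale_add (-1) 0) measurable_snd.
Qed.

Lemma adm_opp : adm opp.
Proof.
split; first exact: measurable_opp.
  by move=> A mA; rewrite opp_affine lam_affine //; right.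
by move=> p; rewrite /opp /= enormN sqrrN.
Qed.

Lemma adm_flip : adm (@flip R n).
Proof.
split; first exact: measurable_flip.
  by move=> A mA; rewrite flip_affine lam_affine //; [right|left].
by move=> p; rewrite /flip /= enormN.
Qed.

Lemma measurable_gap_set A f z x : borel_set A -> adm f ->
  measurable (gap A f z x : set (V * T)).
Proof.
move=> mA [mf _ _]; apply: measurableI; last apply: measurableC.
  exact: (measurable_preimageT mf (preimage_psiD Q x mA)).
exact: (measurable_preimageT mf (preimage_psiD Q z mA)).
Qed.

Lemma gap_small A f z r e : borel_set A -> adm f -> 0 < e ->
  exists2 d, 0 < d & forall x, enorm (x - z) < d ->
    (lam (gap A f z x `&` rball r) <= e%:E)%E.
Proof.
move=> mA af e0; have [mf lf nf] := af.
have [_ cA] := borel_transl_cont mur_translate mur_eball mA.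
(* Large enough to contain psi p + x when p lies in [rball r] and x is within 1 of z. *)
have [d d0 H] := cA (`|r| + enorm z + 1) e e0.
exists (Num.min d 1); first by rewrite lt_min d0 ltr01.
move=> x; rewrite lt_min => /andP[xd x1].
have -> : gap A f z x `&` rball r = f @^-1` (gap A id z x `&` rball r).
  apply/seteqP; split => p [Ap pr]; split => //.
    by have [h1 h2] := nf p; rewrite /rball /= h1 h2.
  by move: pr; have [h1 h2] := nf p; rewrite /rball /= h1 h2.
have mg := measurable_gap_set z x mA adm_id.
rewrite lf; last by apply: measurableI => //; exact: measurable_rball.
have zx : enorm (z - x) < d by rewrite enormB.
apply: le_trans (H _ zx).
set S := (X in mur X).
have mS : borel_set S by exact: measurable_gap.
rewrite -(mur_translate x mS) murE; apply: le_measure; rewrite ?inE.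
- by apply: measurableI => //; exact: measurable_rball.
- exact: (measurable_preimageT (@measurable_psi R n Q) (translate_measurable x mS)).
move=> p [[/= Ap nAp] pr]; split.
  rewrite /eball /= subr0; apply: le_lt_trans (enormD _ _) _.
  rewrite -addrA; apply: ltr_leD.
    rewrite -(ltr_pXn2r (n := 2)) ?nnegrE ?enorm_ge0 // (enorm_psi hQ).
    by rewrite real_normK ?num_real.
  rewrite -[x in enorm x](subrK z) addrC (le_trans (enormD _ _)) //.
  by rewrite lerD2r ltW.
split; first by rewrite /= addrC.
by rewrite /translate /= addrC [psi p + x]addrC addrA subrK.
Qed.

(* The set Z of the header comment. *)
Definition flatpt z := forall rho del : R, 0 < rho -> 0 < del ->
  exists2 x, enorm (x - z) < rho & (sqint P M r0 x < del%:E)%E.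

(** Only the points of [A z] lost at x count: this one-sided continuity suffices to carry smallness
    of [A x], for x near z, over to [A z]. *)
Definition diff_small (A : 'rV[R]_(n + 1) -> set ('rV[R]_n * R)) z :=
  forall e : R, 0 < e -> exists2 d, 0 < d & forall x, enorm (x - z) < d ->
    (lam ((A z `\` A x) `&` rball (20 * r0)) <= e%:E)%E.

Lemma diff_small_gap A z (U1 U2 U3 U4 : set 'rV[R]_(n + 1)) f1 f2 f3 f4 :
  (forall x, measurable (A x : set (V * T))) ->
  borel_set U1 -> borel_set U2 -> borel_set U3 -> borel_set U4 ->
  adm f1 -> adm f2 -> adm f3 -> adm f4 ->
  (forall x, A z `\` A x `<=` (gap U1 f1 z x `|` gap U2 f2 z x) `|`
                              (gap U3 f3 z x `|` gap U4 f4 z x)) ->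
  diff_small A z.
Proof.
move=> mA mU1 mU2 mU3 mU4 a1 a2 a3 a4 H e e0.
have e40 : 0 < e / 4 by rewrite divr_gt0.
have [d1 d10 H1] := gap_small z (20 * r0) mU1 a1 e40.
have [d2 d20 H2] := gap_small z (20 * r0) mU2 a2 e40.
have [d3 d30 H3] := gap_small z (20 * r0) mU3 a3 e40.
have [d4 d40 H4] := gap_small z (20 * r0) mU4 a4 e40.
exists (Num.min (Num.min d1 d2) (Num.min d3 d4)).
  by rewrite !lt_min d10 d20 d30 d40.
move=> x; rewrite !lt_min => /andP[/andP[h1 h2] /andP[h3 h4]].
have mB := @measurable_rball R n (20 * r0).
have m1 : measurable (gap U1 f1 z x `&` rball (20 * r0) : set (V * T)).
  by apply: measurableI => //; exact: measurable_gap_set.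
have m2 : measurable (gap U2 f2 z x `&` rball (20 * r0) : set (V * T)).
  by apply: measurableI => //; exact: measurable_gap_set.
have m3 : measurable (gap U3 f3 z x `&` rball (20 * r0) : set (V * T)).
  by apply: measurableI => //; exact: measurable_gap_set.
have m4 : measurable (gap U4 f4 z x `&` rball (20 * r0) : set (V * T)).
  by apply: measurableI => //; exact: measurable_gap_set.
apply: (@le_trans _ _ (lam (((gap U1 f1 z x `&` rball (20 * r0)) `|`
    (gap U2 f2 z x `&` rball (20 * r0))) `|` ((gap U3 f3 z x `&` rball (20 * r0)) `|`
    (gap U4 f4 z x `&` rball (20 * r0)))))).
  apply: le_measure; rewrite ?inE.
  - by apply: measurableI => //; exact: measurableD.
  - by apply: measurableU; exact: measurableU.
  by move=> p [/H[[?|?]|[?|?]] pr]; [left; left|left; right|right; left|right; right].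
apply: le_trans (measureU2 _ _ _) _; [exact: measurableU|exact: measurableU|].
have -> : e = (e / 4 + e / 4) + (e / 4 + e / 4) by field.
rewrite [X in (_ <= X)%E]EFinD; apply: leeD; rewrite EFinD;
  (apply: le_trans (measureU2 _ _ _) _ => //; apply: leeD).
- exact: H1.
- exact: H2.
- exact: H3.
- exact: H4.
Qed.

Lemma unsplit_diff_small z : diff_small (unsplit Q P M) z.
Proof.
have psiO p : psi (opp p) = - psi p by exact: psiN.
apply: (@diff_small_gap _ z P M M P id opp id opp) => //;
  try exact: adm_id; try exact: adm_opp.
  by move=> x; exact: measurable_unsplit.
move=> x p [/= Dz /contrapT Dx]; rewrite /gap /= !psiO.
case: Dx => -[h1 h2]; [left|right]; apply: contrapT => /not_orP[g1 g2].
  apply: Dz; left; split; apply: contrapT => h; [apply: g1|apply: g2]; by split.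
apply: Dz; right; split; apply: contrapT => h; [apply: g1|apply: g2]; by split.
Qed.

Lemma missing_diff_small A z : borel_set A -> diff_small (missing Q A) z.
Proof.
move=> mA; apply: (@diff_small_gap _ z A A A A id (@flip R n) id (@flip R n)) => //;
  try exact: adm_id; try exact: adm_flip.
  by move=> x; exact: measurable_missing.
move=> x p [/= [h1 h2] nx]; rewrite /gap /=; left.
apply: contrapT => /not_orP[g1 g2]; apply: nx.
by split => h; [apply: g1|apply: g2].
Qed.

Lemma lee_mul2l (c : R) (a b : \bar R) : 0 <= c -> (a <= b)%E -> (c%:E * a <= c%:E * b)%E.
Proof. by move=> c0 ab; apply: lee_wpmul2l => //; rewrite lee_fin. Qed.

Lemma measurable_expe2 d (X : measurableType d) (f : X -> \bar R) :
  measurable_fun setT f -> measurable_fun setT (fun x => f x ^+ 2)%E.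
Proof.
move=> mf; rewrite (_ : (fun _ => _) = (fun x => f x * f x)%E) //.
exact: emeasurable_funM.
Qed.

(** Passes from square integrals to integrals in place of the Cauchy-Schwarz inequality, and allows
    s to be infinite. *)
Lemma le_eta_sqr (eta : R) (s : \bar R) : 0 < eta -> (0 <= s)%E ->
  (s <= eta%:E + (eta^-1)%:E * s ^+ 2)%E.
Proof.
move=> eta0; case: s => [s s0|_|] //; last first.
  by rewrite expe2 mulyy gt0_muley ?lte_fin ?invr_gt0 // addey.
rewrite -EFin_expe -EFinM -EFinD lee_fin -subr_ge0.
rewrite (_ : _ - _ = eta^-1 * ((s - eta / 2) ^+ 2 + 3 / 4 * eta ^+ 2)).
  by rewrite mulr_ge0 ?invr_ge0 ?(ltW eta0) // addr_ge0 ?sqr_ge0 // mulr_ge0 ?sqr_ge0 // divr_ge0.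
by field; rewrite gt_eqF.
Qed.

Lemma shadow_sub (W W' : set (V * T)) r : measurable W -> measurable W' ->
  (shadow W r <= shadow W' r + shadow (W `\` W') r)%E.
Proof.
move=> mW mW'; rewrite /shadow.
have m1 := measurable_ysection r (measurable_chart mW).
have m2 := measurable_ysection r (measurable_chart mW').
have m3 := measurable_ysection r (measurable_chart (measurableD mW mW')).
apply: le_trans (measureU2 _ m2 m3).
apply: le_measure; rewrite ?inE; [exact: m1|exact: measurableU m2 m3|].
move=> y; rewrite /ysection /= !inE => -[yr Wy].
by have [h|h] := pselect (W' (y, hgt y r)); [left|right]; split.
Qed.

Lemma integral_shadow_small (W : set (V * T)) (r1 e : R) : 0 < r1 -> measurable W ->
  (lam (W `&` rball r1) <= e%:E)%E ->
  (\int[lebesgue_measure]_(r in `]0%R, r1[) shadow W r <= (2 * e)%:E)%E.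
Proof.
move=> r10 mW hW; rewrite integral_shadow //.
have mWr : measurable (W `&` rball r1 : set (V * T)).
  exact: measurableI mW (@measurable_rball R n r1).
have mWu : measurable (W `&` rball r1 `&` upper 0 : set (V * T)).
  exact: measurableI mWr (@measurable_upper R n 0).
have sub1 : (lam (W `&` rball r1 `&` upper 0) <= lam (W `&` rball r1))%E.
  by apply: le_measure; rewrite ?inE; [exact: mWu|exact: mWr|move=> p []].
apply: (@le_trans _ _ (lam (chart (W `&` rball r1)))).
  have mc := measurable_chart mWr.
  apply: le_measure; rewrite ?inE; [|exact: mc|].
    exact: measurableI (measurable_chart mW) (@measurable_below R n r1).
  move=> p [[pr Wp] pb]; split => //; split => //; rewrite /rball /= hgt_sqr //.
  rewrite ltr_pXn2r ?nnegrE ?(ltW r10) //.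
  by rewrite (le_trans (enorm_ge0 p.1)) // ltW.
apply: le_trans (lam_chart_le mWr) _; rewrite EFinM.
by apply: lee_mul2l => //; exact: le_trans sub1 hW.
Qed.

(** At points x near z with small integral the minimum is small on average by [sqint_ge]; replacing
    z by x costs only the shadows of the two differences. *)
Lemma limit_min (A B : 'rV[R]_(n + 1) -> set ('rV[R]_n * R)) z :
  (forall x, measurable (A x : set (V * T))) ->
  (forall x, measurable (B x : set (V * T))) ->
  (forall x r, 0 < r -> (Order.min (shadow (A x) r) (shadow (B x) r) <=
     (covK R n * r ^+ n)%:E * epsilon_coef P M x r)%E) ->
  diff_small A z -> diff_small B z -> flatpt z ->
  (\int[lebesgue_measure]_(r in `]0%R, (20 * r0)%R[)
     Order.min (shadow (A z) r) (shadow (B z) r) = 0)%E.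
Proof.
move=> mA mB AB dA dB hz.
have R00 : 0 < 20 * r0 by rewrite mulr_gt0.
have msig x : measurable_fun setT
    (fun r : T => Order.min (shadow (A x) r) (shadow (B x) r) : \bar R).
  by apply: measurable_mine; exact: measurable_shadow.
have msig0 x r : (0 <= Order.min (shadow (A x) r) (shadow (B x) r))%E.
  by rewrite le_min !shadow_ge0.
apply/eqP; rewrite eq_le integral_ge0 ?andbT; last by move=> r _; exact: msig0.
apply/lee_addgt0Pr => e e0; rewrite add0e.
(* Budget: two shares for [le_eta_sqr], two for each of the two difference sets, and two to
   spare. *)
pose e4 := e / 8.
have e40 : 0 < e4 by rewrite divr_gt0.
have [d1 d10 H1] := dA _ e40; have [d2 d20 H2] := dB _ e40.
(* The constant eta then integrates to [e4], and [del] below makes the quadratic term at most [e4]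
   as well. *)
pose eta := e4 / (20 * r0).
have eta0 : 0 < eta by rewrite divr_gt0.
have C0 := @sqK_gt0 R n _ R00.
pose del := e4 * eta / sqK n (20 * r0).
have del0 : 0 < del by rewrite divr_gt0 // mulr_gt0.
have [|x xz Ix] := hz (Num.min d1 d2) del _ del0; first by rewrite lt_min d10 d20.
move: xz; rewrite lt_min => /andP[/H1 h1 /H2 h2].
have mDA : measurable (A z `\` A x : set (V * T)) by exact: measurableD.
have mDB : measurable (B z `\` B x : set (V * T)) by exact: measurableD.
pose m r := Order.min (shadow (A x) r) (shadow (B x) r).
have small (W : set (V * T)) : measurable W -> (lam (W `&` rball (20 * r0)) <= e4%:E)%E ->
    (\int[lebesgue_measure]_(r in `]0%R, (20 * r0)%R[) shadow W r <= (2 * e4)%:E)%E.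
  by move=> mW; exact: integral_shadow_small.
have mm : measurable_fun setT (m : T -> \bar R) by exact: msig.
have me2 : measurable_fun setT (fun r : T => m r ^+ 2 : \bar R)%E.
  exact: measurable_expe2.
have mg : measurable_fun setT (fun r : T => eta%:E + (eta^-1)%:E * (m r) ^+ 2 : \bar R)%E.
  by apply: emeasurable_funD => //; exact: measurable_funeM.
have sub r : (Order.min (shadow (A z) r) (shadow (B z) r) <=
    (eta%:E + (eta^-1)%:E * (m r) ^+ 2) + (shadow (A z `\` A x) r + shadow (B z `\` B x) r))%E.
  apply: (@le_trans _ _ (m r + (shadow (A z `\` A x) r + shadow (B z `\` B x) r))%E).
    rewrite /m; have [sAB|sAB] := leP (shadow (A x) r) (shadow (B x) r).
      apply: (@le_trans _ _ (shadow (A z) r)); first by rewrite ge_min lexx.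
      apply: le_trans (shadow_sub _ (mA z) (mA x)) _; apply: leeD2l.
      by rewrite leeDl // shadow_ge0.
    apply: (@le_trans _ _ (shadow (B z) r)); first by rewrite ge_min lexx orbT.
    apply: le_trans (shadow_sub _ (mB z) (mB x)) _; apply: leeD2l.
    by rewrite leeDr // shadow_ge0.
  by apply: leeD2r; apply: le_eta_sqr => //; exact: msig0.
apply: (@le_trans _ _ (\int[lebesgue_measure]_(r in `]0%R, (20 * r0)%R[)
   ((eta%:E + (eta^-1)%:E * (m r) ^+ 2) + (shadow (A z `\` A x) r + shadow (B z `\` B x) r)))%E).
  by apply: le_integral_ge0 => r _.
have e2 r : (0 <= m r ^+ 2)%E by rewrite expe_ge0 // msig0.
have mD : measurable (`]0%R, (20 * r0)%R[%classic : set T) by exact: measurable_itv.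
have eta_ge0 : 0 <= eta^-1 by rewrite invr_ge0 ltW.
rewrite (integral_affine_sum lebesgue_measure mD (ltW eta0) eta_ge0 me2
  (measurable_shadow mDA) (measurable_shadow mDB) e2 (shadow_ge0 _) (shadow_ge0 _)).
have -> : e%:E = ((e4 + e4 + (2 * e4 + 2 * e4)) + 2 * e4)%:E.
  by congr EFin; rewrite /e4; field.
rewrite EFinD -[X in (X <= _)%E]adde0; apply: leeD; last first.
  by rewrite lee_fin mulr_ge0 // ltW.
rewrite EFinD; apply: leeD; last first.
  by rewrite EFinD; apply: leeD; exact: small.
rewrite EFinD; apply: leeD.
  rewrite [X in (_ * X)%E](lebesgue_measure_itv `]0%R, (20 * r0)%R[) /= lte_fin R00 -EFinD -EFinM lee_fin subr0 /eta.
  by rewrite divfK // gt_eqF.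
rewrite -[leRHS](_ : (eta^-1)%:E * (e4 * eta)%:E = _)%E; last first.
  by rewrite -EFinM; congr EFin; field; rewrite gt_eqF.
apply: lee_mul2l => //.
apply: le_trans (sqint_ge r00 (msig x) (msig0 x) (AB x)) _.
have -> : (e4 * eta)%:E = ((sqK n (20 * r0))%:E * del%:E)%E.
  by rewrite -EFinM /del; congr EFin; field; rewrite gt_eqF.
by apply: lee_mul2l; rewrite ltW.
Qed.

(** [limit_min] with both families equal. Null shadows give null volume only at heights above a
    positive c, so the upper half-space is exhausted by c = 1/(k+1). *)
Lemma unsplit_flatpt z : flatpt z -> lam (unsplit Q P M z `&` (upper 0 `&` rball (20 * r0))) = 0%E.
Proof.
move=> hz; have R00 : 0 < 20 * r0 by rewrite mulr_gt0.
have mD := measurable_unsplit Q mP mM z.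
have := @limit_min (unsplit Q P M) (unsplit Q P M) z (fun x => measurable_unsplit Q mP mM x)
  (fun x => measurable_unsplit Q mP mM x) _ (unsplit_diff_small z) (unsplit_diff_small z) hz.
have H x r : 0 < r -> (Order.min (shadow (unsplit Q P M x) r) (shadow (unsplit Q P M x) r) <=
     (covK R n * r ^+ n)%:E * epsilon_coef P M x r)%E.
  move=> r_gt0; rewrite minxx; apply: le_epsilon_coef => // H oH bH.
  exact: shadow_unsplit_le.
move=> /(_ H); under eq_integral do rewrite minxx.
rewrite integral_shadow // => h0.
have up c : 0 < c -> lam (unsplit Q P M z `&` (upper c `&` rball (20 * r0))) = 0%E.
  move=> c0; apply/eqP; rewrite eq_le measure_ge0 andbT.
  by apply: le_trans (lam_le_chart mD c0 R00) _; rewrite h0 mule0.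
apply: (@subset_measure0 _ _ _ lam _ (\bigcup_k (unsplit Q P M z `&`
    (upper k.+1%:R^-1 `&` rball (20 * r0))))) => //.
- apply: measurableI => //; apply: measurableI; first exact: measurable_upper.
  exact: measurable_rball.
- apply: bigcupT_measurable => k; apply: measurableI => //.
  by apply: measurableI; [exact: measurable_upper|exact: measurable_rball].
- move=> p [Dp [p0 pr]]; exists (Num.truncn p.2^-1) => //; split => //; split => //.
  rewrite /upper /= invf_plt ?posrE //.
  by rewrite truncnS_gt // invr_ge0 ltW.
apply: measure_bigcup_null => k.
  apply: measurableI => //.
  by apply: measurableI; [exact: measurable_upper|exact: measurable_rball].
by apply: up; rewrite invr_gt0.
Qed.

Lemma missing_flatpt z : flatpt z -> (\int[lebesgue_measure]_(r in `]0%R, (20 * r0)%R[)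
     Order.min (shadow (missing Q P z) r) (shadow (missing Q M z) r) = 0)%E.
Proof.
move=> hz; apply: limit_min => //; [move=> x; exact: measurable_missing..| | |].
- move=> x r r_gt0; apply: le_epsilon_coef => // H oH bH.
  exact: shadow_missing_le.
- exact: missing_diff_small.
- exact: missing_diff_small.
Qed.

End limit_points.

(** * Periods *)

Section periods.
Variables (R : realType) (n : nat) (Q : 'M[R]_(n + 1)).
Hypothesis hQ : Q *m Q^T = 1%:M.
Hypothesis hn : (0 < n)%N.
Variables (P M : set 'rV[R]_(n + 1)).
Hypothesis (mP : borel_set P) (mM : borel_set M) (PM : P `&` M = set0).
Variable r0 : R.
Hypothesis r00 : 0 < r0.
Variable z : 'rV[R]_(n + 1).
Hypothesis hz : flatpt P M r0 z.

Notation U := 'rV[R]_(n + 1).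
Notation mur := (mur Q).
Notation height := (height Q).

Definition period (A : set U) (w : U) :=
  mur.-negligible [set p : borelV R (n + 1) | A p /\ ~ (P p <-> P (p + w))].

Lemma negligible_translate (A : set U) (w : U) :
  mur.-negligible (A : set (borelV R (n + 1))) ->
  mur.-negligible ([set p | A (p + w)] : set (borelV R (n + 1))).
Proof.
move=> [N [mN N0 AN]]; exists [set p | N (p + w)]; split.
- exact: translate_measurable.
- by rewrite (mur_translate hQ).
- by move=> p /= /AN.
Qed.

Lemma period_mono (A B : set U) w : A `<=` B -> period B w -> period A w.
Proof. by move=> AB; apply: negligibleS => p /= [/AB]. Qed.

Lemma period_comp (A B : set U) w1 w2 : period A w1 -> period B w2 ->
  (forall p, A p -> B (p + w1)) -> period A (w1 + w2).
Proof.
move=> h1 h2 AB; apply: negligibleS (negligibleU h1 (negligible_translate w1 h2)).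
move=> p /= [Ap nP]; apply: contrapT => /not_orP[g1 g2]; apply: nP.
have e1 : P p <-> P (p + w1) by apply: contrapT => h; apply: g1.
have e2 : P (p + w1) <-> P (p + w1 + w2).
  by apply: contrapT => h; apply: g2; split => //; exact: AB.
by rewrite addrA e1.
Qed.

Lemma inv0 (A : set U) : period A 0.
Proof.
rewrite /period (_ : [set _ | _] = set0); first exact: negligible_set0.
by apply/seteqP; split => // p; rewrite /= addr0 => -[_ []].
Qed.

Lemma period_opp (A B : set U) w : period A w -> (forall p, B p -> A (p - w)) -> period B (- w).
Proof.
move=> h BA; apply: negligibleS (negligible_translate (- w) h) => p /= [Bp nP].
split; first exact: BA.
by rewrite subrK => e; apply: nP; rewrite e.
Qed.

Definition dom (a rho : R) : set U := [set p | a < height (p - z) /\ enorm (p - z) < rho].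

Lemma dom_shift a rho h p u : enorm u <= h -> dom (a + h) (rho - h) p -> dom a rho (p + u).
Proof.
move=> uh [pa pr]; rewrite /dom /= addrAC; split.
  rewrite (heightD _ _ u); have := height_le hQ u; rewrite ler_norml => /andP[h1 _]; lra.
by apply: le_lt_trans (enormD _ _) _; lra.
Qed.

Lemma dom_mono a a' rho rho' : a' <= a -> rho <= rho' -> dom a rho `<=` dom a' rho'.
Proof. by move=> ha hr p [h1 h2]; split; [exact: le_lt_trans h1|exact: lt_le_trans hr]. Qed.

(** [unsplit] in absolute coordinates, where [x + x - p] is the reflection of p through x.
    Symmetries with different centres can then be compared at the same point. *)
Definition Nset x : set U := [set p | 0 < height (p - x) /\ enorm (p - x) < 20 * r0 /\
  ~ ((P p /\ M (x + x - p)) \/ (M p /\ P (x + x - p)))].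

Lemma Nset_negligible x : flatpt P M r0 x ->
  mur.-negligible (Nset x : set (borelV R (n + 1))).
Proof.
move=> hx; pose S : set ('rV[R]_n * R) := unsplit Q P M x `&` (upper 0 `&` rball (20 * r0)).
have mS : measurable (S : set (borelV R n * measurableTypeR R)).
  apply: measurableI; first exact: measurable_unsplit.
  by apply: measurableI; [exact: measurable_upper|exact: measurable_rball].
have mF : measurable_fun setT (fun p : borelV R (n + 1) => (prj Q p, height p) : borelV R n * measurableTypeR R).
  have e (p : U) : prj Q p = \row_i \sum_j p 0 j * Q^T j (lshift 1 i).
    by apply/rowP => i; rewrite !mxE.
  apply: measurable_fun_pair.
    apply: measurable_fun_rV => i.
    rewrite (_ : (fun _ => _) = fun p : U => \sum_j p 0 j * Q^T j (lshift 1 i)).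
      by apply: measurable_sum => j; apply: measurable_funM => //; exact: measurable_coord.
    by apply/funext => p; rewrite e mxE.
  have e2 : height = (fun p : U => \sum_j p 0 j * Q^T j (rshift n 0)).
    by apply/funext => p; exact: heightE.
  rewrite e2.
  by apply: measurable_sum => j; apply: measurable_funM => //; exact: measurable_coord.
pose S' : set U := (fun p => (prj Q p, height p)) @^-1` S.
have mS' : borel_set S' by exact: (measurable_preimageT mF mS).
have h : mur.-negligible (S' : set (borelV R (n + 1))).
  exists S'; split => //; rewrite murE.
  rewrite (_ : _ @^-1` _ = S) ?(unsplit_flatpt hQ hn mP mM r00 hx) //.
  by apply/seteqP; split => p; rewrite /S' /preimage /= (prj_psi hQ) (height_psi hQ); case: p.
apply: negligibleS (negligible_translate (- x) h) => p /= [p0 [pr nD]].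
rewrite /S' /preimage /=; split; last first.
  split => //; rewrite /rball /= -(enorm_prj hQ).
  by rewrite ltr_pXn2r ?nnegrE ?enorm_ge0 ?mulr_ge0 // ltW.
rewrite /unsplit /= (prjK hQ) => H; apply: nD.
by move: H; rewrite addrC subrK opprB addrA.
Qed.

Lemma PMF p : P p -> M p -> False.
Proof. by move=> Pp Mp; have : (P `&` M) p by []; rewrite PM. Qed.

(** The reflection of p through z and that of p + 2e through z + e coincide. As P and M are
    disjoint, membership of this common point in M decides membership of both p and p + 2e in P. *)
Lemma period_double e s : flatpt P M r0 (z + e) -> enorm e < s -> s <= r0 ->
  period (dom s (8 * r0)) (2 *: e).
Proof.
move=> hx es sr0.
have /(negligible_translate (2 *: e)) h2 := Nset_negligible hx.
apply: negligibleS (negligibleU (Nset_negligible hz) h2) => p /= [[ps pr] nP].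
apply: contrapT => /not_orP[g1 g2]; apply: nP.
have hp0 : 0 < height (p - z) by rewrite (le_lt_trans _ ps) // (le_trans (enorm_ge0 e)) // ltW.
have E1 : (P p /\ M (z + z - p)) \/ (M p /\ P (z + z - p)).
  apply: contrapT => h; apply: g1; split => //; split => //.
  by apply: lt_le_trans pr _; rewrite ler_wpM2r ?(ltW r00) // ler_nat.
have eq1 : z + e + (z + e) - (p + 2 *: e) = z + z - p.
  by apply/rowP => i; rewrite !mxE; ring.
have eq2 : p + 2 *: e - (z + e) = (p - z) + e.
  by apply/rowP => i; rewrite !mxE; ring.
have E2 : (P (p + 2 *: e) /\ M (z + z - p)) \/ (M (p + 2 *: e) /\ P (z + z - p)).
  apply: contrapT => h; apply: g2; split; rewrite eq2.
    by rewrite heightD; have := height_le hQ e; rewrite ler_norml => /andP[h1 _]; lra.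
  split; last by rewrite eq1.
  apply: le_lt_trans (enormD _ _) _; apply: (@lt_le_trans _ _ (8 * r0 + r0)).
    by apply: ltr_leD => //; rewrite (le_trans (ltW es)).
  by rewrite -subr_ge0 (_ : _ - _ = 11 * r0) ?mulr_ge0 ?(ltW r00) //; ring.
by case: E1 => -[a1 a2]; case: E2 => -[b1 b2]; split => h //; exfalso;
   solve [exact: (PMF a1 b1)|exact: (PMF b1 a1)|exact: (PMF a2 b2)|exact: (PMF b2 a2)|exact: (PMF h a1)|exact: (PMF h b1)].
Qed.

Lemma period_step e s (b : int) : flatpt P M r0 (z + e) -> enorm e < s -> s <= r0 ->
  -1 <= b <= 1 -> period (dom (3 * s) (6 * r0)) (b%:~R *: (2 *: e)).
Proof.
move=> hx es sr0 hb.
have s0 : 0 < s by apply: le_lt_trans es; exact: enorm_ge0.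
have h := period_double hx es sr0.
have : [\/ b = 0, b = 1 | b = -1] by move: hb; case: b => [[|[|k]]|[|k]] //; [constructor 1|constructor 2|constructor 3].
case=> ->.
- by rewrite scale0r; exact: inv0.
- by rewrite scale1r; apply: period_mono h; apply: dom_mono; lra.
rewrite scaleN1r; apply: period_opp h _ => p hp.
apply: (@dom_shift _ _ (2 * s)).
  by rewrite enormN enormZ ger0_norm // ler_wpM2l // ltW.
by apply: dom_mono hp; lra.
Qed.

(** Each step moves by at most 2s, so the domain loses 2s in height and in radius per element of
    l. *)
Lemma period_seq (I : eqType) (e : I -> U) (b : I -> int) s (l : seq I) :
  (forall i, flatpt P M r0 (z + e i) /\ enorm (e i) < s) -> 0 < s -> s <= r0 ->
  (forall i, -1 <= b i <= 1) ->
  period (dom (3 * s + 2 * s * (size l)%:R) (6 * r0 - 2 * s * (size l)%:R))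
    (\sum_(i <- l) (b i)%:~R *: (2 *: e i)).
Proof.
move=> he s0 sr0 hb; elim: l => [|i l IH]; first by rewrite big_nil; exact: inv0.
have [hi ei] := he i.
rewrite big_cons; apply: period_comp IH _.
  apply: period_mono (period_step hi ei sr0 (hb i)).
  have k0 : 0 <= 2 * s * (size (i :: l))%:R by rewrite !mulr_ge0 // ltW.
  by apply: dom_mono; rewrite ?lerDl // gerBl.
move=> p hp; apply: (@dom_shift _ _ (2 * s)).
  rewrite !enormZ -[leRHS]mul1r; apply: ler_pM => //.
  - by rewrite mulr_ge0 ?enorm_ge0.
  - by rewrite -intr_norm -[1 in leRHS]/(1%:~R) ler_int ler_norml.
  - by rewrite ger0_norm // ler_wpM2l // ltW.
move: hp; rewrite /= -[(size l).+1]addn1 natrD => hp.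
by apply: dom_mono hp; rewrite le_eqVlt; apply/orP; left; apply/eqP; ring.
Qed.

Lemma floor_diff (x d : R) : `|d| <= 1 -> -1 <= Num.floor (x + d) - Num.floor x <= 1.
Proof.
rewrite ler_norml => /andP[d1 d2].
have /andP[a1 a2] := floor_itv x; have /andP[b1 b2] := floor_itv (x + d).
have h1 : (Num.floor (x + d))%:~R < (Num.floor x + 1 + 1)%:~R :> R.
  by rewrite intrD; lra.
have h2 : (Num.floor x)%:~R < (Num.floor (x + d) + 1 + 1)%:~R :> R.
  by rewrite intrD; lra.
move: h1 h2; rewrite !ltr_int; lia.
Qed.

Lemma floor_dist (x : R) : `|(Num.floor x)%:~R - x| <= 1.
Proof.
have /andP[a1 a2] := floor_itv x; move: a2; rewrite intrD => a2.
by rewrite ler_norml; apply/andP; split; lra.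
Qed.

Lemma dom_convex a rho p w t : 0 <= t <= 1 -> dom a rho p -> dom a rho (p + w) ->
  dom a rho (p + t *: w).
Proof.
move=> /andP[t0 t1] [h1 h2] [h3 h4].
have -> : p + t *: w = (1 - t) *: p + t *: (p + w).
  by apply/rowP => i; rewrite !mxE; ring.
have e : (1 - t) *: p + t *: (p + w) - z = (1 - t) *: (p - z) + t *: (p + w - z).
  by apply/rowP => i; rewrite !mxE; ring.
have [t_eq0|t_neq0] := eqVneq t 0.
  by rewrite t_eq0 subr0 scale1r scale0r addr0.
have tp : 0 < t by rewrite lt_def t_neq0.
have u0 : 0 <= 1 - t by rewrite subr_ge0.
split; rewrite e.
  rewrite heightD !heightZ.
  have : (1 - t) * a <= (1 - t) * height (p - z) by rewrite ler_wpM2l // ltW.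
  have : t * a < t * height (p + w - z) by rewrite ltr_pM2l.
  lra.
apply: le_lt_trans (enormD _ _) _; rewrite !enormZ !ger0_norm //.
have : (1 - t) * enorm (p - z) <= (1 - t) * rho by rewrite ler_wpM2l // ltW.
have : t * enorm (p + w - z) < t * rho by rewrite ltr_pM2l.
lra.
Qed.

(* Follow the segment from [p] to [p + w] by integer combinations of the periods [2 *: e i],
   obtained by rounding the coefficients down: they stay within O(s k) of the segment, hence
   in the region where the symmetries are known. *)
Lemma period_path k (e : 'I_k -> U) (c : 'I_k -> R) s kap :
  (forall i, flatpt P M r0 (z + e i) /\ enorm (e i) < s) -> 0 < s -> s <= r0 ->
  3 * s + 4 * s * k%:R <= kap -> 4 * s * k%:R <= r0 ->
  exists2 w', enorm (w' - \sum_i c i *: e i) <= 2 * s * k%:R &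
    period [set p | dom kap (5 * r0) p /\ dom kap (5 * r0) (p + \sum_i c i *: e i)] w'.
Proof.
move=> he s0 sr0 hk1 hk2; set w := \sum_i _.
(* Fine enough for each coefficient, counted in units of 2 e_i, to change by at most 1 between
   consecutive points; the rounded coefficients then change by -1, 0 or 1. *)
pose N := (Num.truncn (\sum_i `|c i|)).+1.
have N0 : (0 : R) < N%:R by rewrite ltr0n.
pose d i := c i / (2 * N%:R).
have cN i : `|c i| <= N%:R.
  apply: le_trans (ltW (truncnS_gt _)).
  by rewrite (bigD1 i) //= lerDl sumr_ge0.
have d1 i : `|d i| <= 1.
  rewrite /d normrM normfV [X in _ / X]gtr0_norm ?mulr_gt0 // ler_pdivrMr ?mulr_gt0 //.
  by rewrite mul1r (le_trans (cN i)) // ler_peMl ?(ltW N0) // ler1n.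
pose W (j : nat) := \sum_i (Num.floor (j%:R * d i))%:~R *: (2 *: e i).
have WE j : enorm (W j - (j%:R / N%:R) *: w) <= 2 * s * k%:R.
  rewrite /W /w scaler_sumr -sumrB.
  have -> : \sum_i ((Num.floor (j%:R * d i))%:~R *: (2 *: e i) - (j%:R / N%:R) *: (c i *: e i)) =
      \sum_i ((Num.floor (j%:R * d i))%:~R - j%:R * d i) *: (2 *: e i).
    apply: eq_bigr => i _; rewrite scalerBl; congr (_ - _); rewrite !scalerA; congr (_ *: _).
    by rewrite /d; field; rewrite gt_eqF.
  apply: le_trans (enorm_sum _ _ _) _.
  apply: (@le_trans _ _ (\sum_(i < k) 2 * s)).
    apply: ler_sum => i _; rewrite enormZ -[leRHS]mul1r; apply: ler_pM => //.
    - exact: enorm_ge0.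
    - exact: floor_dist.
    - by rewrite enormZ ger0_norm // ler_wpM2l // ltW //; have [] := he i.
  by rewrite sumr_const card_ord mulr_natr.
exists (W N).
  by have := WE N; rewrite divff ?gt_eqF // scale1r.
suff : forall j, (j <= N)%N ->
    period [set p | dom kap (5 * r0) p /\ dom kap (5 * r0) (p + w)] (W j) by apply.
elim=> [_|j IH jN].
  rewrite (_ : W 0%N = 0) ; first exact: inv0.
  by rewrite /W big1 // => i _; rewrite mul0r floor0 scale0r.
have -> : W j.+1 = W j + \sum_(i <- enum 'I_k)
    (Num.floor (j%:R * d i + d i) - Num.floor (j%:R * d i))%:~R *: (2 *: e i).
  rewrite big_enum /= /W -big_split /=; apply: eq_bigr => i _.
  rewrite -scalerDl; congr (_ *: _); rewrite intrB addrC subrK.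
  by rewrite -natr1 mulrDl mul1r.
have hb i := floor_diff (j%:R * d i) (d1 i).
apply: (period_comp (IH (ltnW jN)) (period_seq (enum 'I_k) he s0 sr0 hb)) => p [hp hpw].
rewrite size_enum_ord.
have -> : p + W j = p + (j%:R / N%:R) *: w + (W j - (j%:R / N%:R) *: w).
  by rewrite -addrA; congr (_ + _); rewrite addrC subrK.
apply: dom_shift (WE j) _.
have : dom kap (5 * r0) (p + (j%:R / N%:R) *: w).
  apply: dom_convex => //; rewrite divr_ge0 //= ler_pdivrMr // mul1r ler_nat.
  exact: ltnW.
by apply: dom_mono; lra.
Qed.

(** The bound on k is uniform in s, so that the error 2 s k of [period_path] tends to 0 with s; the
    coefficients may grow freely. *)
Definition spanned (w : U) := forall s, 0 < s -> exists k, exists e : 'I_k -> U, exists c : 'I_k -> R,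
  [/\ (k <= n.+1)%N, forall i, flatpt P M r0 (z + e i) /\ enorm (e i) < s
    & w = \sum_i c i *: e i].

Lemma measurable_dom a rho : borel_set (dom a rho).
Proof.
have -> : dom a rho = translate (- z) ([set p | a < height p] `&` [set p | enorm p < rho]) by [].
apply: translate_measurable; apply: borel_setI; last first.
  rewrite (_ : [set _ | _] = eball 0 rho); first exact: eball_measurable.
  by apply/seteqP; split => p; rewrite /eball /= subr0.
apply: open_borel_set; rewrite openE => p /= pa; apply/nbhs_eballP.
exists (height p - a); first by rewrite subr_gt0.
move=> q; rewrite /eball /= => qp.
by have := height_le hQ (q - p); rewrite heightB ler_norml => /andP[h1 _]; lra.
Qed.

(** [period_path] gives periods w' arbitrarily close to w. Continuity of translations, for P and for
    its complement, passes to the limit. *)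
Lemma period_spanned w kap : 0 < kap -> spanned w ->
  period [set p | dom kap (5 * r0) p /\ dom kap (5 * r0) (p + w)] w.
Proof.
move=> k0 hw; rewrite /period.
set S := [set p : borelV R (n + 1) | _].
have mA : borel_set (dom kap (5 * r0) `&` translate w (dom kap (5 * r0))).
  by apply: borel_setI; [|apply: translate_measurable]; exact: measurable_dom.
have mS : borel_set S.
  have -> : S = (dom kap (5 * r0) `&` translate w (dom kap (5 * r0))) `&`
      ((P `\` translate w P) `|` (translate w P `\` P)).
    apply/seteqP; split => p /= [Ap nP]; split => //.
      have [Pp|Pp] := pselect (P p); [left|right]; split => //.
        by move=> Pw; apply: nP.
      by apply: contrapT => nw; apply: nP; split => // Pw.
    by case: nP => -[h1 h2] [h3 h4]; [apply: h2; exact: h3|apply: h2; exact: h4].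
  apply: borel_setI => //; apply: measurableU; apply: measurableD => //;
    exact: translate_measurable.
exists S; split => //; apply/eqP; rewrite eq_le measure_ge0 andbT.
apply/lee_addgt0Pr => eps eps0; rewrite add0e.
have e20 : 0 < eps / 2 by rewrite divr_gt0.
have cP := borel_transl_cont (mur_translate hQ) (mur_eball hQ) mP.
have [d1 d10 H1] := cP.2 (5 * r0 + enorm z) _ e20.
have cnP := transl_contC (mur_translate hQ) cP.
have [d2 d20 H2] := cnP.2 (5 * r0 + enorm z) _ e20.
pose K : R := n.+1%:R.
have K1 : 1 <= K by rewrite ler1n.
have K0 : 0 < K by rewrite ltr0n.
pose s0 := Num.min (Num.min d1 d2) (Num.min kap r0).
have s00 : 0 < s0 by rewrite !lt_min d10 d20 k0 r00.
(* With k <= K, the margin 3s + 4sk is at most 7sK < s0, and the error 2sk is below both d1 and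
   d2. *)
pose s := s0 / (8 * K).
have sE : s * (8 * K) = s0 by rewrite /s divfK // gt_eqF // mulr_gt0.
have s_gt0 : 0 < s by rewrite divr_gt0 // mulr_gt0.
have [k [e [c [kn he wE]]]] := hw s s_gt0.
have [hd1 hd2] : s0 <= d1 /\ s0 <= d2.
  by split; rewrite /s0 !ge_min lexx ?orbT.
have [hd3 hd4] : s0 <= kap /\ s0 <= r0.
  by split; rewrite /s0 !ge_min lexx ?orbT.
have kK : k%:R <= K by rewrite ler_nat.
have skK : s * k%:R <= s * K by rewrite ler_wpM2l // ltW.
have ssK : s <= s * K by rewrite ler_peMr // ltW.
have [|||w' ww hinv] := period_path c he s_gt0 (kap := kap).
- lra.
- lra.
- lra.
rewrite -wE in ww hinv.
have wd1 : enorm (w' - w) < d1 by lra.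
have wd2 : enorm (w' - w) < d2 by lra.
have [N [mN N0 SN]] := hinv.
pose G1 := translate w (eball 0 (5 * r0 + enorm z) `&` (P `\` translate (w' - w) P)).
pose G2 := translate w (eball 0 (5 * r0 + enorm z) `&` (~` P `\` translate (w' - w) (~` P))).
have mG1 : borel_set G1 by apply: translate_measurable; exact: measurable_gap.
have mG2 : borel_set G2.
  by apply: translate_measurable; apply: measurable_gap; exact: measurableC.
apply: (@le_trans _ _ (mur (N `|` (G1 `|` G2)))).
  apply: le_measure; rewrite ?inE.
  - exact: mS.
  - by apply: measurableU => //; exact: measurableU.
  move=> p [[hp hpw] nP].
  have [Np|nNp] := pselect (N p); [by left|right].
  have e1 : P p <-> P (p + w').
    by apply: contrapT => h; apply: nNp; apply: SN.
  have pw : eball 0 (5 * r0 + enorm z) (p + w).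
    rewrite /eball /= subr0 -[p + w](subrK z).
    by apply: le_lt_trans (enormD _ _) _; rewrite ltrD2r; have [] := hpw.
  have e3 : p + w + (w' - w) = p + w' by rewrite addrACA subrr addr0.
  have [Pw|Pw] := pselect (P (p + w)); [left|right]; split => //; split => //;
    rewrite /translate /= ?e3 => h.
    by apply: nP; rewrite e1; split.
  by apply: nP; rewrite e1; split => // h'; exfalso; exact: h.
apply: le_trans (measureU2 _ _ _) _ => //; first exact: measurableU.
rewrite [X in (X + _)%E]N0 add0e.
apply: le_trans (measureU2 _ _ _) _ => //.
rewrite (splitr eps) EFinD; apply: leeD.
  by rewrite [leLHS](mur_translate hQ) ?H1 //; exact: measurable_gap.
rewrite [leLHS](mur_translate hQ) ?H2 //; apply: measurable_gap; exact: measurableC.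
Qed.

End periods.

(** * Rigidity above a hyperplane of periods *)

Section null_sections.
Local Open Scope ereal_scope.

Lemma ge0_integral_eq0P d (T : measurableType d) (R : realType)
    (mu : {measure set T -> \bar R}) (D : set T) (f : T -> \bar R) :
  measurable D -> measurable_fun D f -> (forall x, D x -> 0 <= f x) ->
  \int[mu]_(x in D) f x = 0 <-> mu.-negligible [set x | D x /\ f x <> 0].
Proof.
move=> mD mf f0.
have -> : \int[mu]_(x in D) f x = \int[mu]_(x in D) `|f x|.
  by apply: eq_integral => x; rewrite inE => Dx; rewrite gee0_abs // f0.
have -> : [set x | D x /\ f x <> 0] = ~` [set x | D x -> f x = cst 0 x].
  by apply/seteqP; split => x /=; [move=> [Dx fx] h; exact: fx (h Dx)|move/not_implyP].
exact: ae_eq_integral_abs.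
Qed.

Context d1 d2 (T1 : measurableType d1) (T2 : measurableType d2) (R : realType).
Variables (m1 : {sigma_finite_measure set T1 -> \bar R}).
Variables (m2 : {sigma_finite_measure set T2 -> \bar R}).
Variable N : set (T1 * T2).
Hypothesis mN : measurable N.

Lemma sprodE2 : sprod m1 m2 N = \int[m2]_y m1 (ysection N y).
Proof.
rewrite -[LHS]/((m1 \x m2) N) -[RHS]/((m1 \x^ m2) N).
apply: product_measure_unique => // B C mB mC; exact: product_measure2E.
Qed.

Lemma sprod_xnull : m1.-negligible [set x | m2 (xsection N x) <> 0] <-> sprod m1 m2 N = 0.
Proof.
rewrite -[X in X = 0]/(\int[m1]_x m2 (xsection N x)).
have := @ge0_integral_eq0P _ _ _ m1 setT (fun x => m2 (xsection N x)) measurableT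
  (measurable_fun_xsection m2 mN) (fun x _ => measure_ge0 m2 _).
rewrite (_ : [set x | setT x /\ _] = [set x | m2 (xsection N x) <> 0]) => [[h1 h2]|].
  by split.
by apply/seteqP; split => x //= -[].
Qed.

Lemma sprod_ynull : m2.-negligible [set y | m1 (ysection N y) <> 0] <-> sprod m1 m2 N = 0.
Proof.
rewrite sprodE2.
have := @ge0_integral_eq0P _ _ _ m2 setT (fun x => m1 (ysection N x)) measurableT
  (measurable_fun_ysection m1 mN) (fun x _ => measure_ge0 m1 _).
rewrite (_ : [set x | setT x /\ _] = [set x | m1 (ysection N x) <> 0]) => [[h1 h2]|].
  by split.
by apply/seteqP; split => x //= -[].
Qed.

End null_sections.

Lemma negligible_lt d (T : measurableType d) (R : realType)
    (mu : {measure set T -> \bar R}) (A B : set T) :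
  measurable B -> (0 < mu B)%E -> mu.-negligible A -> exists2 x, B x & ~ A x.
Proof.
move=> mB B0 nA; apply: contrapT => H.
have : mu.-negligible B.
  apply: negligibleS nA => x Bx; apply: contrapT => nAx; apply: H; by exists x.
by move/(measure_negligible mB) => E; move: B0; rewrite E ltxx.
Qed.

Lemma enorm_consv (R : realType) (n : nat) (p : R * 'rV[R]_n) :
  enorm (consv p) ^+ 2 = p.1 ^+ 2 + enorm p.2 ^+ 2.
Proof.
have e1 : consv p 0 ord0 = p.1 by rewrite mxE unlift_none.
have e2 i : consv p 0 (lift ord0 i) = p.2 0 i by rewrite mxE liftK.
rewrite !enorm_sqr /dotv big_ord_recl e1 -expr2; congr (_ + _).
by apply: eq_bigr => i _; rewrite e2.
Qed.

Lemma sqrt_add_lipschitz (R : realType) (q s t : R) : 0 <= q ->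
  `|Num.sqrt (s ^+ 2 + q) - Num.sqrt (t ^+ 2 + q)| <= `|s - t|.
Proof.
move=> q0; set a := Num.sqrt _; set b := Num.sqrt _.
have a0 : 0 <= a by exact: sqrtr_ge0.
have b0 : 0 <= b by exact: sqrtr_ge0.
have a2 : a ^+ 2 = s ^+ 2 + q by rewrite sqr_sqrtr // addr_ge0 ?sqr_ge0.
have b2 : b ^+ 2 = t ^+ 2 + q by rewrite sqr_sqrtr // addr_ge0 ?sqr_ge0.
have sa : `|s| <= a.
  by rewrite -(@ler_pXn2r _ 2) ?nnegrE // real_normK ?num_real // a2 lerDl.
have tb : `|t| <= b.
  by rewrite -(@ler_pXn2r _ 2) ?nnegrE // real_normK ?num_real // b2 lerDl.
have [ab|ab] := leP (a + b) 0.
  have -> : a = 0 by lra.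
  have -> : b = 0 by lra.
  by rewrite subrr normr0.
rewrite -(ler_pM2r ab) -{1}(ger0_norm (ltW ab)) -normrM.
rewrite (_ : (a - b) * (a + b) = (s - t) * (s + t)); last first.
  by rewrite -!subr_sqr a2 b2; ring.
by rewrite normrM ler_wpM2l // (le_trans (ler_normD _ _)) // lerD.
Qed.

(* On almost every line parallel to the first axis, the radius is a Lipschitz
   function of the first coordinate. *)
Lemma radial_null (R : realType) (n : nat) (S : set R) (t r1 eta : R) :
  (0 < n)%N -> measurable (S : set (measurableTypeR R)) -> 0 < eta ->
  (leb R n).-negligible ([set y | enorm y ^+ 2 + t ^+ 2 < r1 ^+ 2 /\
    S (Num.sqrt (enorm y ^+ 2 + t ^+ 2))] : set (borelV R n)) ->
  (@lebesgue_measure R).-negligible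
    [set r : measurableTypeR R | t ^+ 2 + eta ^+ 2 <= r ^+ 2 /\ 0 < r < r1 /\ S r].
Proof.
case: n => [//|n] _ mS eta0 [N [mN N0 SN]].
pose F : set (measurableTypeR R * borelV R n) := @consv R n @^-1` N.
have mF : measurable F by exact: (measurable_preimageT (@measurable_consv R n) mN).
have F0 : sprod (@lebesgue_measure R) (leb R n) F = 0%E by rewrite -N0 lebS.
have h := (sprod_ynull (@lebesgue_measure R) (leb R n) mF).2 F0.
have mb : measurable (eball (0 : 'rV[R]_n) eta : set (borelV R n)) by exact: eball_measurable.
have bpos : (0 < leb R n (eball (0 : 'rV[R]_n) eta))%E.
  apply: lt_le_trans (leb_eball_ge _ eta0).
  by rewrite lte_fin exprn_gt0 // mulr_gt0 // divr_gt0.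
(* A generic line, close enough to the first axis to meet every radius r with t^2 + eta^2 <= r^2. *)
have [y /= yeta /contrapT Fy] := negligible_lt mb bpos h.
rewrite /eball /= subr0 in yeta.
set W := [set r | _].
have mW : measurable W.
  rewrite (_ : W = [set r | t ^+ 2 + eta ^+ 2 <= r ^+ 2] `&` (`]0, r1[%classic `&` S)).
    apply: measurableI; last by apply: measurableI => //; exact: measurable_itv.
    rewrite -[X in measurable X]setTI.
    apply: (@measurable_fun_ler _ (measurableTypeR R) R setT
      (cst (t ^+ 2 + eta ^+ 2)) (fun r => r ^+ 2)) => //.
  by apply/seteqP; split => r /=; rewrite in_itv.
exists W; split => //; apply/eqP; rewrite eq_le measure_ge0 andbT.
pose q := enorm y ^+ 2 + t ^+ 2.
have q0 : 0 <= q by rewrite addr_ge0 ?sqr_ge0.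
have := @lebesgue_measure_lipschitz R (fun s => Num.sqrt (s ^+ 2 + q)) (ysection F y) W 1.
rewrite Fy mule0; apply => //; last first.
  by move=> s s' _ _; rewrite mul1r; exact: sqrt_add_lipschitz.
move=> r [rt [/andP[r0 rr1] Sr]].
have yq : q <= r ^+ 2.
  apply: le_trans rt; rewrite /q addrC lerD2l lerXn2r ?nnegrE ?enorm_ge0 ?(ltW eta0) //.
  exact: ltW.
have e : Num.sqrt (r ^+ 2 - q) ^+ 2 = r ^+ 2 - q by rewrite sqr_sqrtr // subr_ge0.
have er : Num.sqrt (r ^+ 2) = r by rewrite sqrtr_sqr gtr0_norm.
exists (Num.sqrt (r ^+ 2 - q)); last by rewrite e subrK.
rewrite /ysection /= inE /F /preimage /=; apply: SN => /=.
rewrite enorm_consv /= e -addrA -/q subrK er; split => //.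
by rewrite ltr_pXn2r ?nnegrE ?(ltW r0) // ltW // (lt_trans r0).
Qed.

Section constancy.
Variables (R : realType) (n : nat) (Q : 'M[R]_(n + 1)).
Hypothesis hQ : Q *m Q^T = 1%:M.
Hypothesis hn : (0 < n)%N.
Variables (P M : set 'rV[R]_(n + 1)).
Hypothesis (mP : borel_set P) (mM : borel_set M) (PM : P `&` M = set0).
Variable r0 : R.
Hypothesis r00 : 0 < r0.
Variable z : 'rV[R]_(n + 1).
Hypothesis hz : flatpt P M r0 z.
Hypothesis hspan : forall w : 'rV[R]_n, spanned P M r0 z (psi Q (w, 0)).

Notation V := (borelV R n).
Notation T := (measurableTypeR R).
Notation psi := (psi Q).
Notation lam := (lam R n).
Notation lebn := (leb R n).

Let R1 := 5 * r0.

Let R10 : 0 < R1. Proof. by rewrite mulr_gt0. Qed.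

Definition PZ : set ('rV[R]_n * R) := [set p | P (z + psi p)].

Lemma measurable_PZ : measurable (PZ : set (V * T)).
Proof. exact: preimage_psiD. Qed.

Definition reg (kap : R) : set ('rV[R]_n * R) := upper kap `&` rball R1.

Lemma measurable_reg kap : measurable (reg kap : set (V * T)).
Proof. by apply: measurableI; [exact: measurable_upper|exact: measurable_rball]. Qed.

Lemma reg_dom kap p : reg kap p -> dom Q z kap R1 (z + psi p).
Proof.
move=> [pk pr]; rewrite /dom /= addrC addKr (height_psi hQ); split => //.
by rewrite -(@ltr_pXn2r _ 2) ?nnegrE ?enorm_ge0 ?(ltW R10) // (enorm_psi hQ).
Qed.

Definition hshift (w : 'rV[R]_n) (p : 'rV[R]_n * R) := (p.1 + w, p.2).

Lemma psi_hshift w p : psi (hshift w p) = psi p + psi (w, 0).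
Proof. by rewrite -psiD /hshift /= addr0. Qed.

Lemma shift_negligible kap w : 0 < kap ->
  lam.-negligible ([set p | reg kap p /\ reg kap (hshift w p) /\
    ~ (PZ p <-> PZ (hshift w p))] : set (V * T)).
Proof.
move=> k0.
have [N [mN N0 SN]] := period_spanned hQ hn mP mM PM r00 hz k0 (hspan w).
exists (psi @^-1` translate z N); split.
- exact: (measurable_preimageT (@measurable_psi R n Q) (translate_measurable z mN)).
- by rewrite -murE (mur_translate hQ).
move=> p /= [p1 [p2 np]]; rewrite /translate /=; apply: SN.
have e : psi p + z + psi (w, 0) = z + psi (hshift w p).
  by rewrite psi_hshift addrA (addrC z).
have d1 : dom Q z kap R1 (psi p + z) by rewrite addrC; exact: reg_dom.
split; first by split=> //=; rewrite e; exact: reg_dom.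
by rewrite e (addrC (psi p)).
Qed.

Definition ngset (g : Prop) (t : R) : set 'rV[R]_n :=
  [set y | rball R1 (y, t) /\ ~ (PZ (y, t) <-> g)].

(* Fubini on the triples (w, y, t) for which the period (w, 0) fails at (y, t). *)
Lemma slice_const kap : 0 < kap -> (@lebesgue_measure R).-negligible
  [set t : T | kap < t /\ ~ exists g : Prop, lebn.-negligible (ngset g t : set V)].
Proof.
move=> k0.
pose N3 : set (V * (V * T)) := [set q | reg kap q.2 /\ reg kap (hshift q.1 q.2) /\ ~ (PZ q.2 <-> PZ (hshift q.1 q.2))].
have mH : measurable_fun setT (fun q : V * (V * T) => hshift q.1 q.2 : V * T).
  apply: measurable_fun_pair.
    apply: measurable_fun_rV => i.
    rewrite (_ : (fun _ => _) = fun q : 'rV[R]_n * ('rV[R]_n * R) => q.2.1 0 i + q.1 0 i).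
      apply: measurable_funD.
        apply: (measurableT_comp (@measurable_coord R n i)).
        exact: (measurableT_comp measurable_fst measurable_snd).
      exact: (measurableT_comp (@measurable_coord R n i) measurable_fst).
    by apply/funext => q; rewrite mxE.
  exact: (measurableT_comp measurable_snd measurable_snd).
have mN3 : measurable N3.
  have m1 := measurable_preimageT (measurable_snd : measurable_fun setT (snd : V * (V * T) -> V * T)) (measurable_reg kap).
  have m2 := measurable_preimageT mH (measurable_reg kap).
  have m3 := measurable_preimageT (measurable_snd : measurable_fun setT (snd : V * (V * T) -> V * T)) measurable_PZ.
  have m4 := measurable_preimageT mH measurable_PZ.
  rewrite (_ : N3 = (snd @^-1` reg kap `&` (fun q => hshift q.1 q.2) @^-1` reg kap) `&`
    ((snd @^-1` PZ `\` (fun q => hshift q.1 q.2) @^-1` PZ) `|`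
     ((fun q => hshift q.1 q.2) @^-1` PZ `\` snd @^-1` PZ))).
    apply: measurableI; first exact: measurableI.
    by apply: measurableU; exact: measurableD.
  apply/seteqP; split => q /=.
    move=> [h1 [h2 h3]]; split => //.
    have [a|a] := pselect (PZ q.2); [left|right]; split => //.
      by move=> b; apply: h3.
    by apply: contrapT => b; apply: h3; split => // c; exfalso.
  move=> [[h1 h2] h3]; split => //; split => // -[a b].
  by case: h3 => -[c d]; apply: d; [exact: a|exact: b].
have N30 : sprod lebn lam N3 = 0%E.
  apply/(sprod_xnull lebn lam mN3).
  rewrite (_ : [set x | _] = set0); first exact: negligible_set0.
  apply/seteqP; split => // w /= []; apply: measure_negligible.
    exact: measurable_xsection.
  apply: negligibleS (shift_negligible w k0) => p.
  by rewrite /xsection /= inE.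
have [B [mB B0 NB]] := (sprod_ynull lebn lam mN3).2 N30.
have := (sprod_ynull lebn (@lebesgue_measure R) mB).2 B0.
apply: negligibleS => t /= [kt nog] Bt0; apply: nog.
have [[ys hys]|hys] := pselect (exists y : 'rV[R]_n, rball R1 (y, t : R)); last first.
  exists True; rewrite (_ : ngset _ _ = set0); first exact: negligible_set0.
  by apply/seteqP; split => // y [yr _]; apply: hys; exists y.
pose b := Num.sqrt (R1 ^+ 2 - t ^+ 2).
have b0 : 0 < b.
  rewrite sqrtr_gt0 subr_gt0; apply: le_lt_trans hys => /=.
  by rewrite lerDr sqr_ge0.
have ballE y : eball 0 b y -> rball R1 (y, t).
  rewrite /eball /rball /= subr0 => yb; rewrite -ltrBrDr.
  rewrite -(@sqr_sqrtr _ (R1 ^+ 2 - t ^+ 2)); last by rewrite ltW // -sqrtr_gt0.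
  by rewrite ltr_pXn2r ?nnegrE ?enorm_ge0 // ltW.
have mb : measurable (eball (0 : 'rV[R]_n) b : set V) by exact: eball_measurable.
have bpos : (0 < lebn (eball (0 : 'rV[R]_n) b))%E.
  apply: lt_le_trans (leb_eball_ge _ b0).
  by rewrite lte_fin exprn_gt0 // mulr_gt0 // divr_gt0.
have nB : lebn.-negligible (ysection B t : set V).
  by exists (ysection B t); split => //; exact: measurable_ysection.
(* Almost every shift preserves the membership of (y0, t), and y0 + w runs over the whole slice, so
   the constant value is the one at y0. *)
have [y0 y0b y0B] := negligible_lt mb bpos nB.
exists (PZ (y0, t)).
have h0 : lebn (ysection N3 (y0, t)) = 0%E.
  by apply: contrapT => h; apply: y0B; rewrite /ysection /= inE; apply: NB.
have mh0 : measurable (ysection N3 (y0, t) : set V) by exact: measurable_ysection.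
exists ((fun y => 1 *: y + (- y0)) @^-1` ysection N3 (y0, t)); split.
- exact: (measurable_preimageT (measurable_affine_rV 1 (- y0)) mh0).
- by rewrite leb_affine //; left.
move=> y [yr ny]; rewrite /preimage /ysection /= inE /N3 /= scale1r.
have -> : hshift (y - y0) (y0, t) = (y, t).
  by rewrite /hshift /= addrC subrK.
split; first by split => //; exact: ballE.
split; first by split.
by move=> h; apply: ny; rewrite h.
Qed.

(** [flip] acts within slices of constant height, on almost all of which P is a.e. constant. *)
Lemma flip_negligible kap : 0 < kap ->
  lam.-negligible ([set p | reg kap p /\ ~ (PZ p <-> PZ (flip p))] : set (V * T)).
Proof.
move=> k0; set S := [set p | _].
have mf := measurable_preimageT (@measurable_flip R n) measurable_PZ.
have mS : measurable (S : set (V * T)).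
  rewrite (_ : S = reg kap `&` ((PZ `\` @flip R n @^-1` PZ) `|` (@flip R n @^-1` PZ `\` PZ))).
    apply: measurableI; first exact: measurable_reg.
    by apply: measurableU; apply: measurableD => //; exact: measurable_PZ.
  apply/seteqP; split => q /=.
    move=> [h1 h3]; split => //.
    have [a|a] := pselect (PZ q); [left|right]; split => //.
      by move=> b; apply: h3.
    by apply: contrapT => b; apply: h3; split => // c; exfalso.
  move=> [h1 h3]; split => // -[a b].
  by case: h3 => -[c d]; apply: d; [exact: a|exact: b].
exists S; split => //; apply/(sprod_ynull lebn (@lebesgue_measure R) mS).
apply: negligibleS (slice_const k0) => t /= h.
have [kt|kt] := ltP kap t; last first.
  case: h; rewrite (_ : ysection _ _ = set0) ?measure0 //.
  apply/seteqP; split => // y; rewrite /ysection /= inE => -[[/= ht _] _].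
  by move: ht; rewrite /upper /= ltNge kt.
split => // -[g ng]; apply: h; apply: measure_negligible; first exact: measurable_ysection.
have ng' : lebn.-negligible ([set y | ngset g t (- y)] : set V).
  have [N [mN N0 sN]] := ng; exists ((fun y => -1 *: y + 0) @^-1` N); split.
  - exact: (measurable_preimageT (measurable_affine_rV (-1) 0) mN).
  - by rewrite leb_affine //; right.
  - by move=> y /= hy; rewrite scaleN1r addr0; exact: sN.
apply: negligibleS (negligibleU ng ng') => y; rewrite /ysection /= inE => -[[_ yr] nP].
apply: contrapT => /not_orP[g1 g2]; apply: nP.
have e1 : PZ (y, t) <-> g by apply: contrapT => h1; apply: g1.
have e2 : PZ (- y, t) <-> g.
  by apply: contrapT => h1; apply: g2; split => //; rewrite /rball /= enormN.
by rewrite /flip /= e1 e2.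
Qed.

Definition rad (p : 'rV[R]_n * R) : R := Num.sqrt (enorm p.1 ^+ 2 + p.2 ^+ 2).

Lemma measurable_rad : measurable_fun setT (rad : V * T -> T).
Proof.
apply: (measurableT_comp (continuous_measurable_fun (@sqrt_continuous R))).
apply: measurable_funD; apply: measurable_funX; last exact: measurable_snd.
exact: measurableT_comp (@measurable_enorm R n) measurable_fst.
Qed.

Lemma rad_hgt y r : enorm y < r -> rad (y, hgt y r) = r.
Proof.
move=> yr; rewrite /rad /= hgt_sqr // sqrtr_sqr ger0_norm //.
by rewrite (le_trans (enorm_ge0 y)) // ltW.
Qed.

(** The radii at which P meets almost every pair {w, flip w}; by invariance under [flip] they turn
    out to be those whose hemisphere is filled by P. *)
Definition fullradii : set R := [set r | shadow (missing Q P z) r = 0%E].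

Lemma measurable_fullradii : measurable (fullradii : set T).
Proof.
have m := measurable_shadow (measurable_missing Q z mP).
exact: (measurable_preimageT m (emeasurable_set1 _)).
Qed.

(** Together with [shadow_negligible], polar coordinates for null sets. This direction comes from
    [lam_le_chart] and hence stays above a positive height. *)
Lemma negligible_rad_null (W : set (V * T)) kap : 0 < kap -> measurable W ->
  W `<=` reg kap ->
  (@lebesgue_measure R).-negligible [set r : T | 0 < r < R1 /\ shadow W r <> 0%E] ->
  lam W = 0%E.
Proof.
move=> k0 mW Wr nW.
have -> : W = W `&` (upper kap `&` rball R1).
  by apply/seteqP; split => [p Wp|p []//]; split => //; exact: Wr.
apply/eqP; rewrite eq_le measure_ge0 andbT.
apply: le_trans (lam_le_chart mW k0 R10) _.
rewrite -integral_shadow // (_ : (\int[_]_(r in _) _ = 0)%E) ?mule0 //.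
apply/ge0_integral_eq0P => //.
by apply: measurable_funTS; exact: measurable_shadow.
Qed.

Lemma shadow_negligible (W : set (V * T)) : measurable W -> lam W = 0%E ->
  (@lebesgue_measure R).-negligible [set r : T | 0 < r < R1 /\ shadow W r <> 0%E].
Proof.
move=> mW W0.
suff : (\int[lebesgue_measure]_(r in `]0%R, R1[) shadow W r = 0)%E.
  move/ge0_integral_eq0P => H; apply: negligibleS (H _ _ _) => //.
  - by apply: measurable_funTS; exact: measurable_shadow.
apply/eqP; rewrite eq_le integral_ge0 ?andbT; last by move=> r _; exact: shadow_ge0.
have := @integral_shadow_small R n W R1 0 R10 mW.
rewrite mulr0 => H; apply: H; rewrite -[leRHS]W0.
apply: le_measure; rewrite ?inE; [|exact: mW|by move=> p []].
exact: measurableI mW (@measurable_rball R n R1).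
Qed.

Definition Wset kap : set ('rV[R]_n * R) :=
  [set p | reg kap p /\ ~ (PZ p <-> fullradii (rad p))].

Lemma measurable_Wset kap : measurable (Wset kap : set (V * T)).
Proof.
have mc := measurable_preimageT measurable_rad measurable_fullradii.
rewrite (_ : Wset kap = reg kap `&` ((PZ `\` rad @^-1` fullradii) `|` (rad @^-1` fullradii `\` PZ))).
  apply: measurableI; first exact: measurable_reg.
  by apply: measurableU; apply: measurableD => //; exact: measurable_PZ.
apply/seteqP; split => q /=.
  move=> [h1 h3]; split => //.
  have [a|a] := pselect (PZ q); [left|right]; split => //.
    by move=> b; apply: h3.
  by apply: contrapT => b; apply: h3; split => // c; exfalso.
move=> [h1 h3]; split => // -[a b].
by case: h3 => -[c d]; apply: d; [exact: a|exact: b].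
Qed.

(* Almost every upper hemisphere about z is a.e. contained in P or a.e. disjoint from P. *)
Lemma Wset_null kap : 0 < kap -> lam (Wset kap) = 0%E.
Proof.
move=> k0; apply: (negligible_rad_null k0 (@measurable_Wset kap)); first by move=> p [].
have [E [mE E0 SE]] := flip_negligible k0.
have nE := shadow_negligible mE E0.
have R01 : R1 <= 20 * r0 by rewrite ler_wpM2r ?(ltW r00) // ler_nat.
have nNP : (@lebesgue_measure R).-negligible [set r : T | (`]0%R, (20 * r0)%R[%classic r) /\
    Order.min (shadow (missing Q P z) r) (shadow (missing Q M z) r) <> 0%E].
  apply/ge0_integral_eq0P => //; last exact: (missing_flatpt hQ hn mP mM r00 hz).
  - by apply: measurable_funTS; apply: measurable_mine; apply: measurable_shadow; exact: measurable_missing.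
  - by move=> r _; rewrite le_min !shadow_ge0.
apply: negligibleS (negligibleU nE nNP) => r /= [/andP[r_gt0 r1] nW].
apply: contrapT => /not_orP[g1 g2]; apply: nW.
have sE : shadow E r = 0%E by apply: contrapT => h; apply: g1; rewrite r_gt0 r1.
have smin : Order.min (shadow (missing Q P z) r) (shadow (missing Q M z) r) = 0%E.
  by apply: contrapT => h; apply: g2; split => //; rewrite in_itv /= r_gt0 (lt_le_trans r1).
have key (A : set (V * T)) : measurable A -> shadow A r = 0%E ->
    (forall y, enorm y < r -> Wset kap (y, hgt y r) -> E (y, hgt y r) \/ A (y, hgt y r)) ->
    shadow (Wset kap) r = 0%E.
  move=> mA A0 H; apply: measure_negligible.
    exact: measurable_ysection (measurable_chart (@measurable_Wset kap)).
  have n1 : lebn.-negligible (ysection (chart E) r : set V).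
    by exists (ysection (chart E) r); split => //; exact: measurable_ysection (measurable_chart mE).
  have n2 : lebn.-negligible (ysection (chart A) r : set V).
    by exists (ysection (chart A) r); split => //; exact: measurable_ysection (measurable_chart mA).
  apply: negligibleS (negligibleU n1 n2) => y; rewrite /ysection /= !inE => -[yr Wy].
  by have [h|h] := H y yr Wy; [left|right]; split.
(* Almost every pair {w, flip w} lies in P or misses P. In the first case P meets almost every pair,
   so contains it. Otherwise the minimum forces M to meet almost every pair, and P, disjoint from M,
   misses it. *)
have [cr|cr] := pselect (fullradii r).
  apply: (key (missing Q P z)) => //; first exact: measurable_missing.
  move=> y yr [yreg nP]; rewrite rad_hgt // in nP.
  have nPZ : ~ PZ (y, hgt y r) by move=> h; apply: nP.
  have [h|h] := pselect (PZ (flip (y, hgt y r))); [left; apply: SE|by right].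
  by split => // -[_ h2]; apply: nPZ; exact: h2.
apply: (key (missing Q M z)) => //; first exact: measurable_missing.
  by move: smin; rewrite minEle; case: ifP => // _ h; case: cr.
move=> y yr [yreg nP]; rewrite rad_hgt // in nP.
have yPZ : PZ (y, hgt y r) by apply: contrapT => h; apply: nP; split.
have [h|h] := pselect (PZ (flip (y, hgt y r))); [right|left; apply: SE].
  by split => hM; [exact: (PMF PM yPZ hM)|exact: (PMF PM h hM)].
by split => // -[h2 _]; apply: h; exact: h2.
Qed.

(** Membership in P depends on the height alone and also on the radius alone. A slice at a height t
    < a meets the hemispheres of all radii between a and R1, so its constant value is taken on all
    of them. *)
Lemma main_const kap a : 0 < kap -> kap < a -> a < R1 ->
  exists g : Prop, lam.-negligible
    ([set p | reg kap p /\ a < rad p /\ ~ (PZ p <-> g)] : set (V * T)).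
Proof.
move=> k0 ka aR.
have W0 := Wset_null k0.
have mWk := measurable_Wset kap.
have hW := (sprod_ynull lebn (@lebesgue_measure R) mWk).2 W0.
have mI : measurable (`]kap, a[%classic : set T) by exact: measurable_itv.
have Ipos : (0 < (@lebesgue_measure R) (`]kap, a[%classic : set T))%E.
  by rewrite lebesgue_measure_itv /= lte_fin ka -EFinD lte_fin subr_gt0.
(* At this generic height P is a.e. constant and a.e. determined by the radius, so the value g also
   decides [fullradii] along the slice. *)
have [t /= tI /not_orP[t1 t2]] := negligible_lt mI Ipos (negligibleU (slice_const k0) hW).
move: tI; rewrite in_itv /= => /andP[kt ta].
have {t1}[g hg] : exists g : Prop, lebn.-negligible (ngset g t : set V).
  by apply: contrapT => h; apply: t1.
have {}t2 : lebn (ysection (Wset kap) t) = 0%E by apply: contrapT.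
exists g.
pose S : set R := [set r | ~ (fullradii r <-> g)].
have mS : measurable (S : set T).
  have [hg'|hg'] := pselect g.
    rewrite (_ : S = ~` fullradii); first by apply: measurableC; exact: measurable_fullradii.
    by apply/seteqP; split => r /= hr h; apply: hr; rewrite ?h.
  rewrite (_ : S = fullradii); first exact: measurable_fullradii.
  apply/seteqP; split => r /= hr; first by apply: contrapT => h; apply: hr; split.
  by case=> h _; apply: hg'; exact: h.
have nE : lebn.-negligible ([set y | enorm y ^+ 2 + t ^+ 2 < R1 ^+ 2 /\
    S (Num.sqrt (enorm y ^+ 2 + t ^+ 2))] : set V).
  have n2 : lebn.-negligible (ysection (Wset kap) t : set V).
    by exists (ysection (Wset kap) t); split => //; exact: measurable_ysection.
  apply: negligibleS (negligibleU hg n2) => y /= [yr Sy].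
  apply: contrapT => /not_orP[g1 g2]; apply: Sy.
  have e1 : PZ (y, t) <-> g by apply: contrapT => h; apply: g1.
  rewrite -e1; have : PZ (y, t) <-> fullradii (rad (y, t)).
    by apply: contrapT => h; apply: g2; rewrite /ysection /= inE.
  by move=> ->.
(* As t^2 + (a - t)^2 <= a^2, [radial_null] then reaches every radius between a and R1. *)
pose eta := a - t.
have eta0 : 0 < eta by rewrite subr_gt0.
have nT : (@lebesgue_measure R).-negligible
    [set r : T | t ^+ 2 + eta ^+ 2 <= r ^+ 2 /\ 0 < r < R1 /\ S r].
  exact: (radial_null hn mS eta0 nE).
have nW : lam.-negligible (Wset kap : set (V * T)) by exists (Wset kap); split.
pose W2 : set (V * T) := [set p | reg kap p /\ a < rad p /\ S (rad p)].
have mW2 : measurable W2.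
  apply: measurableI; first exact: measurable_reg.
  apply: measurableI; last exact: (measurable_preimageT measurable_rad mS).
  have := measurable_preimageT measurable_rad (measurable_itv `]a, +oo[ : measurable (_ : set T)).
  by rewrite (_ : _ @^-1` _ = [set p | a < rad p]) //; apply/seteqP; split => p /=; rewrite in_itv /= andbT.
have nW2 : lam.-negligible W2.
  exists W2; split => //; apply: (negligible_rad_null k0 mW2); first by move=> p [].
  apply: negligibleS nT => r /= [/andP[r_gt0 rR] hs]; apply: contrapT => h; apply: hs.
  rewrite /shadow (_ : ysection _ _ = set0) ?measure0 //.
  apply/seteqP; split => // y; rewrite /ysection /= inE => -[/= yr].
  rewrite /W2 /= rad_hgt // => -[_ [ar Sr]]; apply: h; split.
    have t_gt0 : 0 < t by exact: lt_trans kt.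
    have : t ^+ 2 + eta ^+ 2 <= a ^+ 2.
      by rewrite (_ : a = t + eta) /eta; [have := mulr_gt0 t_gt0 eta0; rewrite /eta; nra|ring].
    by move/le_trans; apply; rewrite lerXn2r ?nnegrE ?(ltW r_gt0) ?(ltW ar) // ltW // (lt_trans k0).
  by rewrite r_gt0 rR.
apply: negligibleS (negligibleU nW nW2) => p /= [pr [pa np]].
apply: contrapT => /not_orP[g1 g2]; apply: np.
have e1 : PZ p <-> fullradii (rad p) by apply: contrapT => h; apply: g1.
by rewrite e1; apply: contrapT => h; apply: g2.
Qed.

(** * Failure of the central symmetry off the hyperplane *)

Lemma negligible_affine b (a : 'rV[R]_n) c (A : set (V * T)) : b = 1 \/ b = -1 ->
  lam.-negligible A -> lam.-negligible ([set p | A (b *: p.1 + a, b * p.2 + c)] : set (V * T)).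
Proof.
move=> hb [N [mN N0 AN]].
exists ((fun p => (b *: p.1 + a, b * p.2 + c)) @^-1` N); split.
- apply: (measurable_preimageT _ mN); apply: measurable_fun_pair.
    exact: measurableT_comp (measurable_affine_rV b a) measurable_fst.
  exact: measurableT_comp (measurable_scale_add b c) measurable_snd.
- by rewrite lam_affine.
- by move=> p; exact: AN.
Qed.

(** With d the height of x above the plane, the ball of radius d/2 about x stays above height d/2
    and within 3 r0 of z. There [main_const] makes P a.e. constant, so no antipodal pair is split
    between P and M. *)
Lemma unsplit_full x : 0 < height Q (x - z) -> enorm (x - z) <= 2 * r0 ->
  lam (~` unsplit Q P M x `&` rball (height Q (x - z) / 2)) = 0%E.
Proof.
move=> d0 xz; set d := height Q (x - z) in d0 *.
have dr : d <= 2 * r0 by apply: le_trans xz; apply: le_trans (height_le hQ _); exact: ler_norm.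
have [|||g hg] := @main_const (d / 8) (d / 4); [lra|lra|rewrite /R1; lra|].
set N0 := [set p | _] in hg.
have n1 := negligible_affine (prj Q (x - z)) d (or_introl erefl) hg.
have n2 := negligible_affine (prj Q (x - z)) d (or_intror erefl) hg.
apply: measure_negligible.
  apply: measurableI; last exact: measurable_rball.
  by apply: measurableC; exact: measurable_unsplit.
have key b p : b = 1 \/ b = -1 -> rball (d / 2) p ->
    ~ N0 (b *: p.1 + prj Q (x - z), b * p.2 + d) -> P (x + b *: psi p) <-> g.
  move=> hb pr np; set p' := (_, _) in np.
  have e : psi p' = b *: psi p + (x - z).
    by rewrite /p' -[x - z in RHS](prjK hQ) -psiZ -psiD.
  have e1 : z + psi p' = x + b *: psi p.
    by rewrite e addrCA (addrC z) subrK addrC.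
  have b2 : b ^+ 2 = 1 by case: hb => ->; rewrite ?sqrrN expr1n.
  have ep : enorm (psi p) < d / 2.
    rewrite -(@ltr_pXn2r _ 2) ?nnegrE ?enorm_ge0 //; last by lra.
    by rewrite (enorm_psi hQ).
  have ebp : enorm (b *: psi p) < d / 2.
    rewrite enormZ (_ : `|b| = 1) ?mul1r //.
    by case: hb => ->; rewrite ?normrN normr1.
  have ht : d / 2 < p'.2.
    have := height_le hQ (b *: psi p); rewrite heightZ (height_psi hQ) /p' /= ler_norml => /andP[h1 _].
    by lra.
  rewrite -e1; apply: contrapT => h; apply: np; split; last split => //.
  - split; first by apply: lt_trans ht; lra.
    change (enorm p'.1 ^+ 2 + p'.2 ^+ 2 < R1 ^+ 2).
    rewrite -(enorm_psi hQ) ltr_pXn2r ?nnegrE ?enorm_ge0 ?(ltW R10) //.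
    rewrite e; apply: le_lt_trans (enormD _ _) _; rewrite /R1; lra.
  - apply: lt_le_trans (_ : `|p'.2| <= _); first by apply: lt_le_trans (ler_norm _); lra.
    by rewrite -sqrtr_sqr /rad ler_wsqrtr // lerDr sqr_ge0.
apply: negligibleS (negligibleU n1 n2) => p [/= /contrapT nD pr].
apply: contrapT => /not_orP[g1 g2].
have e1 := key 1 p (or_introl erefl) pr g1.
have e2 := key (-1) p (or_intror erefl) pr g2.
rewrite scale1r in e1; rewrite scaleN1r in e2.
case: nD => -[h1 h2].
  by apply: (PMF PM (p := x - psi p)) => //; apply/e2/e1.
by apply: (PMF PM (p := x + psi p)) => //; apply/e1/e2.
Qed.

(** If c is the lower bound of [epsilon_coef_ge], the radii between d/4 and d/2 contribute at least
    c^2 (2/d)(d/4) = c^2/2, whatever the distance d to the plane. *)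
Definition threshold : R := ((2 / n.+1%:R) ^+ n / covK R n) ^+ 2 / 2.

Lemma epsilon_coef_ge x r : 0 < height Q (x - z) -> 0 < r < height Q (x - z) / 2 ->
  shadow (~` unsplit Q P M x `&` rball (height Q (x - z) / 2)) r = 0%E ->
  (((2 / n.+1%:R) ^+ n / covK R n)%:E <= epsilon_coef P M x r)%E.
Proof.
move=> d0 /andP[r_gt0 rd] s0; set W := _ `&` _ in s0.
have mD := measurable_unsplit Q mP mM x.
have mW : measurable (W : set (V * T)).
  by apply: measurableI; [exact: measurableC|exact: measurable_rball].
have c0 := covK_gt0 R n.
have rn0 : 0 < r ^+ n by rewrite exprn_gt0.
have h1 : (shadow (unsplit Q P M x) r <= (covK R n * r ^+ n)%:E * epsilon_coef P M x r)%E.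
  by apply: le_epsilon_coef => // H oH bH; exact: shadow_unsplit_le.
have h2 : (((2 * (r / n.+1%:R)) ^+ n)%:E <= shadow (unsplit Q P M x) r)%E.
  apply: le_trans (leb_eball_ge (0 : 'rV[R]_n) r_gt0) _.
  rewrite -[leRHS]adde0 -s0.
  have m1 := measurable_ysection r (measurable_chart mD).
  have m2 := measurable_ysection r (measurable_chart mW).
  apply: le_trans (measureU2 _ m1 m2).
  apply: le_measure; rewrite ?inE; [exact: eball_measurable|exact: measurableU m1 m2|].
  move=> y; rewrite /eball /= subr0 /ysection /= !inE => yr.
  have [h|h] := pselect (unsplit Q P M x (y, hgt y r)); [by left|right].
  split => //; split => //; rewrite /rball /= hgt_sqr // ltr_pXn2r ?nnegrE ?(ltW r_gt0) //.
  by rewrite (le_trans (ltW r_gt0)) // ltW.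
have cr : 0 < covK R n * r ^+ n by rewrite mulr_gt0.
have := le_trans h2 h1.
rewrite -(lee_pdivrMl _ _ cr); apply: le_trans.
rewrite -EFinM lee_fin le_eqVlt; apply/orP; left; apply/eqP.
have -> : 2 * (r / n.+1%:R) = r * (2 / n.+1%:R) by rewrite mulrCA.
rewrite (exprMn _ r).
have key (K a b : R) : 0 < a -> b / K = (K * a)^-1 * (a * b).
  by move=> a0; rewrite invfM -mulrA mulKf ?gt_eqF // mulrC.
exact: key.
Qed.

Lemma sqint_ge_threshold x : 0 < height Q (x - z) -> enorm (x - z) <= 2 * r0 ->
  (threshold%:E <= sqint P M r0 x)%E.
Proof.
move=> d0 xz; have F := unsplit_full d0 xz; have E := epsilon_coef_ge d0.
set d := height Q (x - z) in d0 F E *; set W := _ `&` _ in F E.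
have dr : d <= 2 * r0 by apply: le_trans xz; apply: le_trans (height_le hQ _); exact: ler_norm.
have mW : measurable (W : set (V * T)).
  apply: measurableI; last exact: measurable_rball.
  by apply: measurableC; exact: measurable_unsplit.
have [N [mN N0 SN]] := shadow_negligible mW F.
pose I : set T := `]d / 4, d / 2[%classic.
have mI : measurable I by exact: measurable_itv.
(* Removing the null set N of radii with non-null shadow leaves the length d/4, and c^2 2/d times
   the indicator of G is a measurable minorant of the integrand. *)
pose G := I `\` N.
have mG : measurable G by exact: measurableD.
pose c := (2 / n.+1%:R) ^+ n / covK R n.
have c0 : 0 < c by rewrite divr_gt0 ?covK_gt0 // exprn_gt0 // divr_gt0.
pose k := c ^+ 2 * (2 / d).
have k0 : 0 <= k by rewrite mulr_ge0 ?sqr_ge0 // divr_ge0 // ltW.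
apply: (@le_trans _ _ (\int[lebesgue_measure]_(r in `]0%R, (20 * r0)%R[) (k%:E * (\1_G r)%:E))%E).
  rewrite ge0_integralZl //; last first.
    by apply/measurable_EFinP; exact: measurable_indic.
  rewrite integral_indic // (_ : G `&` _ = G); last first.
    apply/seteqP; split => r //=; first by case.
    move=> rG; split => //; case: rG => /= + _; rewrite !in_itv /= => /andP[h1 h2].
    by apply/andP; split; [apply: lt_trans h1; lra|apply: lt_trans h2 _; lra].
  have hG : ((d / 4)%:E <= (@lebesgue_measure R) G)%E.
    have mIN : measurable (I `&` N) by exact: measurableI.
    have : ((@lebesgue_measure R) I <= (@lebesgue_measure R) (G `|` N))%E.
      apply: le_measure; rewrite ?inE; [exact: mI|exact: measurableU|].
      by move=> r Ir; have [h|h] := pselect (N r); [right|left; split].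
    have hU := measureU2 (@lebesgue_measure R) mG mN.
    rewrite [X in (_ <= _ + X)%E]N0 adde0 in hU.
    move/le_trans => /(_ _ hU); apply: le_trans; rewrite lebesgue_measure_itv /= lte_fin ifT; last by lra.
    by rewrite -EFinD lee_fin; lra.
  apply: le_trans (lee_mul2l k0 hG); rewrite -EFinM lee_fin /threshold -/c /k.
  by rewrite le_eqVlt; apply/orP; left; apply/eqP; field; rewrite gt_eqF.
apply: le_integral_ge0 => r; first by rewrite mule_ge0 ?lee_fin.
rewrite /= in_itv /= => /andP[r_gt0 _].
have e0 := @epsilon_coef_ge0 R n P M x r r_gt0.
have [rG|rG] := boolP (r \in G); last first.
  rewrite indicE (negbTE rG) mule0; apply: mule_ge0; first exact: mule_ge0.
  by rewrite lee_fin invr_ge0 ltW.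
rewrite indicE rG mule1; move: rG; rewrite inE => -[]; rewrite /I /= in_itv /= => /andP[r1 r2] nN.
have sr : shadow W r = 0%E.
  by apply: contrapT => h; apply: nN; apply: SN; split => //; apply/andP; split => //; rewrite /R1; lra.
have {}E := E r _ sr.
rewrite /k EFinM; apply: lee_pmul; rewrite ?lee_fin ?sqr_ge0 ?divr_ge0 ?(ltW d0) //.
  rewrite expr2 EFinM; apply: lee_pmul; rewrite ?lee_fin ?(ltW c0) //.
    by apply: E; rewrite r_gt0.
  by apply: E; rewrite r_gt0.
by rewrite -[2 / d]invf_div lef_pV2 ?posrE ?divr_gt0 // ltW.
Qed.

End constancy.

(** * Frames and hyperplanes *)

Section frames.
Variables (R : realType) (m : nat).
Implicit Types (G : set 'rV[R]_m) (v : 'rV[R]_m).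

Definition frame k G := exists A : 'M[R]_(k, m), row_free A /\ forall i, G (row i A).

Lemma frame_step k (A : 'M[R]_(k, m)) G : row_free A -> (forall i, G (row i A)) ->
  ~ frame k.+1 G -> forall v, G v -> (v <= A)%MS.
Proof.
move=> fA GA nf v Gv; apply: contrapT => /negP nv; apply: nf.
exists (col_mx v A : 'M[R]_(1 + k, m)); split.
  rewrite /row_free eqn_leq rank_leq_row /=.
  have : (A < v + A)%MS.
    rewrite ltmxE addsmxSr /=; apply: contra nv => h; exact: submx_trans (addsmxSl _ _) h.
  move/rank_ltmx; rewrite (eqP fA).
  by rewrite addsmxE.
suff h (i : 'I_(1 + k)) : G (row i (col_mx v A)) by exact: h.
case: (split_ordP i) => j ->; last by rewrite rowKd.
by rewrite rowKu ord1 row_id.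
Qed.

Lemma frame_or k G : frame k G \/
  exists r, (r < k)%N /\ exists A : 'M[R]_(r, m), forall v, G v -> (v <= A)%MS.
Proof.
elim: k => [|k [[A [fA GA]]|[r [rk hA]]]].
- by left; exists 0; split; [rewrite /row_free mxrank0|case].
- have [h|h] := pselect (frame k.+1 G); [by left|right].
  by exists k; split => //; exists A => v; exact: frame_step h v.
- by right; exists r; split => //; exact: ltnW.
Qed.

End frames.

(** The subspace B must not depend on the scale. Either full frames exist at every scale, or from
    some scale on all directions lie in one subspace of dimension n, which every smaller frame also
    spans. *)
Lemma frame_hyperplane (R : realType) (n : nat) (G : R -> set 'rV[R]_(n + 1)) :
  (forall s s', s <= s' -> G s `<=` G s') -> (forall s, 0 < s -> frame n (G s)) ->
  exists B : 'M[R]_(n, n + 1), row_free B /\ forall s, 0 < s ->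
    exists k (A : 'M[R]_(k, n + 1)),
      [/\ (k <= n.+1)%N, forall i, G s (row i A) & (B <= A)%MS].
Proof.
move=> Gm fG; have [h|h] := pselect (forall s, 0 < s -> frame n.+1 (G s)).
  have [B [fB _]] := fG 1 ltr01; exists B; split => // s s0.
  have [A [fA GA]] := h s s0; exists n.+1, A; split => //.
  by apply: submx_full; rewrite /row_full (eqP fA) addn1.
have [s0 [s00 nf]] : exists s0, 0 < s0 /\ ~ frame n.+1 (G s0).
  apply: contrapT => h'; apply: h => s s0; apply: contrapT => nf; apply: h'; by exists s.
have [B [fB GB]] := fG s0 s00; exists B; split => // s sp.
have mp : 0 < Num.min s s0 by rewrite lt_min sp.
have [A [fA GA]] := fG _ mp; exists n, A; split => //.
  by move=> i; apply: Gm (GA i); rewrite ge_min lexx.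
have AB : (A <= B)%MS.
  apply/row_subP => i; apply: (frame_step fB GB nf).
  by apply: Gm (GA i); rewrite ge_min lexx orbT.
by rewrite -(mxrank_leqif_sup AB) (eqP fA) (eqP fB).
Qed.

Lemma one_sub_scale_sqr (R : realType) (m : nat) (X : 'M[R]_m) (a d : R) :
  X *m X = d *: X -> a * (2 - a * d) = 0 -> (1%:M - a *: X) *m (1%:M - a *: X) = 1%:M.
Proof.
move=> XX ad; rewrite mulmxBl mul1mx mulmxBr mulmx1 -scalemxAl -scalemxAr XX !scalerA.
rewrite opprB addrA -addrA -[RHS]addr0 -addrA; congr (_ + _).
rewrite -!scaleNr -!scalerDl (_ : _ + _ = - (a * (2 - a * d))).
  by rewrite ad oppr0 scale0r.
by ring.
Qed.

(* The Householder reflection exchanging [v] and [enorm v] times the last basis vector. *)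
Lemma orthogonal_last_row (R : realType) (n : nat) (v : 'rV[R]_(n + 1)) :
  exists Q : 'M[R]_(n + 1), Q *m Q^T = 1%:M /\ forall w : 'rV[R]_n, dotv v (psi Q (w, 0)) = 0.
Proof.
pose e : 'rV[R]_(n + 1) := row_mx 0 1%:M.
(* If v is already [enorm v] times e, then d = 0, the convention 2/0 = 0 gives a = 0, and H is the
   identity. *)
pose u := v - enorm v *: e; pose d := dotv u u; pose a := 2 / d.
pose H := 1%:M - a *: (u^T *m u).
have uu : u *m u^T = d%:M by rewrite [LHS]mx11_scalar /d dotvE.
have HT : H^T = H by rewrite /H linearB /= trmx1 linearZ /= trmx_mul trmxK.
have ad : a * (2 - a * d) = 0.
  have [d0|d0] := eqVneq d 0; first by rewrite /a d0 invr0 mulr0 mul0r.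
  by rewrite /a divfK // subrr mulr0.
exists H; split.
  rewrite HT; apply: one_sub_scale_sqr ad.
  by rewrite -mulmxA (mulmxA u) uu mul_scalar_mx -scalemxAr.
move=> w.
have e1 : dotv e e = 1.
  by rewrite /e dotv_row_mx dotv0l add0r mulr1.
have vH : v *m H = enorm v *: e.
  have vu : v *m u^T = (dotv v u)%:M by rewrite [LHS]mx11_scalar dotvE.
  rewrite /H mulmxBr mulmx1 -scalemxAr mulmxA vu mul_scalar_mx scalerA.
  have h : dotv v u * 2 = d.
    rewrite /d /u !(dotvDl, dotvDr, dotvNl, dotvNr, dotvZl, dotvZr) e1 (dotvC e v).
    by rewrite -enorm_sqr; ring.
  have [d0|d0] := eqVneq d 0.
    have u0 : u = 0 by apply/eqP; rewrite -dotv_eq0 -/d d0.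
    by rewrite u0 scaler0 subr0; apply/eqP; rewrite -subr_eq0 -/u u0.
  have -> : a * dotv v u = 1 by rewrite /a mulrAC (mulrC 2) h divff.
  by rewrite scale1r subKr.
rewrite dotvE /psi trmx_mul HT mulmxA vH -scalemxAl mxE -dotvE.
by rewrite /e dotv_row_mx dotv0l add0r !mulr0.
Qed.

(** * Coverings *)

(** If K failed [Pr], the sets containing K minus some set with [Pr] would form a proper filter, and
    a cluster point of it in K would contradict the local hypothesis. *)
Lemma compact_ind (T : topologicalType) (K : set T) (Pr : set T -> Prop) :
  compact K -> Pr set0 -> (forall A B, A `<=` B -> Pr B -> Pr A) ->
  (forall A B, Pr A -> Pr B -> Pr (A `|` B)) ->
  (forall x, K x -> exists2 A, nbhs x A & Pr A) -> Pr K.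
Proof.
move=> cK Pr0 Prm PrU Prl; apply: contrapT => nPr.
pose F : set_system T := [set A | exists2 S, Pr S & K `\` S `<=` A].
have FF : ProperFilter F.
  split; last split.
  - move=> [S PS KS]; apply: nPr; apply: Prm PS => x Kx.
    by apply: contrapT => nS; exact: (KS x).
  - by exists set0.
  - move=> A B [S PS KS] [S' PS' KS']; exists (S `|` S'); first exact: PrU.
    by move=> x [Kx /not_orP[h1 h2]]; split; [exact: KS|exact: KS'].
  - by move=> A B AB [S PS KS]; exists S => //; exact: subset_trans AB.
have FK : F K by exists set0 => // x [].
have [p [Kp clp]] := cK F FF FK.
have [A nA PA] := Prl p Kp.
have : F (~` A) by exists A => // x [].
by move=> /clp /(_ nA) [y [nAy Ay]].
Qed.

Section covering.
Variables (R : realType) (n : nat).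
Notation U := 'rV[R]_(n + 1).

Definition cover_by (l : seq (U * R)) : set U :=
  [set x | exists2 b, b \in l & eball b.1 b.2 x].

(** Zero n-dimensional content. The covers are finite, so their unions are open with compact
    complement in a closed ball, and [measure_cover_by] bounds their mass. *)
Definition coverable (S : set U) := forall e : R, 0 < e -> exists l : seq (U * R),
  [/\ S `<=` cover_by l, forall b, b \in l -> 0 < b.2 & \sum_(b <- l) b.2 ^+ n <= e].

Lemma coverable_mono A B : A `<=` B -> coverable B -> coverable A.
Proof.
by move=> AB h e e0; have [l [l1 l2 l3]] := h e e0; exists l; split => //; exact: subset_trans l1.
Qed.

Lemma coverable0 : coverable set0.
Proof. by move=> e e0; exists [::]; split => //; rewrite big_nil ltW. Qed.

Lemma coverableU A B : coverable A -> coverable B -> coverable (A `|` B).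
Proof.
move=> hA hB e e0; have e20 : 0 < e / 2 by rewrite divr_gt0.
have [l [l1 l2 l3]] := hA _ e20; have [k [k1 k2 k3]] := hB _ e20.
exists (l ++ k); split.
- move=> x [/l1|/k1] [b bl bx]; exists b => //; rewrite mem_cat bl ?orbT //.
- by move=> b; rewrite mem_cat => /orP[/l2|/k2].
- by rewrite big_cat /= (splitr e) lerD.
Qed.

Lemma row_mul_le r m (c : 'rV[R]_r) (A : 'M[R]_(r, m)) (q : R) :
  (forall i, `|c 0 i| <= q) -> enorm (c *m A) <= q * \sum_i enorm (row i A).
Proof.
move=> cq; rewrite mulmx_sum_row mulr_sumr; apply: le_trans (enorm_sum _ _ _) _.
by apply: ler_sum => i _; rewrite enormZ ler_wpM2r ?enorm_ge0.
Qed.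

(* Cut the cube of side 2L into [N^r] small ones: their images lie in balls of radius
   about 1/N, and [N^r] times [N^-n] tends to 0. *)
Lemma coverable_image r (A : 'M[R]_(r, n + 1)) z (L : R) : (r < n)%N -> 0 < L ->
  coverable [set z + c *m A | c in [set c : 'rV[R]_r | forall i, `|c 0 i| < L]].
Proof.
move=> rn L0 e e0.
pose C := \sum_i enorm (row i A) + 1.
have C0 : 0 < C by rewrite ltr_wpDl // sumr_ge0 // => i _; exact: enorm_ge0.
pose N := (Num.truncn ((2 * L * C) ^+ n / e)).+1.
have N0 : (0 : R) < N%:R by rewrite ltr0n.
pose rho := 2 * L * C / N%:R.
have rho0 : 0 < rho by rewrite divr_gt0 // !mulr_gt0.
pose cen (f : {ffun 'I_r -> 'I_N}) : 'rV[R]_r := \row_i (2 * L * (f i)%:R / N%:R - L).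
exists [seq (z + cen f *m A, rho) | f <- enum {ffun 'I_r -> 'I_N}]; split.
- move=> _ [c cL <-].
  pose f : {ffun 'I_r -> 'I_N} :=
    [ffun i => inord (Num.truncn ((c 0 i + L) * N%:R / (2 * L)))].
  exists (z + cen f *m A, rho); first by apply: map_f; rewrite mem_enum.
  rewrite /eball /= opprD addrACA subrr add0r -mulmxBl.
  apply: le_lt_trans (@row_mul_le _ _ _ _ (2 * L / N%:R) _) _; last first.
    rewrite [ltRHS](_ : _ = 2 * L / N%:R * C); last by rewrite /rho mulrAC.
    rewrite ltr_pM2l ?divr_gt0 ?mulr_gt0 // /C.
    by rewrite ltrDl.
  move=> i; rewrite !mxE ffunE.
  have := cL i; rewrite ltr_norml => /andP[c1 c2].
  set q := (c 0 i + L) * N%:R / (2 * L).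
  have q0 : 0 <= q.
    by rewrite divr_ge0 ?mulr_ge0 ?(ltW L0) ?(ltW N0) //; lra.
  have qN : q < N%:R.
    rewrite ltr_pdivrMr ?mulr_gt0 // mulrC ltr_pM2l //; lra.
  have /andP[t1 t2] := truncn_itv q0.
  rewrite inordK; last by rewrite -(ltr_nat R); exact: le_lt_trans qN.
  have ce : c 0 i = 2 * L * q / N%:R - L.
    by rewrite /q; field; rewrite !gt_eqF.
  rewrite {1}ce opprB addrA subrK -mulrBl -mulrBr normrM normfV (gtr0_norm N0).
  rewrite ler_pM2r ?invr_gt0 // normrM gtr0_norm ?mulr_gt0 //.
  rewrite -[leRHS]mulr1 ler_pM2l ?mulr_gt0 // ger0_norm ?subr_ge0 //.
  by rewrite lerBlDr addrC natr1 ltW.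
- by move=> b /mapP[f _ ->].
rewrite big_map big_enum /= sumr_const card_ffun !card_ord -mulr_natr natrX.
(* Of the factor N^n = N N^k N^r, the last power cancels the number of balls and the spare N beats
   (2LC)^n / e. *)
have [k kn] : exists k, n = (r + k).+1 by exists (n - r.+1)%N; lia.
have h1 : (2 * L * C) ^+ n <= e * N%:R.
  rewrite [leRHS]mulrC -ler_pdivrMr //; apply: ltW; exact: truncnS_gt.
have h2 : 1 <= N%:R ^+ k :> R by rewrite exprn_ege1 // ler1n.
have e1 : N%:R ^+ n = N%:R * N%:R ^+ k * N%:R ^+ r :> R.
  by rewrite {1}kn exprS exprD; ring.
rewrite /rho expr_div_n mulrAC ler_pdivrMr ?exprn_gt0 // e1 mulrA.
rewrite ler_pM2r ?exprn_gt0 // mulrA; apply: le_trans h1 _.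
by rewrite ler_peMr // mulr_ge0 // ltW.
Qed.

End covering.

(** * The dichotomy *)

Section reflection.
Variables (R : realType) (n : nat).

(** Reverses the vertical axis. It transfers the bound above a plane to the points below it, and
    corrects a frame of determinant -1 into a rotation. *)
Definition lflip : 'M[R]_(n + 1) := block_mx 1%:M 0 0 (- 1%:M).

Lemma psi_lflip Q p : psi (lflip *m Q) p = psi Q (p.1, - p.2).
Proof.
rewrite /psi mulmxA /lflip mul_row_block !mulmx0 mulmx1 addr0 add0r mulmxN mulmx1.
by rewrite -raddfN.
Qed.

Lemma lflip_orthogonal (Q : 'M[R]_(n + 1)) : Q *m Q^T = 1%:M -> (lflip *m Q) *m (lflip *m Q)^T = 1%:M.
Proof.
move=> hQ; rewrite trmx_mul mulmxA -(mulmxA lflip) hQ mulmx1 /lflip tr_block_mx.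
rewrite !linear0 linearN /= !trmx1 mulmx_block !mulmx0 !mul0mx !mulmx1 mulmxN mulNmx mulmx1.
by rewrite opprK !addr0 !add0r -scalar_mx_block.
Qed.

Lemma det_lflip (Q : 'M[R]_(n + 1)) : \det (lflip *m Q) = - \det Q.
Proof.
by rewrite det_mulmx /lflip det_ublock det1 -scaleN1r detZ det1 expr1 mulr1 mul1r mulN1r.
Qed.

Lemma height_lflip (Q : 'M[R]_(n + 1)) v : Q *m Q^T = 1%:M -> height (lflip *m Q) v = - height Q v.
Proof.
move=> hQ; rewrite -{1}(prjK hQ v).
have -> : psi Q (prj Q v, height Q v) = psi (lflip *m Q) (prj Q v, - height Q v).
  by rewrite psi_lflip /= opprK.
by rewrite (height_psi (lflip_orthogonal hQ)).
Qed.

End reflection.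

Section dichotomy.
Variables (R : realType) (n : nat).
Hypothesis hn : (0 < n)%N.
Variables (P M : set 'rV[R]_(n + 1)).
Hypothesis (mP : borel_set P) (mM : borel_set M) (PM : P `&` M = set0).
Variable r0 : R.
Hypothesis r00 : 0 < r0.
Notation U := 'rV[R]_(n + 1).

Definition directions (z : U) (s : R) : set U := [set e | flatpt P M r0 (z + e) /\ enorm e < s].

(** The directions lie in the row space of a matrix with r < n rows; [pinvmx A] yields coordinates
    bounded by L, and [coverable_image] applies. *)
Lemma flatpt_coverable z s : 0 < s -> ~ frame n (directions z s) ->
  coverable (eball z s `&` flatpt P M r0).
Proof.
move=> s0 nf; have [//|[r [rn [A hA]]]] := frame_or n (directions z s).
pose L := s * \sum_i enorm (row i (pinvmx A)) + 1.
have L0 : 0 < L.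
  rewrite ltr_wpDl // mulr_ge0 ?(ltW s0) // sumr_ge0 // => i _; exact: enorm_ge0.
apply: coverable_mono (coverable_image A z rn L0) => y [ys hy].
exists ((y - z) *m pinvmx A) => [i|].
  apply: le_lt_trans (coord_le_enorm _ i) _.
  apply: le_lt_trans (@row_mul_le _ _ _ _ _ s _) _; last by rewrite /L ltrDl.
  move=> j; apply: le_trans (coord_le_enorm _ j) _; exact: ltW.
rewrite mulmxKpV; first by rewrite addrC subrK.
by apply: hA; split => //; rewrite addrC subrK.
Qed.

Lemma nflatptP z : ~ flatpt P M r0 z -> exists rho del : R, [/\ 0 < rho, 0 < del &
  forall x, enorm (x - z) < rho -> ~ (sqint P M r0 x < del%:E)%E].
Proof.
move=> nz; apply: contrapT => h; apply: nz => rho del rho0 del0.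
apply: contrapT => h'; apply: h; exists rho, del; split => // x xz Ix.
by apply: h'; exists x.
Qed.

Lemma compact_cball (x0 : U) r : compact [set x | enorm (x - x0) <= r].
Proof.
case: n hn x0 => [//|n'] _ x0.
have h : @compact 'rV[R]_(n' + 1).+1 [set x | enorm (x - x0) <= r].
  apply: bounded_closed_compact.
    exists (enorm x0 + r); split; first exact: num_real.
    move=> q hq x /= xr; apply: le_trans (ltW hq); apply: le_trans (norm_le_enorm _) _.
    rewrite -[x](subrK x0) addrC; apply: le_trans (enormD _ _) _.
    by rewrite lerD2l.
  rewrite -[X in closed X]setCK; apply: open_closedC; rewrite openE => p /= pr.
  apply/nbhs_eballP; exists (enorm (p - x0) - r).
    by rewrite subr_gt0 ltNge; exact/negP.
  move=> q; rewrite /eball /= => qp qr.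
  have := enorm_triangle q p x0; rewrite (enormB p q); lra.
exact: h.
Qed.

Lemma open_cover_by (l : seq (U * R)) : open (cover_by l).
Proof.
rewrite (_ : cover_by l = \bigcup_(b in [set` l]) eball b.1 b.2).
  by apply: bigcup_open => b _; exact: open_eball.
by apply/seteqP; split => x [b bl bx]; exists b.
Qed.

(** After covering the limit points, the rest of the closed ball is compact and free of them. The
    integral is bounded below near each remaining point, and compactness makes the bound uniform. *)
Lemma small_sqint_cover (x0 : U) e : 0 < e ->
  (forall z, enorm (z - x0) <= r0 -> flatpt P M r0 z ->
    exists2 s, 0 < s & ~ frame n (directions z s)) ->
  exists2 del : R, 0 < del & exists l : seq (U * R),
    [/\ forall x, enorm (x - x0) <= r0 -> (sqint P M r0 x < del%:E)%E -> cover_by l x,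
        forall b, b \in l -> 0 < b.2 & \sum_(b <- l) b.2 ^+ n <= e].
Proof.
move=> e0 H; pose K : set U := [set x | enorm (x - x0) <= r0].
have cK : compact K by exact: compact_cball.
have ball_nbhs (x : U) r : 0 < r -> nbhs x (eball x r).
  by move=> rp; apply/nbhs_eballP; exists r.
have : coverable (K `&` flatpt P M r0).
  apply: (@compact_ind _ K (fun A => coverable (A `&` flatpt P M r0))) => //.
  - by rewrite set0I; exact: coverable0.
  - by move=> A B AB; apply: coverable_mono; exact: setSI.
  - by move=> A B hA hB; rewrite setIUl; exact: coverableU.
  move=> x Kx; have [zx|zx] := pselect (flatpt P M r0 x).
    have [s s0 nf] := H x Kx zx.
    by exists (eball x s); [exact: ball_nbhs|exact: flatpt_coverable].
  have [rho [del [rho0 del0 h]]] := nflatptP zx.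
  exists (eball x rho); first exact: ball_nbhs.
  rewrite (_ : _ `&` _ = set0); first exact: coverable0.
  apply/seteqP; split => // y [yx zy].
  have d0 : 0 < rho - enorm (y - x) by rewrite subr_gt0.
  have [w wy Iw] := zy _ _ d0 del0; apply: (h w) => //.
  apply: le_lt_trans (enorm_triangle y w x) _; lra.
move=> /(_ e e0)[l [lK l0 le]].
have cK' : compact (K `&` ~` cover_by l).
  apply: compact_closedI => //; apply: open_closedC; exact: open_cover_by.
have [del del0 hdel] : exists2 del : R, 0 < del &
    forall x, (K `&` ~` cover_by l) x -> ~ (sqint P M r0 x < del%:E)%E.
  apply: (@compact_ind _ _ (fun A : set U => exists2 del : R, 0 < del &
    forall x, A x -> ~ (sqint P M r0 x < del%:E)%E) cK').
  - by exists 1.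
  - by move=> A B AB [d d0 hd]; exists d => // x /AB; exact: hd.
  - move=> A B [d d0 hd] [d' d'0 hd']; exists (Num.min d d'); first by rewrite lt_min d0.
    move=> x [/hd|/hd'] h /lt_le_trans hx; apply: h; apply: hx;
      by rewrite lee_fin ge_min lexx ?orbT.
  move=> x [Kx nx]; have nz : ~ flatpt P M r0 x by move=> zx; apply: nx; apply: lK.
  have [rho [d [rho0 d0 h]]] := nflatptP nz.
  exists (eball x rho); first exact: ball_nbhs.
  by exists d.
exists del => //; exists l; split => // x xK Ix; apply: contrapT => nx.
by apply: (hdel x).
Qed.

Lemma hyperplane_of_frames z : flatpt P M r0 z ->
  (forall s, 0 < s -> frame n (directions z s)) ->
  exists Q : 'M[R]_(n + 1), Q *m Q^T = 1%:M /\
    forall w : 'rV[R]_n, spanned P M r0 z (psi Q (w, 0)).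
Proof.
move=> hz hf; have [|B [fB hB]] := @frame_hyperplane R n (directions z) _ hf.
  by move=> s s' ss e [h1 h2]; split => //; exact: lt_le_trans ss.
have rB : \rank B = n by exact/eqP.
(* A normal to the row space of B, which has codimension one. *)
pose v := nz_row (kermx B^T).
have v0 : v != 0.
  rewrite nz_row_eq0 -mxrank_eq0 mxrank_ker mxrank_tr rB addKn //.
have vB : B *m v^T = 0.
  apply: trmx_inj; rewrite trmx_mul trmxK trmx0; apply/sub_kermxP; exact: nz_row_sub.
have [Q [hQ Qv]] := orthogonal_last_row v; exists Q; split => // w s s0.
have [k [A [kn GA BA]]] := hB s s0.
have wB : (psi Q (w, 0) <= B)%MS.
  have BK : (B <= kermx v^T)%MS by exact/sub_kermxP.
  have rv : \rank v^T = 1%N.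
    by rewrite mxrank_tr; apply/eqP; rewrite eqn_leq rank_leq_row lt0n mxrank_eq0.
  have KB : (kermx v^T <= B)%MS.
    by rewrite -(mxrank_leqif_sup BK) mxrank_ker rv rB addnK.
  apply: submx_trans KB; apply/sub_kermxP.
  by rewrite [LHS]mx11_scalar -dotvE dotvC Qv raddf0.
have /submxP[D ->] := submx_trans wB BA.
exists k, (fun i => row i A), (fun i => D 0 i); split => //.
exact: mulmx_sum_row.
Qed.

(** The lower bound off the plane is one-sided in the height; it is applied to Q above the plane and
    to [lflip R n *m Q] below it. *)
Lemma small_sqint_plane z Q x : Q *m Q^T = 1%:M -> flatpt P M r0 z ->
  (forall w : 'rV[R]_n, spanned P M r0 z (psi Q (w, 0))) ->
  enorm (x - z) <= 2 * r0 -> (sqint P M r0 x < (threshold R n)%:E)%E ->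
  height Q x = height Q z.
Proof.
move=> hQ hz hs xz Ix; apply/eqP; rewrite -subr_eq0 -heightB.
have hF := lflip_orthogonal hQ.
have hs' w : spanned P M r0 z (psi (lflip R n *m Q) (w, 0)).
  by rewrite psi_lflip /= oppr0.
have [h|h|//] := ltgtP (height Q (x - z)) 0.
  have := sqint_ge_threshold hF hn mP mM PM r00 hz hs' _ xz.
  by rewrite height_lflip // oppr_gt0 => /(_ h); rewrite leNgt Ix.
by have := sqint_ge_threshold hQ hn mP mM PM r00 hz hs h xz; rewrite leNgt Ix.
Qed.

Lemma plane_lipschitz_graph (Q : 'M[R]_(n + 1)) (c eta : R) : Q *m Q^T = 1%:M -> 0 <= eta ->
  lipschitz_graph eta [set v | height Q v = c].
Proof.
move=> hQ eta0.
have Lc (c' : R) (y z : 'rV[R]_n) : `|c' - c'| <= eta * enorm (y - z).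
  by rewrite subrr normr0 mulr_ge0 ?enorm_ge0.
have graphE (Q' : 'M[R]_(n + 1)) (c' : R) : Q' *m Q'^T = 1%:M ->
    [set v | height Q' v = c'] = [set row_mx y c'%:M *m Q' | y in [set: 'rV[R]_n]].
  move=> hQ'; apply/seteqP; split => v /=.
    by move=> hv; exists (prj Q' v) => //; rewrite -[RHS](prjK hQ') hv.
  by move=> [y _ <-]; rewrite -[_ *m Q']/(psi Q' (y, c')) (height_psi hQ').
have hF := lflip_orthogonal hQ.
have dQ : (\det Q) ^+ 2 = 1 by rewrite expr2 -{2}det_tr -det_mulmx hQ det1.
have [d1|d1] := eqVneq (\det Q) 1.
  exists Q, (fun=> c); split => //; exact: graphE.
exists (lflip R n *m Q), (fun=> - c); split => //.
  split => //; rewrite det_lflip.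
  by move/eqP: dQ; rewrite sqrf_eq1 (negbTE d1) /= => /eqP ->; rewrite opprK.
rewrite -graphE //; apply/seteqP; split => v /=; rewrite height_lflip //.
  by move=> ->.
by move/oppr_inj.
Qed.

Lemma measurable_plane (Q : 'M[R]_(n + 1)) (c : R) : Q *m Q^T = 1%:M -> borel_set [set v | height Q v = c].
Proof.
move=> hQ; rewrite -[X in borel_set X]setCK; apply: measurableC; apply: open_borel_set.
rewrite openE => p /= pc; apply/nbhs_eballP; exists `|height Q p - c|.
  by rewrite normr_gt0 subr_eq0; exact/eqP.
move=> q; rewrite /eball /= => qp qc.
have := height_le hQ (q - p); rewrite heightB qc distrC => /le_lt_trans /(_ qp).
by rewrite ltxx.
Qed.

Lemma measure_cover_by (mu : {measure set (borelV R (n + 1)) -> \bar R}) (l : seq (U * R)) :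
  (forall x r, 0 < r -> (mu (eball x r) <= (r ^+ n)%:E)%E) ->
  (forall b, b \in l -> 0 < b.2) ->
  (mu (cover_by l) <= (\sum_(b <- l) b.2 ^+ n)%:E)%E.
Proof.
move=> hmu; elim: l => [_|b l IH bl].
  rewrite big_nil (_ : cover_by _ = set0) ?measure0 //.
  by apply/seteqP; split => // x [].
have mC : borel_set (cover_by l) by apply: open_borel_set; exact: open_cover_by.
rewrite big_cons EFinD (_ : cover_by _ = eball b.1 b.2 `|` cover_by l); last first.
  apply/seteqP; split => x.
    move=> [b']; rewrite inE => /orP[/eqP->|b'l]; [by left|by right; exists b'].
  move=> [xb|[b' b'l xb']]; [by exists b; rewrite ?mem_head|].
  by exists b' => //; rewrite inE b'l orbT.
apply: le_trans (measureU2 _ (eball_measurable _ _) mC) _; apply: leeD.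
  by apply: hmu; apply: bl; rewrite mem_head.
by apply: IH => b' b'l; apply: bl; rewrite inE b'l orbT.
Qed.

End dichotomy.

(** * Conclusion: a plane of slope 0, or a contradiction *)

Lemma lipschitz_graph_large_measure (R : realType) (n : nat) (P M : set 'rV[R]_(n + 1))
    (x0 : 'rV[R]_(n + 1)) (r0 c0 eta : R) : (0 < n)%N ->
  borel_set P -> borel_set M -> P `&` M = set0 -> 0 < r0 -> 0 < c0 -> 0 <= eta ->
  exists delta : R, 0 < delta /\
    forall (E : set 'rV[R]_(n + 1)) (mu : {measure set (borelV R (n + 1)) -> \bar R}),
      borel_set E -> E `<=` eball x0 r0 -> mu (~` E) = 0%E ->
      (forall x r, 0 < r -> (mu (eball x r) <= (r ^+ n)%:E)%E) ->
      ((c0 * r0 ^+ n)%:E <= mu (eball x0 r0))%E ->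
      (forall x, E x -> (sqint P M r0 x < delta%:E)%E) ->
      exists G, lipschitz_graph eta G /\ ((99 / 100)%:E * mu (eball x0 r0) <= mu G)%E.
Proof.
move=> hn mP mM PM r00 c00 eta0.
have sub (E S : set 'rV[R]_(n + 1)) (mu : {measure set (borelV R (n + 1)) -> \bar R}) :
    borel_set E -> borel_set S -> mu (~` E) = 0%E -> E `<=` S -> (mu (eball x0 r0) <= mu S)%E.
  move=> mE mS muE ES; rewrite -[leRHS]adde0 -muE.
  have mCE := measurableC mE.
  apply: le_trans (measureU2 mu mS mCE).
  apply: le_measure; rewrite ?inE; [exact: eball_measurable|exact: measurableU|].
  by move=> x _; have [/ES|] := pselect (E x); [left|right].
have [[z [zx0 [hz hf]]]|H] := pselect (exists z, enorm (z - x0) <= r0 /\ flatpt P M r0 z /\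
    forall s, 0 < s -> frame n (directions P M r0 z s)).
  have [Q [hQ hs]] := hyperplane_of_frames hz hf.
  exists (threshold R n); split.
    by rewrite divr_gt0 // exprn_gt0 // divr_gt0 ?covK_gt0 // exprn_gt0 // divr_gt0.
  move=> E mu mE EB muE _ _ hE; exists [set v | height Q v = height Q z]; split.
    exact: plane_lipschitz_graph.
  apply: (@le_trans _ _ (mu (eball x0 r0))).
    rewrite -[leRHS]mul1e; apply: lee_wpmul2r; first exact: measure_ge0.
    by rewrite lee_fin ler_pdivrMr // mul1r ler_nat.
  apply: (sub E) => //; first exact: measurable_plane.
  move=> x Ex; apply: (small_sqint_plane hn mP mM PM r00 hQ hz hs); last exact: hE.
  apply: le_trans (enorm_triangle x0 x z) _; rewrite (enormB x0 z).
  have := EB x Ex; rewrite /eball /= => h; lra.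
(* Half of the assumed lower bound on the mass, so that the cover contradicts it strictly. *)
have e0 : 0 < c0 * r0 ^+ n / 2 by rewrite divr_gt0 // mulr_gt0 // exprn_gt0.
have [|del del0 [l [hl l0 le]]] := @small_sqint_cover _ _ hn P M r0 x0 _ e0.
  move=> z zx0 hz; apply: contrapT => h; apply: H; exists z; split => //; split => // s s0.
  by apply: contrapT => h'; apply: h; exists s.
exists del; split => // E mu mE EB muE hmu hlow hE; exfalso.
have : (mu (eball x0 r0) <= (c0 * r0 ^+ n / 2)%:E)%E.
  apply: le_trans (_ : (_ <= mu (cover_by l))%E) _.
    apply: (sub E) => //; first by apply: open_borel_set; exact: open_cover_by.
    by move=> x Ex; apply: hl; [apply: ltW; exact: EB|exact: hE].
  by apply: le_trans (measure_cover_by hmu l0) _; rewrite lee_fin.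
move=> /(le_trans hlow); rewrite lee_fin; lra.
Qed.

Theorem mainTheorem2 (R : realType) (n : nat) (hn : (1 <= n)%N)
    (Op Om : set 'rV[R]_(n + 1))
    (hOp : borel_set Op) (hOm : borel_set Om) (hdisj : Op `&` Om = set0)
    (c0 : R) (hc0 : 0 < c0 < 1)
    (x0 : 'rV[R]_(n + 1)) (r0 : R) (hr0 : 0 < r0) :
  (exists delta : R, 0 < delta /\
    forall (E : set 'rV[R]_(n + 1))
           (mu : {measure set (borelV R (n + 1)) -> \bar R}),
      borel_set E -> E `<=` eball x0 r0 ->
      radon mu -> mu (~` E) = 0%E ->
      (forall (x : 'rV[R]_(n + 1)) (r : R), 0 < r ->
         (mu (eball x r) <= (r ^+ n)%:E)%E) ->
      ((c0 * r0 ^+ n)%:E <= mu (eball x0 r0))%E ->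
      (forall x : 'rV[R]_(n + 1), E x ->
         (\int[lebesgue_measure]_(r in `]0%R, (20 * r0)%R[)
            ((epsilon_coef Op Om x r) ^+ 2 * (r^-1)%:E) < delta%:E)%E) ->
      exists G : set 'rV[R]_(n + 1),
        lipschitz_graph (1 / 10) G /\
        ((99 / 100)%:E * mu (eball x0 r0) <= mu G)%E)
  /\
  (forall eta : R, 0 < eta <= 1 / 10 ->
   exists delta : R, 0 < delta /\
    forall (E : set 'rV[R]_(n + 1))
           (mu : {measure set (borelV R (n + 1)) -> \bar R}),
      borel_set E -> E `<=` eball x0 r0 ->
      radon mu -> mu (~` E) = 0%E ->
      (forall (x : 'rV[R]_(n + 1)) (r : R), 0 < r ->
         (mu (eball x r) <= (r ^+ n)%:E)%E) ->
      ((c0 * r0 ^+ n)%:E <= mu (eball x0 r0))%E ->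
      (forall x : 'rV[R]_(n + 1), E x ->
         (\int[lebesgue_measure]_(r in `]0%R, (20 * r0)%R[)
            ((epsilon_coef Op Om x r) ^+ 2 * (r^-1)%:E) < delta%:E)%E) ->
      exists G : set 'rV[R]_(n + 1),
        lipschitz_graph eta G /\
        ((99 / 100)%:E * mu (eball x0 r0) <= mu G)%E).
Proof.
move: hc0 => /andP[c00 _].
have main eta : 0 <= eta -> _ := fun h => lipschitz_graph_large_measure x0 hn hOp hOm hdisj hr0 c00 h.
split=> [|eta /andP[eta0 _]].
  have [|delta [delta0 H]] := main (1 / 10); first by rewrite divr_ge0.
  exists delta; split => // E mu mE EB _; exact: H.
have [delta [delta0 H]] := main eta (ltW eta0).
exists delta; split => // E mu mE EB _; exact: H.
Qed.
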